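(* If $t^*\in\mathbb{R}$ is a local extremum point of $\Xi(t)$, then the point $(\sigma,t)=(\tfrac12,t^* )$ is a saddle point of the real-valued function $(\sigma,t)\mapsto\Re\{\xi(\sigma+it)\}$ on $\mathbb{R}^2$.
   Context: Riemann's $\xi$ function is the entire function $\xi(s)=\frac{s(s-1)}{2}\pi^{-s/2}\Gamma(s/2)\zeta(s)$, where $\zeta(s)$ is the Riemann zeta function (defined by $\sum_{n\ge1}n^{-s}$ for $\Re(s)>1$ and extended by analytic continuation). For real $t$, $\Xi(t)=\xi(\tfrac12+it)$, which is a real-valued function of $t$. A saddle point of a smooth real function is a critical point that is not a local extremum. *)

(* Defs.v *)
From Stdlib Require Import Reals.
From Coquelicot Require Import Coquelicot.

Open Scope R_scope.

Definition Cexp (z : C) : C :=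
  (exp (Re z) * cos (Im z), exp (Re z) * sin (Im z)).

(* x^s = e^(s ln x), meaningful for x > 0 only. *)
Definition Rcpow (x : R) (s : C) : C := Cexp (s * ln x)%C.

(* [ex_derive] over the absolute ring C is complex differentiability. *)
Definition holomorphic_at (f : C -> C) (s : C) : Prop :=
  @ex_derive C_AbsRing C_NormedModule f s.

Definition entire (f : C -> C) : Prop := forall s : C, holomorphic_at f s.

(* Since C \ {1} is connected, these two clauses determine [zeta] at every
   s <> 1; its value at the pole is left free. *)
Definition is_riemann_zeta (zeta : C -> C) : Prop :=
  (forall s : C, 1 < Re s ->
     @is_series C_AbsRing C_NormedModule
       (fun n : nat => Rcpow (INR (S n)) (- s)%C) (zeta s)) /\
  (forall s : C, s <> RtoC 1 -> holomorphic_at zeta s).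

(* Euler's integral for Re s > 0, continued to C \ {0, -1, -2, ...}; the
   values at the poles are left free. *)
Definition is_gamma (Gamma : C -> C) : Prop :=
  (forall s : C, 0 < Re s ->
     @is_RInt_gen C_R_NormedModule
       (fun x : R => (Rcpow x (s - 1) * exp (- x))%C)
       (at_right 0) (Rbar_locally p_infty) (Gamma s)) /\
  (forall s : C, (forall n : nat, s <> RtoC (- INR n)) ->
     holomorphic_at Gamma s).

(* The product formula is required away from the poles of zeta(s) (s = 1) and
   of Gamma(s/2) (s = 0, -2, -4, ...); there xi is fixed by continuity. *)
Definition is_riemann_xi (xi : C -> C) : Prop :=
  entire xi /\
  exists zeta Gamma : C -> C,
    is_riemann_zeta zeta /\ is_gamma Gamma /\
    forall s : C, s <> RtoC 1 -> (forall n : nat, s <> RtoC (- (2 * INR n))) ->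
      xi s = (s * (s - 1) / 2 * Rcpow PI (- s / 2) * Gamma (s / 2) * zeta s)%C.

(* xi(1/2 + it) is real, so taking [Re] only changes the type. *)
Definition Xi (xi : C -> C) (t : R) : R := Re (xi (RtoC (1 / 2) + Ci * t)%C).

Definition is_local_max (f : R -> R) (t : R) : Prop :=
  locally t (fun u => f u <= f t).

Definition is_local_min (f : R -> R) (t : R) : Prop :=
  locally t (fun u => f t <= f u).

Definition is_local_extremum (f : R -> R) (t : R) : Prop :=
  is_local_max f t \/ is_local_min f t.

Definition is_local_max_2d (f : R -> R -> R) (x y : R) : Prop :=
  locally_2d (fun u v => f u v <= f x y) x y.

Definition is_local_min_2d (f : R -> R -> R) (x y : R) : Prop :=
  locally_2d (fun u v => f x y <= f u v) x y.

Definition is_local_extremum_2d (f : R -> R -> R) (x y : R) : Prop :=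
  is_local_max_2d f x y \/ is_local_min_2d f x y.

Definition is_critical_point (f : R -> R -> R) (x y : R) : Prop :=
  differentiable_pt_lim f x y 0 0.

Definition is_saddle_point (f : R -> R -> R) (x y : R) : Prop :=
  is_critical_point f x y /\ ~ is_local_extremum_2d f x y.

(* Main.v *)
Require Import Defs.
From Stdlib Require Import Reals ZArith Lra Lia Psatz.
From Coquelicot Require Import Coquelicot.
Open Scope R_scope.

(** The function [xi] is real on the critical line, so there the Cauchy-Riemann
    equations give [d/dsigma Re xi = d/dt Im xi = 0]; with [Xi' (tstar) = 0] the
    point is critical.  [Re xi] is harmonic and not constant, hence has no local
    extremum at all.

    Complex analysis.  Goursat's bisection argument gives the vanishing of the
    integral of an entire function along a rectangle; applied to [f (z0 + e^w)] on a
    rectangle of height [2 pi] it yields the mean value property, from which both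
    the maximum principle and the identity theorem follow.

    Reality on the critical line.  The functional equation of the theta function is
    obtained, following Polya, by summing [(2 cos y)^(2m)] over roots of unity and
    letting [m] tend to infinity.  Riemann's integral representation then exhibits
    an entire function that is visibly real on the critical line and coincides
    with [xi] for [Re s > 3], hence everywhere. *)

(** * Complex derivatives *)

(** [entire] provides a derivative at each point but no continuity of it, so Green's theorem is out
    of reach and the integral theorem has to come from bisection. The substitution [z0 + e^w] keeps
    every contour a rectangle: circles become vertical segments, and neither Cauchy's formula nor
    power series enter. The formula for [xi] is only tractable where the Dirichlet series and the
    Mellin integrals converge together, so an identity theorem starting from a half-plane is the
    natural form; a disc reduces to it through [w -> z0 + e^(-w)]. Polya's argument replaces Fourier
    analysis by finite identities and dominated limits. Its normalizing constant is read off at the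
    fixed point [x = 1] of [x -> 1/x]. [xi] is not constant because its theta form equals 1/2 at 0,
    where [s (s - 1)] vanishes, and exceeds 1/2 at 2, where positive Laplace transforms are
    multiplied by 2. *)

Definition Cderiv (f : C -> C) (s d : C) : Prop :=
  @is_derive C_AbsRing (AbsRing_NormedModule C_AbsRing) f s d.

Lemma Cderiv_eps (f : C -> C) (s d : C) :
  Cderiv f s d <->
  forall eps : R, 0 < eps -> exists delta : R, 0 < delta /\
    forall h : C, Cmod h < delta ->
      Cmod (f (s + h) - f s - h * d)%C <= eps * Cmod h.
Proof.
  split.
  - intros [_ H] eps Heps.
    destruct (H s (fun P HP => HP) (mkposreal eps Heps)) as [delta Hd].
    exists delta; split; [apply cond_pos|]. intros h Hh.
    assert (E : (s + h - s)%C = h) by ring.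
    specialize (Hd (s + h)%C).
    assert (B : @ball (AbsRing_UniformSpace C_AbsRing) s delta (s + h)%C).
    { change (Cmod (s + h - s)%C < delta). now rewrite E. }
    specialize (Hd B).
    change (Cmod ((f (s + h) - f s) - (s + h - s) * d)%C <= eps * Cmod (s + h - s)%C) in Hd.
    now rewrite E in Hd.
  - intros H. split.
    + apply is_linear_scal_l.
    + intros x Hx.
      pose proof (@is_filter_lim_locally_unique C_AbsRing (AbsRing_NormedModule C_AbsRing) s x Hx) as E; subst x.
      intros eps. destruct (H eps (cond_pos eps)) as [delta [Hd H']].
      assert (K : forall y : C, Cmod (y - s)%C < delta ->
        Cmod ((f y - f s) - (y - s) * d)%C <= eps * Cmod (y - s)%C).
      { intros y Hy. specialize (H' _ Hy).
        now replace (s + (y - s))%C with y in H' by ring. }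
      exists (mkposreal delta Hd). exact K.
Qed.

(** The two notions differ in the module structure put on the target: [Cderiv] views the ring as a
    module over itself, the form in which the product and chain rules are stated. The little-o
    condition only sees the norm, which is [Cmod] in both. *)
Lemma holomorphic_Cderiv (f : C -> C) (s : C) :
  holomorphic_at f s <-> exists d, Cderiv f s d.
Proof.
  split; intros [d [_ H]]; exists d; (split; [apply is_linear_scal_l|]);
    intros x Hx; exact (H x Hx).
Qed.

Lemma Cderiv_const (c s : C) : Cderiv (fun _ => c) s 0%C.
Proof. exact (@is_derive_const C_AbsRing (AbsRing_NormedModule C_AbsRing) c s). Qed.

Lemma Cderiv_id (s : C) : Cderiv (fun z => z) s 1%C.
Proof. exact (@is_derive_id C_AbsRing s). Qed.

Lemma Cderiv_plus (f g : C -> C) (s df dg : C) :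
  Cderiv f s df -> Cderiv g s dg -> Cderiv (fun z => f z + g z)%C s (df + dg)%C.
Proof. exact (@is_derive_plus C_AbsRing (AbsRing_NormedModule C_AbsRing) f g s df dg). Qed.

Lemma Cderiv_mult (f g : C -> C) (s df dg : C) :
  Cderiv f s df -> Cderiv g s dg ->
  Cderiv (fun z => f z * g z)%C s (df * g s + f s * dg)%C.
Proof.
  intros Hf Hg. exact (@is_derive_mult C_AbsRing f g s df dg Hf Hg Cmult_comm).
Qed.

Lemma Cderiv_comp (f g : C -> C) (s df dg : C) :
  Cderiv f (g s) df -> Cderiv g s dg -> Cderiv (fun z => f (g z)) s (dg * df)%C.
Proof. exact (@is_derive_comp C_AbsRing (AbsRing_NormedModule C_AbsRing) f g s df dg). Qed.

Lemma entire_const (c : C) : entire (fun _ => c).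
Proof. intros s. apply holomorphic_Cderiv. eexists. apply Cderiv_const. Qed.

Lemma entire_id : entire (fun z => z).
Proof. intros s. apply holomorphic_Cderiv. eexists. apply Cderiv_id. Qed.

Lemma entire_plus (f g : C -> C) : entire f -> entire g -> entire (fun z => f z + g z)%C.
Proof.
  intros Hf Hg s. apply holomorphic_Cderiv.
  destruct (proj1 (holomorphic_Cderiv _ _) (Hf s)), (proj1 (holomorphic_Cderiv _ _) (Hg s)).
  eexists. eapply Cderiv_plus; eassumption.
Qed.

Lemma entire_mult (f g : C -> C) : entire f -> entire g -> entire (fun z => f z * g z)%C.
Proof.
  intros Hf Hg s. apply holomorphic_Cderiv.
  destruct (proj1 (holomorphic_Cderiv _ _) (Hf s)), (proj1 (holomorphic_Cderiv _ _) (Hg s)).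
  eexists. eapply Cderiv_mult; eassumption.
Qed.

Lemma entire_comp (f g : C -> C) : entire f -> entire g -> entire (fun z => f (g z)).
Proof.
  intros Hf Hg s. apply holomorphic_Cderiv.
  destruct (proj1 (holomorphic_Cderiv _ _) (Hf (g s))), (proj1 (holomorphic_Cderiv _ _) (Hg s)).
  eexists. eapply Cderiv_comp; eassumption.
Qed.

Lemma entire_ext (f g : C -> C) : (forall z, f z = g z) -> entire f -> entire g.
Proof.
  intros E H s. unfold holomorphic_at. eapply (ex_derive_ext (V := C_NormedModule)); [|exact (H s)].
  exact E.
Qed.

(** * Elementary estimates and the complex exponential *)

Lemma Cmod_le_Re_Im (z : C) : Cmod z <= Rabs (Re z) + Rabs (Im z).
Proof.
  unfold Cmod. apply Rsqr_incr_0_var.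
  - rewrite Rsqr_sqrt by nra. unfold Rsqr, Re, Im. rewrite <- (pow2_abs (fst z)), <- (pow2_abs (snd z)).
    pose proof (Rabs_pos (fst z)); pose proof (Rabs_pos (snd z)). nra.
  - pose proof (Rabs_pos (Re z)); pose proof (Rabs_pos (Im z)). lra.
Qed.

Lemma Cmod_sqr (z : C) : Cmod z * Cmod z = Re z * Re z + Im z * Im z.
Proof. unfold Cmod, Re, Im. rewrite sqrt_sqrt; nra. Qed.

Lemma Im_le_Cmod (z : C) : Rabs (Im z) <= Cmod z.
Proof.
  apply Rle_trans with (2 := Rmax_Cmod z). apply Rmax_r.
Qed.

Lemma exp_le (x y : R) : x <= y -> exp x <= exp y.
Proof. intros [H| ->]; [left; now apply exp_increasing|right; reflexivity]. Qed.

Lemma exp_sub_1_le (x : R) : exp x - 1 <= x * exp x.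
Proof.
  pose proof (exp_ineq1_le (- x)). rewrite exp_Ropp in H.
  pose proof (exp_pos x).
  assert (/ exp x * exp x = 1) by (apply Rinv_l; lra). nra.
Qed.

Lemma exp_sub_1_abs (x : R) : Rabs (exp x - 1) <= Rabs x * exp (Rabs x).
Proof.
  pose proof (exp_sub_1_le x). pose proof (exp_ineq1_le x).
  unfold Rabs at 2 3. destruct (Rcase_abs x).
  - assert (exp x < 1) by (rewrite <- exp_0; apply exp_increasing; lra).
    rewrite Rabs_left by lra.
    assert (1 <= exp (- x)) by (rewrite <- exp_0; apply exp_le; lra). nra.
  - rewrite Rabs_pos_eq; lra.
Qed.

Lemma exp_taylor1 (x : R) : Rabs (exp x - 1 - x) <= x * x * exp (Rabs x).
Proof.
  pose proof (exp_sub_1_le x). pose proof (exp_ineq1_le x).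
  rewrite Rabs_pos_eq by lra. pose proof (exp_pos x).
  unfold Rabs; destruct (Rcase_abs x).
  - assert (1 <= exp (- x)) by (rewrite <- exp_0; apply exp_le; lra). nra.
  - nra.
Qed.

Lemma sin_abs_le (x : R) : Rabs (sin x) <= Rabs x.
Proof.
  destruct (Req_dec x 0) as [-> | Hx]. { rewrite sin_0, Rabs_R0. lra. }
  destruct (MVT_gen sin 0 x cos) as [c [_ Hc]].
  - intros. auto_derive; [trivial|ring].
  - intros. apply continuity_sin.
  - rewrite sin_0, !Rminus_0_r in Hc. rewrite Hc, Rabs_mult.
    assert (Rabs (cos c) <= 1) by (apply Rabs_le; apply COS_bound).
    pose proof (Rabs_pos x). nra.
Qed.

Lemma one_sub_cos (x : R) : 1 - cos x = 2 * (sin (x / 2) * sin (x / 2)).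
Proof.
  replace x with (2 * (x / 2)) at 1 by field. rewrite cos_2a_sin. ring.
Qed.

Lemma one_sub_cos_le (x : R) : 1 - cos x <= x * x / 2.
Proof.
  rewrite one_sub_cos. pose proof (sin_abs_le (x / 2)) as H.
  apply Rsqr_le_abs_1 in H. unfold Rsqr in H. lra.
Qed.

Lemma one_sub_cos_le_abs (x : R) : 1 - cos x <= Rabs x.
Proof.
  rewrite one_sub_cos. pose proof (sin_abs_le (x / 2)) as H.
  assert (H1 : Rabs (sin (x/2)) <= 1) by (apply Rabs_le; apply SIN_bound).
  assert (H2 : sin (x / 2) * sin (x / 2) = Rabs (sin (x / 2)) * Rabs (sin (x / 2))).
  { rewrite <- Rabs_mult, Rabs_pos_eq; nra. }
  rewrite (Rabs_div x 2), (Rabs_pos_eq 2) in H by lra.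
  pose proof (Rabs_pos (sin (x/2))). rewrite H2. nra.
Qed.

Lemma sin_taylor1 (y : R) : Rabs (sin y - y) <= y * y.
Proof.
  destruct (MVT_gen (fun t => sin t - t) 0 y (fun t => cos t - 1)) as [c [Hc E]].
  - intros. auto_derive; [trivial|ring].
  - intros. apply continuity_pt_minus; [apply continuity_sin|apply derivable_continuous_pt, derivable_pt_id].
  - rewrite sin_0, !Rminus_0_r in E. rewrite E, Rabs_mult.
    rewrite Rabs_minus_sym, (Rabs_pos_eq (1 - _)) by (pose proof (COS_bound c); lra).
    pose proof (one_sub_cos_le_abs c).
    assert (Rabs c <= Rabs y).
    { unfold Rmin, Rmax, Rabs in *. destruct (Rle_dec 0 y), (Rcase_abs c), (Rcase_abs y); lra. }
    replace (y * y) with (Rabs y * Rabs y) by (rewrite <- Rabs_mult; apply Rabs_pos_eq; nra).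
    apply Rmult_le_compat_r; [apply Rabs_pos|lra].
Qed.

(** Only the order 2 in [Cmod z] matters. It serves twice: for the derivative of the exponential
    and, with [z = h * u], for differentiating Laplace transforms under the integral sign. *)
Lemma Cexp_taylor1 (z : C) : Cmod (Cexp z - 1 - z)%C <= 2 * Cmod z ^ 2 * exp (Cmod z).
Proof.
  assert (HE : exp (Rabs (Re z)) <= exp (Cmod z)) by (apply exp_le, re_le_Cmod).
  pose proof (Cmod_sqr z) as Hm. simpl (Cmod z ^ 2). rewrite Rmult_1_r, Hm. clear Hm.
  eapply Rle_trans; [apply Cmod_le_Re_Im|].
  destruct z as [x y]. unfold Cexp. simpl in *.
  set (E := exp (Rabs x)) in *. set (E' := exp (Cmod (x, y))) in *.
  replace (exp x * cos y + - (1) + - x) with ((exp x - 1 - x) - exp x * (1 - cos y)) by ring.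
  replace (exp x * sin y + - 0 + - y) with (exp x * (sin y - y) + y * (exp x - 1)) by ring.
  pose proof (exp_taylor1 x) as H1. pose proof (exp_sub_1_abs x) as H2. fold E in H1, H2.
  pose proof (sin_taylor1 y) as H3. pose proof (one_sub_cos_le y) as H4.
  assert (H5 : 0 <= 1 - cos y) by (pose proof (COS_bound y); lra).
  assert (HxE : exp x <= E) by (apply exp_le, Rle_abs).
  pose proof (exp_pos x) as Hp.
  assert (A : Rabs (exp x - 1 - x - exp x * (1 - cos y)) <= x * x * E + E * (y * y / 2)).
  { eapply Rle_trans; [apply Rabs_triang|]. rewrite Rabs_Ropp, Rabs_mult, (Rabs_pos_eq (exp x)), (Rabs_pos_eq (1 - _)) by lra. nra. }
  assert (B : Rabs (exp x * (sin y - y) + y * (exp x - 1)) <= E * (y * y) + Rabs y * (Rabs x * E)).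
  { eapply Rle_trans; [apply Rabs_triang|]. rewrite !Rabs_mult, (Rabs_pos_eq (exp x)) by lra.
    pose proof (Rabs_pos (sin y - y)). pose proof (Rabs_pos y).
    apply Rplus_le_compat; [apply Rmult_le_compat; lra|apply Rmult_le_compat_l; lra]. }
  assert (D : Rabs y * Rabs x <= (x * x + y * y) / 2).
  { rewrite <- Rabs_mult. apply Rabs_le. pose proof (Rle_0_sqr (x + y)); pose proof (Rle_0_sqr (x - y)). unfold Rsqr in *. split; lra. }
  assert (0 < E) by apply exp_pos.
  assert (Rabs y * (Rabs x * E) <= (x * x + y * y) / 2 * E) by nra.
  nra.
Qed.

Lemma Cexp_plus (z w : C) : Cexp (z + w) = (Cexp z * Cexp w)%C.
Proof.
  destruct z as [a b], w as [c d]. unfold Cexp, Cmult. simpl.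
  rewrite exp_plus, cos_plus, sin_plus. f_equal; ring.
Qed.

Lemma Cexp_RtoC (x : R) : Cexp x = RtoC (exp x).
Proof. unfold Cexp, RtoC. simpl. rewrite cos_0, sin_0. f_equal; ring. Qed.

Lemma Cexp_0 : Cexp 0 = 1%C.
Proof. rewrite Cexp_RtoC, exp_0. reflexivity. Qed.

Lemma Cmod_Cexp (z : C) : Cmod (Cexp z) = exp (Re z).
Proof.
  destruct z as [a b]. unfold Cexp, Cmod. simpl.
  replace (_ + _) with (Rsqr (exp a) * (Rsqr (sin b) + Rsqr (cos b))) by (unfold Rsqr; ring).
  rewrite sin2_cos2, Rmult_1_r. apply sqrt_Rsqr. left. apply exp_pos.
Qed.

Lemma Cderiv_Cexp (s : C) : Cderiv Cexp s (Cexp s).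
Proof.
  apply Cderiv_eps. intros eps Heps.
  set (M := exp (Re s) * 2 * exp 1).
  assert (HM : 0 < M) by (unfold M; pose proof (exp_pos (Re s)); pose proof (exp_pos 1); nra).
  exists (Rmin 1 (eps / M)). split.
  { apply Rmin_glb_lt; [lra|]. now apply Rdiv_lt_0_compat. }
  intros h Hh.
  assert (H1 : Cmod h < 1) by (eapply Rlt_le_trans; [exact Hh|apply Rmin_l]).
  assert (H2 : Cmod h < eps / M) by (eapply Rlt_le_trans; [exact Hh|apply Rmin_r]).
  rewrite Cexp_plus.
  replace (Cexp s * Cexp h - Cexp s - h * Cexp s)%C with (Cexp s * (Cexp h - 1 - h))%C by ring.
  rewrite Cmod_mult, Cmod_Cexp.
  pose proof (Cexp_taylor1 h) as T. pose proof (exp_pos (Re s)).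
  assert (exp (Cmod h) <= exp 1) by (apply exp_le; lra).
  pose proof (Cmod_ge_0 h) as G.
  assert (H3 : Cmod h * M <= eps).
  { apply Rmult_le_reg_r with (/ M); [now apply Rinv_0_lt_compat|].
    rewrite Rmult_assoc, Rinv_r by lra. unfold Rdiv in H2. lra. }
  apply Rle_trans with (exp (Re s) * (2 * Cmod h ^ 2 * exp 1)).
  - apply Rmult_le_compat_l; [lra|]. eapply Rle_trans; [exact T|].
    apply Rmult_le_compat_l; [simpl; nra|lra].
  - replace (exp (Re s) * (2 * Cmod h ^ 2 * exp 1)) with (Cmod h * (Cmod h * M)) by (unfold M; ring).
    nra.
Qed.

Lemma entire_Cexp : entire Cexp.
Proof. intros s. apply holomorphic_Cderiv. eexists. apply Cderiv_Cexp. Qed.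

(** The Cauchy-Riemann equations: the real differential of [f] is multiplication by [d], whose
    matrix has rows [(Re d, - Im d)] and [(Im d, Re d)]. *)
Lemma Cderiv_partials (f : C -> C) (x y : R) (d : C) :
  Cderiv f (x, y) d ->
  differentiable_pt_lim (fun u v => Re (f (u, v))) x y (Re d) (- Im d) /\
  differentiable_pt_lim (fun u v => Im (f (u, v))) x y (Im d) (Re d).
Proof.
  intros H.
  assert (K : forall eps : posreal, locally_2d (fun u v =>
      Cmod (f (u, v) - f (x, y) - ((u - x)%R, (v - y)%R) * d)%C <= eps * Rmax (Rabs (u - x)) (Rabs (v - y))) x y).
  (* The modulus of the increment is at most twice the larger coordinate, hence the halves of [eps]
     and [delta]. *)
  { intros eps. assert (He : 0 < eps / 2) by (pose proof (cond_pos eps); lra).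
    destruct (proj1 (Cderiv_eps f (x, y) d) H _ He) as [delta [Hd Hf]].
    assert (Hd2 : 0 < delta / 2) by lra.
    exists (mkposreal _ Hd2). simpl. intros u v Hu Hv.
    assert (Hm : Cmod (u - x, v - y) <= Rabs (u - x) + Rabs (v - y)) by apply Cmod_le_Re_Im.
    specialize (Hf (u - x, v - y) ltac:(lra)).
    replace ((x, y) + ((u - x)%R, (v - y)%R))%C with (u, v) in Hf by (unfold Cplus; simpl; f_equal; ring).
    eapply Rle_trans; [exact Hf|].
    pose proof (Rmax_l (Rabs (u - x)) (Rabs (v - y))). pose proof (Rmax_r (Rabs (u - x)) (Rabs (v - y))).
    nra. }
  split; intros eps; destruct (K eps) as [delta Hd]; exists delta; intros u v Hu Hv;
    (eapply Rle_trans; [|exact (Hd u v Hu Hv)]).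
  - eapply Rle_trans; [|apply re_le_Cmod]. right. f_equal. destruct (f (u,v)), (f (x,y)), d. simpl. ring.
  - eapply Rle_trans; [|apply Im_le_Cmod]. right. f_equal. destruct (f (u,v)), (f (x,y)), d. simpl. ring.
Qed.

(** * Goursat's theorem on rectangles *)

(** The shared [b] is the closedness condition: the y-partial of [P] is the x-partial of [Q]. Total
    differentiability is asked point by point, without continuity of the partials. *)
Definition closed_form (P Q : R -> R -> R) : Prop :=
  forall x y, exists a b c,
    differentiable_pt_lim P x y a b /\ differentiable_pt_lim Q x y b c.

Lemma differentiable_pt_lim_continuous (f : R -> R -> R) (x y a b : R) :
  differentiable_pt_lim f x y a b ->
  continuous (fun u => f u y) x /\ continuous (fun v => f x v) y.
Proof.
  intros H.
  assert (K : continuity_2d_pt f x y).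
  { apply differentiable_continuity_pt. exists a, b. exact H. }
  split; apply continuity_pt_filterlim, continuity_pt_locally;
    intros eps; specialize (K eps).
  - exact (locally_2d_1d_const_y _ _ _ K).
  - exact (locally_2d_1d_const_x _ _ _ K).
Qed.

Lemma closed_form_continuous (P Q : R -> R -> R) : closed_form P Q ->
  (forall x y, continuous (fun u => P u y) x) /\ (forall x y, continuous (fun v => Q x v) y).
Proof.
  intros H. split; intros x y; destruct (H x y) as (a & b & c & HP & HQ);
    eapply differentiable_pt_lim_continuous; eassumption.
Qed.

Lemma ex_RInt_minus_continuous (f g : R -> R) (a b : R) :
  (forall x, continuous f x) -> (forall x, continuous g x) ->
  ex_RInt (fun x => f x - g x) a b.
Proof.
  intros Hf Hg. apply (ex_RInt_continuous (V := R_CompleteNormedModule)). intros z _.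
  now apply (continuous_minus f g).
Qed.

(* The integral of [P dx + Q dy] along the boundary of [x, x+w] x [y, y+h]. *)
Definition rect_int (P Q : R -> R -> R) (x y w h : R) : R :=
  RInt (fun u => P u y - P u (y + h)) x (x + w) +
  RInt (fun v => Q (x + w) v - Q x v) y (y + h).

Lemma rect_int_split_x (P Q : R -> R -> R) (x y w w' h : R) : closed_form P Q ->
  rect_int P Q x y (w + w') h = rect_int P Q x y w h + rect_int P Q (x + w) y w' h.
Proof.
  intros H. destruct (closed_form_continuous _ _ H) as [HP HQ]. unfold rect_int.
  rewrite <- (RInt_Chasles (V := R_CompleteNormedModule) _ x (x + w) (x + (w + w')))
    by (apply ex_RInt_minus_continuous; intros; apply HP).
  rewrite <- !Rplus_assoc.
  rewrite (RInt_ext (fun v => Q (x + w + w') v - Q x v)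
     (fun v => plus (Q (x + w) v - Q x v) (Q (x + w + w') v - Q (x + w) v)))
    by (intros; unfold plus; simpl; ring).
  rewrite (RInt_plus (V := R_CompleteNormedModule)
      (fun v => Q (x + w) v - Q x v) (fun v => Q (x + w + w') v - Q (x + w) v))
    by (apply ex_RInt_minus_continuous; intros; apply HQ).
  unfold plus; simpl. ring.
Qed.

Lemma rect_int_split_y (P Q : R -> R -> R) (x y w h h' : R) : closed_form P Q ->
  rect_int P Q x y w (h + h') = rect_int P Q x y w h + rect_int P Q x (y + h) w h'.
Proof.
  intros H. destruct (closed_form_continuous _ _ H) as [HP HQ]. unfold rect_int.
  rewrite <- (RInt_Chasles (V := R_CompleteNormedModule) _ y (y + h) (y + (h + h')))
    by (apply ex_RInt_minus_continuous; intros; apply HQ).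
  rewrite <- !Rplus_assoc.
  rewrite (RInt_ext (fun u => P u y - P u (y + h + h'))
     (fun u => plus (P u y - P u (y + h)) (P u (y + h) - P u (y + h + h'))))
    by (intros; unfold plus; simpl; ring).
  rewrite (RInt_plus (V := R_CompleteNormedModule)
      (fun u => P u y - P u (y + h)) (fun u => P u (y + h) - P u (y + h + h')))
    by (apply ex_RInt_minus_continuous; intros; apply HP).
  unfold plus; simpl. ring.
Qed.

(** A sigma type rather than an existential, since [rect_int_zero] iterates the choice by a fixpoint
    to build the sequence of corners. *)
Lemma rect_int_quarter (P Q : R -> R -> R) (x y w h : R) : closed_form P Q ->
  {p : R * R | (fst p = x \/ fst p = x + w / 2) /\ (snd p = y \/ snd p = y + h / 2) /\
    Rabs (rect_int P Q x y w h) <= 4 * Rabs (rect_int P Q (fst p) (snd p) (w / 2) (h / 2))}.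
Proof.
  intros H.
  assert (E : rect_int P Q x y w h =
    rect_int P Q x y (w / 2) (h / 2) + rect_int P Q x (y + h / 2) (w / 2) (h / 2) +
    (rect_int P Q (x + w / 2) y (w / 2) (h / 2) + rect_int P Q (x + w / 2) (y + h / 2) (w / 2) (h / 2))).
  { rewrite <- !rect_int_split_y, <- rect_int_split_x by exact H. f_equal; field. }
  set (J := Rabs (rect_int P Q x y w h)).
  destruct (Rle_lt_dec J (4 * Rabs (rect_int P Q x y (w / 2) (h / 2)))) as [L|L1].
  { exists (x, y); auto. }
  destruct (Rle_lt_dec J (4 * Rabs (rect_int P Q x (y + h / 2) (w / 2) (h / 2)))) as [L|L2].
  { exists (x, y + h / 2); auto. }
  destruct (Rle_lt_dec J (4 * Rabs (rect_int P Q (x + w / 2) y (w / 2) (h / 2)))) as [L|L3].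
  { exists (x + w / 2, y); auto. }
  exists (x + w / 2, y + h / 2). simpl. split; [auto|]. split; [auto|].
  fold J. apply Rnot_lt_le. intros L4.
  enough (J < J) by lra. unfold J at 1. rewrite E.
  eapply Rle_lt_trans; [apply Rabs_triang|].
  eapply Rle_lt_trans; [apply Rplus_le_compat; apply Rabs_triang|]. lra.
Qed.

Lemma nested_intervals_point (x d : nat -> R) :
  (forall n, x n <= x (S n)) -> (forall n, x (S n) + d (S n) <= x n + d n) ->
  (forall n, 0 <= d n) -> exists X, forall n, x n <= X <= x n + d n.
Proof.
  intros H1 H2 H3.
  assert (M : forall n k, x n <= x (n + k)%nat /\ x (n + k)%nat + d (n + k)%nat <= x n + d n).
  { intros n k. induction k as [|k IH]; [rewrite Nat.add_0_r; lra|].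
    rewrite Nat.add_succ_r. specialize (H1 (n + k)%nat). specialize (H2 (n + k)%nat). lra. }
  assert (U : forall n m, x m <= x n + d n).
  { intros n m. destruct (Nat.le_ge_cases n m) as [L|L].
    - replace m with (n + (m - n))%nat by lia. specialize (M n (m - n)%nat). specialize (H3 (n + (m - n))%nat). lra.
    - replace n with (m + (n - m))%nat by lia. specialize (M m (n - m)%nat). specialize (H3 (m + (n - m))%nat). lra. }
  destruct (completeness (fun r => exists n, r = x n)) as [X [HX1 HX2]].
  - exists (x 0%nat + d 0%nat). intros r [n ->]. apply U.
  - exists (x 0%nat), 0%nat. reflexivity.
  - exists X. intros n. split.
    + apply HX1. now exists n.
    + apply HX2. intros r [m ->]. apply U.
Qed.

(* The linear part of a closed form integrates to zero along the boundary. *)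
Lemma rect_int_small (P Q : R -> R -> R) (X Y : R) (eps : posreal) :
  closed_form P Q -> exists delta : posreal, forall x y w h D,
    0 <= w -> 0 <= h -> w + h <= D -> D < delta -> x <= X <= x + w -> y <= Y <= y + h ->
    Rabs (rect_int P Q x y w h) <= 2 * eps * D * D.
Proof.
  intros H. destruct (closed_form_continuous _ _ H) as [HP HQ].
  destruct (H X Y) as (a & b & c & DP & DQ).
  destruct (locally_2d_and _ _ _ _ (DP eps) (DQ eps)) as [delta Hd].
  exists delta. intros x y w h D Hw Hh HD HDd HX HY.
  assert (K : forall u v, x <= u <= x + w -> y <= v <= y + h ->
    Rabs (P u v - P X Y - (a * (u - X) + b * (v - Y))) <= eps * D /\
    Rabs (Q u v - Q X Y - (b * (u - X) + c * (v - Y))) <= eps * D).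
  { intros u v Hu Hv.
    assert (Au : Rabs (u - X) <= D) by (apply Rabs_le; lra).
    assert (Av : Rabs (v - Y) <= D) by (apply Rabs_le; lra).
    destruct (Hd u v ltac:(lra) ltac:(lra)) as [K1 K2].
    pose proof (cond_pos eps).
    assert (Rmax (Rabs (u - X)) (Rabs (v - Y)) <= D) by now apply Rmax_lub.
    split; (eapply Rle_trans; [eassumption|]); apply Rmult_le_compat_l; lra. }
  (* The affine part contributes [- b * h * w] along the horizontal sides and [b * w * h] along the
     vertical ones. Each pair of sides is compared with its own contribution, and the two cancel in
     the sum. *)
  assert (A : Rabs (RInt (fun u => P u y - P u (y + h)) x (x + w) + b * h * w) <= w * (2 * eps * D)).
  { replace (b * h * w) with (RInt (fun _ : R => b * h) x (x + w)).
    2:{ rewrite (RInt_const (V := R_CompleteNormedModule)). unfold scal; simpl; unfold mult; simpl. ring. }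
    rewrite <- (RInt_plus (V := R_CompleteNormedModule)).
    2:{ apply ex_RInt_minus_continuous; intros; apply HP. }
    2:{ apply ex_RInt_const. }
    replace (w * (2 * eps * D)) with ((x + w - x) * (2 * eps * D)) by ring.
    apply abs_RInt_le_const; [lra| |].
    - apply (ex_RInt_plus (V := R_NormedModule)); [apply ex_RInt_minus_continuous; intros; apply HP|apply ex_RInt_const].
    - intros t Ht. destruct (K t y Ht ltac:(lra)) as [K1 _]. destruct (K t (y + h) Ht ltac:(lra)) as [K2 _].
      unfold plus; simpl.
      replace (P t y - P t (y + h) + b * h) with
        ((P t y - P X Y - (a * (t - X) + b * (y - Y))) - (P t (y + h) - P X Y - (a * (t - X) + b * (y + h - Y)))) by ring.
      eapply Rle_trans; [apply Rabs_triang|]. rewrite Rabs_Ropp. lra. }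
  assert (B : Rabs (RInt (fun v => Q (x + w) v - Q x v) y (y + h) + - (b * w * h)) <= h * (2 * eps * D)).
  { replace (- (b * w * h)) with (RInt (fun _ : R => - (b * w)) y (y + h)).
    2:{ rewrite (RInt_const (V := R_CompleteNormedModule)). unfold scal; simpl; unfold mult; simpl. ring. }
    rewrite <- (RInt_plus (V := R_CompleteNormedModule)).
    2:{ apply ex_RInt_minus_continuous; intros; apply HQ. }
    2:{ apply ex_RInt_const. }
    replace (h * (2 * eps * D)) with ((y + h - y) * (2 * eps * D)) by ring.
    apply abs_RInt_le_const; [lra| |].
    - apply (ex_RInt_plus (V := R_NormedModule)); [apply ex_RInt_minus_continuous; intros; apply HQ|apply ex_RInt_const].
    - intros t Ht. destruct (K x t ltac:(lra) Ht) as [_ K1]. destruct (K (x + w) t ltac:(lra) Ht) as [_ K2].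
      unfold plus; simpl.
      replace (Q (x + w) t - Q x t + - (b * w)) with
        ((Q (x + w) t - Q X Y - (b * (x + w - X) + c * (t - Y))) - (Q x t - Q X Y - (b * (x - X) + c * (t - Y)))) by ring.
      eapply Rle_trans; [apply Rabs_triang|]. rewrite Rabs_Ropp. lra. }
  unfold rect_int.
  match goal with |- Rabs (?S + ?T) <= _ =>
    replace (S + T) with ((S + b * h * w) + (T + - (b * w * h))) by ring end.
  eapply Rle_trans; [apply Rabs_triang|].
  assert (0 <= eps * D) by (pose proof (cond_pos eps); apply Rmult_le_pos; lra).
  apply Rle_trans with ((w + h) * (2 * (eps * D))); [lra|].
  replace (2 * eps * D * D) with (D * (2 * (eps * D))) by ring.
  apply Rmult_le_compat_r; lra.
Qed.

Theorem rect_int_zero (P Q : R -> R -> R) (x y w h : R) :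
  closed_form P Q -> 0 <= w -> 0 <= h -> rect_int P Q x y w h = 0.
Proof.
  intros H Hw Hh.
  set (sz := fun (r : R) (n : nat) => r / 2 ^ n).
  assert (Sz : forall r n, sz r n / 2 = sz r (S n)).
  { intros. unfold sz. simpl. field. apply pow_nonzero. lra. }
  assert (Sp : forall r n, 0 <= r -> 0 <= sz r n).
  { intros. unfold sz. apply Rmult_le_pos; [lra|]. left. apply Rinv_0_lt_compat, pow_lt. lra. }
  set (corner := fix corner n := match n with
    | O => (x, y)
    | S n => proj1_sig (rect_int_quarter P Q (fst (corner n)) (snd (corner n)) (sz w n) (sz h n) H)
    end).
  assert (St : forall n, let p := corner n in let p' := corner (S n) in
    (fst p' = fst p \/ fst p' = fst p + sz w (S n)) /\
    (snd p' = snd p \/ snd p' = snd p + sz h (S n)) /\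
    Rabs (rect_int P Q (fst p) (snd p) (sz w n) (sz h n)) <=
    4 * Rabs (rect_int P Q (fst p') (snd p') (sz w (S n)) (sz h (S n)))).
  { intros n. simpl. destruct (rect_int_quarter _ _ _ _ _ _ _) as [p Hp]. simpl.
    rewrite !Sz in Hp. exact Hp. }
  assert (Z0 : forall r, sz r 0%nat = r) by (intros; unfold sz; simpl; field).
  assert (G : forall n, Rabs (rect_int P Q x y w h) <=
     4 ^ n * Rabs (rect_int P Q (fst (corner n)) (snd (corner n)) (sz w n) (sz h n))).
  { induction n as [|n IH]; [simpl; rewrite !Z0; lra|].
    destruct (St n) as (_ & _ & S3). simpl (4 ^ S n).
    assert (0 < 4 ^ n) by (apply pow_lt; lra). nra. }
  destruct (nested_intervals_point (fun n => fst (corner n)) (sz w)) as [X HX].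
  { intros n. destruct (St n) as (S1 & _). pose proof (Sp w (S n) Hw). lra. }
  { intros n. destruct (St n) as (S1 & _). pose proof (Sp w (S n) Hw). pose proof (Sz w n). lra. }
  { auto. }
  destruct (nested_intervals_point (fun n => snd (corner n)) (sz h)) as [Y HY].
  { intros n. destruct (St n) as (_ & S1 & _). pose proof (Sp h (S n) Hh). lra. }
  { intros n. destruct (St n) as (_ & S1 & _). pose proof (Sp h (S n) Hh). pose proof (Sz h n). lra. }
  { auto. }
  set (J := rect_int P Q x y w h) in *.
  (* At depth [n] the local bound is quadratic in a size divided by [2 ^ n], which exactly absorbs
     the factor [4 ^ n] lost in [G]; so [n] disappears. *)
  assert (B : forall eps : posreal, Rabs J <= 2 * eps * ((w + h) * (w + h))).
  { intros eps. destruct (rect_int_small P Q X Y eps H) as [delta Hd].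
    destruct (pow_lt_1_zero (/ 2) ltac:(rewrite Rabs_pos_eq; lra) (delta / (w + h + 1))) as [n Hn].
    { apply Rdiv_lt_0_compat; [apply cond_pos|lra]. }
    specialize (Hn n (le_n n)). rewrite Rabs_pos_eq in Hn by (apply pow_le; lra). rewrite pow_inv in Hn.
    assert (P2 : 0 < 2 ^ n) by (apply pow_lt; lra).
    assert (I2 : 0 < / 2 ^ n) by now apply Rinv_0_lt_compat.
    specialize (Hd (fst (corner n)) (snd (corner n)) (sz w n) (sz h n) (sz (w + h) n)
      ltac:(auto) ltac:(auto)).
    specialize (G n). specialize (HX n). specialize (HY n). simpl in HX, HY.
    assert (L : sz (w + h) n < delta).
    { unfold sz, Rdiv in *. apply Rle_lt_trans with ((w + h + 1) * / 2 ^ n); [nra|].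
      apply Rlt_le_trans with ((w + h + 1) * (delta * / (w + h + 1))).
      - apply Rmult_lt_compat_l; lra.
      - right. field. lra. }
    specialize (Hd ltac:(unfold sz; lra) L HX HY).
    eapply Rle_trans; [exact G|].
    apply Rle_trans with (4 ^ n * (2 * eps * sz (w + h) n * sz (w + h) n)).
    - apply Rmult_le_compat_l; [left; apply pow_lt; lra|exact Hd].
    - right. unfold sz. replace 4 with (2 * 2) by ring. rewrite Rpow_mult_distr. field. lra. }
  destruct (Req_dec J 0) as [E|E]; [exact E|exfalso].
  apply Rabs_pos_lt in E.
  set (W := (w + h) * (w + h)) in *. assert (0 <= W) by (unfold W; nra).
  (* With this [eps] the bound [B] becomes [Rabs J <= Rabs J / 2]; the [+ 1] covers the degenerate
     rectangle [W = 0]. *)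
  assert (0 < Rabs J / (4 * (W + 1))) as He by (apply Rdiv_lt_0_compat; lra).
  specialize (B (mkposreal _ He)). simpl in B.
  assert (2 * (Rabs J / (4 * (W + 1))) * W = Rabs J / 2 * (W / (W + 1))) as E2 by (field; lra).
  assert (W / (W + 1) <= 1).
  { apply Rmult_le_reg_r with (W + 1); [lra|]. unfold Rdiv. rewrite Rmult_assoc, Rinv_l; lra. }
  nra.
Qed.

(** * Mean value property, identity theorem, maximum principle *)

(** This form is the imaginary part of [f dz]: on vertical sides it integrates [Re f], the quantity
    in the mean value property. *)
Lemma entire_closed_form (f : C -> C) : entire f ->
  closed_form (fun x y => Im (f (x, y))) (fun x y => Re (f (x, y))).
Proof.
  intros H x y. destruct (proj1 (holomorphic_Cderiv _ _) (H (x, y))) as [d Hd].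
  destruct (Cderiv_partials _ _ _ _ Hd) as [H1 H2]. eauto.
Qed.

Lemma entire_continuous (f : C -> C) (s : C) (eps : R) : entire f -> 0 < eps ->
  exists delta, 0 < delta /\ forall h, Cmod h < delta -> Cmod (f (s + h) - f s)%C < eps.
Proof.
  intros H Heps. destruct (proj1 (holomorphic_Cderiv _ _) (H s)) as [d Hd].
  destruct (proj1 (Cderiv_eps _ _ _) Hd 1 Rlt_0_1) as [delta [Hdelta K]].
  pose proof (Cmod_ge_0 d).
  exists (Rmin delta (eps / (1 + Cmod d))). split.
  { apply Rmin_glb_lt; [exact Hdelta|]. apply Rdiv_lt_0_compat; lra. }
  intros h Hh. specialize (K h (Rlt_le_trans _ _ _ Hh (Rmin_l _ _))).
  pose proof (Rlt_le_trans _ _ _ Hh (Rmin_r _ _)) as Hh2.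
  replace (f (s + h) - f s)%C with ((f (s + h) - f s - h * d) + h * d)%C by ring.
  eapply Rle_lt_trans; [apply Cmod_triangle|]. rewrite Cmod_mult.
  apply Rmult_lt_compat_r with (r := 1 + Cmod d) in Hh2; [|lra].
  unfold Rdiv in Hh2. rewrite Rmult_assoc, Rinv_l in Hh2; lra.
Qed.

Lemma entire_polar (f : C -> C) (z0 : C) : entire f -> entire (fun w => f (z0 + Cexp w)%C).
Proof.
  intros H. apply (entire_comp f (fun w => z0 + Cexp w)%C H).
  apply entire_plus; [apply entire_const|apply entire_Cexp].
Qed.

Lemma ex_RInt_continuous_R (f : R -> R) (a b : R) :
  (forall x, continuous f x) -> ex_RInt f a b.
Proof. intros H. apply (ex_RInt_continuous (V := R_CompleteNormedModule)). auto. Qed.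

Lemma entire_circle_continuous (f : C -> C) (z0 : C) (rho theta : R) : entire f ->
  continuous (fun t => Re (f (z0 + Cexp (rho, t))%C)) theta.
Proof.
  intros H. exact (proj2 (closed_form_continuous _ _ (entire_closed_form _ (entire_polar f z0 H))) rho theta).
Qed.

Lemma Re_minus (z w : C) : Re (z - w)%C = Re z - Re w.
Proof. destruct z, w. reflexivity. Qed.

(* Since [f (z0 + e^w)] is 2 pi i-periodic, its integral along a segment
   [rho + i [0, 2 pi]] does not depend on [rho]; let [rho] tend to -infinity. *)
Lemma entire_mean_value (f : C -> C) (z0 : C) (rho : R) : entire f ->
  RInt (fun t => Re (f (z0 + Cexp (rho, t))%C)) 0 (2 * PI) = 2 * PI * Re (f z0).
Proof.
  intros H. pose proof PI_RGT_0 as Hpi.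
  set (g := fun w => f (z0 + Cexp w)%C).
  assert (Hg : entire g) by now apply entire_polar.
  assert (Cg : forall r t, continuous (fun t => Re (g (r, t))) t) by (intros; now apply entire_circle_continuous).
  set (I := fun r => RInt (fun t => Re (g (r, t))) 0 (2 * PI)).
  assert (Const : forall r, r <= rho -> I r = I rho).
  { intros r Hr.
    pose proof (rect_int_zero _ _ r 0 (rho - r) (2 * PI) (entire_closed_form _ Hg) ltac:(lra) ltac:(lra)) as Z.
    unfold rect_int in Z. rewrite (RInt_ext _ (fun _ => 0)) in Z.
    - rewrite (RInt_const (V := R_CompleteNormedModule)) in Z.
      replace (r + (rho - r)) with rho in Z by ring. rewrite Rplus_0_l in Z.
      rewrite (RInt_minus (V := R_CompleteNormedModule) (fun v => Re (g (rho, v))) (fun v => Re (g (r, v)))) in Z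
        by (apply ex_RInt_continuous_R; intros; apply Cg).
      fold (I rho) (I r) in Z. unfold scal, minus, plus, opp, mult in Z; simpl in Z. unfold mult in Z; simpl in Z. lra.
    (* The horizontal sides cancel by periodicity, so the two vertical ones carry equal
       integrals. *)
    - intros x _. unfold g. replace (Cexp (x, 0 + 2 * PI)) with (Cexp (x, 0)); [apply Rminus_diag_eq; reflexivity|].
      unfold Cexp; simpl. rewrite !Rplus_0_l, sin_2PI, cos_2PI, sin_0, cos_0. reflexivity. }
  change (I rho = 2 * PI * Re (f z0)). apply cond_eq. intros eps Heps.
  destruct (entire_continuous f z0 (eps / (4 * PI)) H) as [delta [Hd K]].
  { apply Rdiv_lt_0_compat; lra. }
  (* At most [rho] for [Const] to apply, and with [exp r <= delta / 2] so that the circle lies where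
     [f] is close to [f z0]. *)
  set (r := Rmin rho (ln (delta / 2))).
  rewrite <- (Const r) by apply Rmin_l. unfold I.
  assert (B : Rabs (RInt (fun t => Re (g (r, t)) - Re (f z0)) 0 (2 * PI)) <= (2 * PI - 0) * (eps / (4 * PI))).
  { apply abs_RInt_le_const; [lra| |].
    - apply ex_RInt_minus_continuous; [intros; apply Cg|]. intros; apply continuous_const.
    - intros t _. rewrite <- Re_minus. eapply Rle_trans; [apply re_le_Cmod|]. left. apply K.
      rewrite Cmod_Cexp. simpl. apply Rle_lt_trans with (exp (ln (delta / 2))).
      + apply exp_le, Rmin_r.
      + rewrite exp_ln; lra. }
  rewrite (RInt_minus (V := R_CompleteNormedModule)) in B.
  2:{ apply ex_RInt_continuous_R; intros; apply Cg. }
  2:{ apply ex_RInt_const. }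
  rewrite (RInt_const (V := R_CompleteNormedModule)) in B.
  unfold scal, minus, plus, opp in B; simpl in B. unfold mult in B; simpl in B.
  replace ((2 * PI - 0) * (eps / (4 * PI))) with (eps / 2) in B by (field; lra).
  rewrite Rminus_0_r in B. eapply Rle_lt_trans; [|apply (Rlt_eps2_eps eps); lra].
  exact B.
Qed.

Lemma continuous_bounded (f : R -> R) (a b : R) : a <= b -> (forall x, continuous f x) ->
  exists M, forall x, a <= x <= b -> Rabs (f x) <= M.
Proof.
  intros Hab H.
  destruct (continuity_ab_maj (fun x => Rabs (f x)) a b Hab) as [m [Hm _]].
  - intros c _. apply continuity_pt_filterlim.
    apply (continuous_comp f Rabs); [apply H|apply continuous_Rabs].
  - exists (Rabs (f m)). exact Hm.
Qed.

Lemma Rle_exp_decay_0 (v M a : R) : 0 < a ->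
  (forall n : nat, Rabs v <= M * exp (- (a * INR n))) -> v = 0.
Proof.
  intros Ha H. destruct (Req_dec v 0) as [E|E]; [exact E|exfalso].
  apply Rabs_pos_lt in E.
  destruct (INR_unbounded (M / (Rabs v * a))) as [n Hn].
  specialize (H n). rewrite exp_Ropp in H.
  pose proof (exp_ineq1_le (a * INR n)) as L. pose proof (exp_pos (a * INR n)) as Ep.
  apply Rmult_le_compat_r with (r := exp (a * INR n)) in H; [|lra].
  rewrite Rmult_assoc, Rinv_l, Rmult_1_r in H by lra.
  apply Rmult_lt_compat_r with (r := Rabs v * a) in Hn; [|nra].
  unfold Rdiv in Hn. rewrite Rmult_assoc, Rinv_l in Hn by nra. nra.
Qed.

(* Multiplying [f] by [exp (N (w + w^2/2))], [w = (z - z1)/R], changes nothing at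
   the centre [z1] of the circle [|w| = 1] but is exponentially small in [N] on the
   part [Re w <= 1/4], the only one where [f] may be nonzero when [R] is large. *)
Lemma entire_zero_half_plane (f : C -> C) (a : R) : entire f ->
  (forall z, a < Re z -> f z = 0%C) -> forall z, f z = 0%C.
Proof.
  intros H Hz z1. pose proof PI_RGT_0 as Hpi.
  (* A quarter of the radius already moves [z1] beyond the line [Re z = a], so [f] vanishes on the
     arc [cos t > 1/4]. *)
  set (r0 := 4 * (Rabs (a - Re z1) + 1)).
  assert (HR : 0 < r0) by (unfold r0; pose proof (Rabs_pos (a - Re z1)); lra).
  assert (HRa : a < Re z1 + r0 / 4) by (unfold r0; pose proof (Rle_abs (a - Re z1)); lra).
  assert (W : forall t, Cexp (ln r0, t) = (r0 * cos t, r0 * sin t)).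
  { intros t. unfold Cexp; simpl. now rewrite exp_ln. }
  set (k := fun (n : nat) (z : C) =>
    (INR n * ((z - z1) * (/ r0)%R + (z - z1) * (/ r0)%R * ((z - z1) * (/ r0)%R) * (1 / 2)%R))%C).
  assert (Hk : forall n, entire (k n)).
  { intros n. assert (L : entire (fun z => (z - z1) * (/ r0)%R)%C).
    { apply entire_mult; [|apply entire_const]. apply entire_plus; [apply entire_id|apply entire_const]. }
    apply entire_mult; [apply entire_const|]. apply entire_plus; [exact L|].
    apply entire_mult; [|apply entire_const]. now apply entire_mult. }
  (* The mean value property only speaks of real parts; [c = 1] and [c = Ci] recover both
     coordinates of [f z1]. *)
  assert (Key : forall c, Cmod c = 1 -> Re (c * f z1)%C = 0).
  { intros c Hc.
    destruct (continuous_bounded (fun t => Re (f (z1 + Cexp (ln r0, t))%C)) 0 (2 * PI) ltac:(lra)) as [M1 HM1].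
    { intros t. now apply entire_circle_continuous. }
    destruct (continuous_bounded (fun t => Re ((fun z => Ci * f z) (z1 + Cexp (ln r0, t)))%C) 0 (2 * PI) ltac:(lra)) as [M2 HM2].
    { intros t. apply (entire_circle_continuous (fun z => Ci * f z)%C). apply entire_mult; [apply entire_const|exact H]. }
    (* On the circle the exponent has real part [n (cos t + cos (2 t) / 2) = n (cos t + cos t ^ 2 -
       1/2)], at most [n (1/4 + 1/16 - 1/2) = - 3 n / 16] when [cos t <= 1/4]. The quadratic term is
       essential: [cos t] alone is not negative on [0 <= cos t <= 1/4]. *)
    apply (Rle_exp_decay_0 _ (M1 + M2) (3 / 16)); [lra|]. intros n.
    set (F := fun z => (c * f z * Cexp (k n z))%C).
    assert (HF : entire F).
    { apply entire_mult; [apply entire_mult; [apply entire_const|exact H]|].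
      apply (entire_comp Cexp (k n)); [apply entire_Cexp|apply Hk]. }
    assert (F1 : F z1 = (c * f z1)%C).
    { unfold F, k. replace (INR n * _)%C with (RtoC 0) by ring. rewrite Cexp_0. ring. }
    rewrite <- F1.
    apply Rmult_le_reg_l with (2 * PI); [lra|].
    rewrite <- (Rabs_pos_eq (2 * PI)) at 1 by lra. rewrite <- Rabs_mult.
    rewrite <- (entire_mean_value F z1 (ln r0) HF).
    replace (2 * PI * ((M1 + M2) * exp (- (3 / 16 * INR n)))) with
      ((2 * PI - 0) * ((M1 + M2) * exp (- (3 / 16 * INR n)))) by ring.
    apply abs_RInt_le_const; [lra| |].
    { apply ex_RInt_continuous_R. intros. now apply entire_circle_continuous. }
    intros t Ht. specialize (HM1 t Ht). specialize (HM2 t Ht). cbv beta in HM2.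
    pose proof (Rabs_pos (Re (f (z1 + Cexp (ln r0, t))%C))).
    pose proof (Rabs_pos (Re (Ci * f (z1 + Cexp (ln r0, t)))%C)).
    pose proof (exp_pos (- (3 / 16 * INR n))).
    assert (HMf : Cmod (f (z1 + Cexp (ln r0, t))%C) <= M1 + M2).
    { eapply Rle_trans; [apply Cmod_le_Re_Im|]. apply Rplus_le_compat; [exact HM1|].
      eapply Rle_trans; [|exact HM2]. destruct (f _) as [p q]. simpl. right.
      rewrite <- Rabs_Ropp. f_equal. ring. }
    eapply Rle_trans; [apply re_le_Cmod|]. unfold F. rewrite !Cmod_mult, Hc, Rmult_1_l, Cmod_Cexp.
    rewrite W in *.
    destruct (Rlt_le_dec (1 / 4) (cos t)) as [Hcos|Hcos].
    - rewrite (Hz (z1 + ((r0 * cos t)%R, (r0 * sin t)%R))%C), Cmod_0.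
      + rewrite Rmult_0_l. apply Rmult_le_pos; lra.
      + destruct z1 as [x1 y1]. simpl in *. nra.
    - apply Rmult_le_compat; [apply Cmod_ge_0|left; apply exp_pos|exact HMf|].
      apply exp_le. unfold k.
      replace (z1 + ((r0 * cos t)%R, (r0 * sin t)%R) - z1)%C with ((r0 * cos t, r0 * sin t) : C) by (apply injective_projections; simpl; ring).
      simpl. pose proof (pos_INR n) as Pn. pose proof (COS_bound t) as Bt.
      pose proof (sin2_cos2 t) as S2. unfold Rsqr in S2.
      match goal with |- ?X <= _ => replace X with (INR n * (cos t + (cos t * cos t - sin t * sin t) / 2)) by (field; lra) end.
      replace (- (3 / 16 * INR n)) with (INR n * (- (3 / 16))) by ring.
      apply Rmult_le_compat_l; [exact Pn|]. nra. }
  pose proof (Key 1%C Cmod_1) as K1. pose proof (Key Ci Cmod_Ci) as K2.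
  destruct (f z1) as [p q]. simpl in *. apply injective_projections; simpl; lra.
Qed.

Lemma Cexp_surj (z : C) : z <> 0%C -> exists w, Cexp w = z.
Proof.
  intros Hz. apply Cmod_gt_0 in Hz as Hm. pose proof (Cmod_sqr z) as E. destruct z as [x y]. simpl in E.
  set (r := Cmod (x, y)) in *.
  assert (Hxy : Rsqr (x / r) + Rsqr (y / r) = 1).
  { unfold Rsqr. replace (x / r * (x / r) + y / r * (y / r)) with ((x * x + y * y) / (r * r)) by (field; lra).
    rewrite <- E. field. lra. }
  assert (Hx : -1 <= x / r <= 1).
  { pose proof (Rle_0_sqr (y / r)). unfold Rsqr in *. nra. }
  pose proof (cos_acos _ Hx) as Ca. pose proof (sin_acos _ Hx) as Sa.
  assert (Sa' : sin (acos (x / r)) = Rabs (y / r)).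
  { rewrite Sa. replace (1 - Rsqr (x / r)) with (Rsqr (y / r)) by lra. apply sqrt_Rsqr_abs. }
  destruct (Rle_lt_dec 0 (y / r)) as [Hy|Hy].
  - exists (ln r, acos (x / r)). unfold Cexp; simpl. rewrite exp_ln, Ca, Sa', Rabs_pos_eq by assumption.
    f_equal; field; lra.
  - exists (ln r, - acos (x / r)). unfold Cexp; simpl. rewrite exp_ln, cos_neg, sin_neg, Ca, Sa', Rabs_left by assumption.
    f_equal; field; lra.
Qed.

(** The map [w -> z0 + e^(-w)] sends the half-plane [Re w > - ln delta] into the disc and has image
    [C] minus [z0], so the half-plane case applies to the composite. *)
Lemma entire_zero_disc (f : C -> C) (z0 : C) (delta : R) : entire f -> 0 < delta ->
  (forall h, Cmod h < delta -> f (z0 + h)%C = 0%C) -> forall z, f z = 0%C.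
Proof.
  intros H Hd Hz z.
  assert (G : forall w, f (z0 + Cexp (- w))%C = 0%C).
  { apply (entire_zero_half_plane (fun w => f (z0 + Cexp (- w)))%C (- ln delta)).
    - apply (entire_comp (fun w => f (z0 + Cexp w))%C Copp); [now apply entire_polar|].
      apply entire_ext with (f := fun z => ((- (1)) * z)%C); [intros; ring|].
      apply entire_mult; [apply entire_const|apply entire_id].
    - intros w Hw. apply Hz. rewrite Cmod_Cexp. rewrite <- (exp_ln delta Hd).
      apply exp_increasing. destruct w. simpl in *. lra. }
  destruct (Ceq_dec z z0) as [->|E].
  - rewrite <- (Hz 0%C); [f_equal; ring|]. now rewrite Cmod_0.
  - destruct (Cexp_surj (z - z0)%C) as [w Hw].
    + intros K. apply E. replace z with (z0 + (z - z0))%C by ring. rewrite K. ring.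
    + specialize (G (- w)%C). rewrite <- G. f_equal. replace (- - w)%C with w by ring. rewrite Hw. ring.
Qed.

Lemma RInt_nonneg_zero (f : R -> R) (a b : R) : a < b ->
  (forall x, continuous f x) -> (forall x, 0 <= f x) -> RInt f a b = 0 -> f a = 0.
Proof.
  intros Hab Hc Hp HI. destruct (Req_dec (f a) 0) as [E|E]; [exact E|exfalso].
  assert (Ha : 0 < f a) by (specialize (Hp a); lra).
  destruct (proj1 (continuity_pt_locally f a) (proj2 (continuity_pt_filterlim f a) (Hc a))
    (mkposreal _ Ha)) as [eta He]. simpl in He.
  set (m := Rmin b (a + eta)).
  assert (Hm : a < m) by (apply Rmin_glb_lt; [lra|]; pose proof (cond_pos eta); lra).
  assert (Hmb : m <= b) by apply Rmin_l. assert (Hme : m <= a + eta) by apply Rmin_r.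
  assert (0 < RInt f a m).
  { apply RInt_gt_0; [exact Hm| |intros; apply Hc]. intros x Hx.
    assert (B : ball a eta x).
    { unfold ball; simpl; unfold AbsRing_ball, minus, plus, opp, abs; simpl. apply Rabs_lt_between. lra. }
    specialize (He x B). apply Rabs_lt_between in He. lra. }
  assert (0 <= RInt f m b) by (apply RInt_ge_0; [exact Hmb|now apply ex_RInt_continuous_R|auto]).
  rewrite <- (RInt_Chasles (V := R_CompleteNormedModule) f a m b) in HI by now apply ex_RInt_continuous_R.
  unfold plus in HI; simpl in HI. lra.
Qed.

(** The circle about [z0] through [z0 + h] is parametrized to start at [z0 + h]. On it
    [Re (f z0) - Re f] is nonnegative with zero mean, hence vanishes at the endpoint [t = 0]. *)
Lemma entire_Re_local_max (f : C -> C) (z0 : C) (delta : R) : entire f ->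
  (forall h, Cmod h < delta -> Re (f (z0 + h)%C) <= Re (f z0)) ->
  forall h, Cmod h < delta -> Re (f (z0 + h)%C) = Re (f z0).
Proof.
  intros H Hmax h Hh. pose proof PI_RGT_0 as Hpi.
  set (g := fun z => f (z0 + h * z)%C).
  assert (Hg : entire g).
  { apply (entire_comp f (fun z => z0 + h * z)%C H).
    apply entire_plus; [apply entire_const|]. apply entire_mult; [apply entire_const|apply entire_id]. }
  assert (Hc : forall x, continuous (fun t => Re (g (0 + Cexp (0%R, t))%C)) x)
    by (intros; now apply entire_circle_continuous).
  pose proof (RInt_nonneg_zero (fun t => Re (f z0) - Re (g (0 + Cexp (0%R, t))%C)) 0 (2 * PI) ltac:(lra)) as Z.
  assert (E : Re (f z0) - Re (g (0 + Cexp (0%R, 0%R))%C) = 0).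
  { apply Z.
    - intros x. apply (continuous_minus (fun _ => Re (f z0))); [apply continuous_const|apply Hc].
    - intros x. apply Rge_le, Rge_minus, Rle_ge. unfold g. apply Hmax. rewrite Cmod_mult.
      replace (0 + Cexp (0%R, x))%C with (Cexp (0%R, x)) by ring. rewrite Cmod_Cexp. simpl. rewrite exp_0. lra.
    - rewrite (RInt_minus (V := R_CompleteNormedModule)).
      2:{ apply ex_RInt_const. }
      2:{ now apply ex_RInt_continuous_R. }
      rewrite (RInt_const (V := R_CompleteNormedModule)), (entire_mean_value g 0%C 0 Hg).
      unfold g. replace (z0 + h * 0)%C with z0 by ring.
      unfold scal, minus, plus, opp, mult; simpl. unfold mult; simpl. ring. }
  unfold g in E. change (0%R, 0%R) with (RtoC 0) in E. rewrite Cexp_0 in E.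
  replace (z0 + h * (0 + 1))%C with (z0 + h)%C in E by ring. lra.
Qed.

(* Once [Re f] is constant near [z0], [Re ((f - f z0)^2) = - (Im (f - f z0))^2] has a
   local maximum at [z0] as well, so [Im f] is constant near [z0]. *)
Lemma entire_local_max_constant (f : C -> C) (z0 : C) (delta : R) : entire f -> 0 < delta ->
  (forall h, Cmod h < delta -> Re (f (z0 + h)%C) <= Re (f z0)) ->
  forall z, f z = f z0.
Proof.
  intros H Hd Hmax z.
  pose proof (entire_Re_local_max f z0 delta H Hmax) as HRe.
  set (g := fun z => (f z + - f z0)%C).
  assert (Hg : entire g) by (apply entire_plus; [exact H|apply entire_const]).
  assert (Hg0 : g z0 = 0%C) by (unfold g; ring).
  assert (HgR : forall h, Cmod h < delta -> Re (g (z0 + h)%C) = 0).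
  { intros h Hh. specialize (HRe h Hh). unfold g. destruct (f (z0 + h)%C), (f z0). simpl in *. lra. }
  assert (Hz : g z = 0%C).
  { apply (entire_zero_disc g z0 delta Hg Hd). intros h Hh.
    assert (E : Re (g (z0 + h) * g (z0 + h))%C = 0).
    { rewrite (entire_Re_local_max (fun z => g z * g z)%C z0 delta).
      - rewrite Hg0. simpl. ring.
      - now apply entire_mult.
      - intros k Hk. specialize (HgR k Hk). rewrite Hg0. destruct (g (z0 + k)%C) as [p q]. simpl in *. subst p. nra.
      - exact Hh. }
    specialize (HgR h Hh). destruct (g (z0 + h)%C) as [p q]. simpl in *. subst p.
    apply injective_projections; simpl; [reflexivity|nra]. }
  unfold g in Hz. replace (f z) with ((f z + - f z0) + f z0)%C by ring. rewrite Hz. ring.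
Qed.

(** * Polya's identity *)

(* Coquelicot types sums and integrals in projections of [R_AbelianMonoid] and the
   like, where [ring] does not recognise an equation in [R]. *)
Ltac Rring := match goal with |- @eq _ ?a ?b => change (@eq R a b); ring end.

Lemma sum_n_S (a : nat -> R) (n : nat) : sum_n a (S n) = sum_n a n + a (S n) :> R.
Proof. rewrite sum_Sn. reflexivity. Qed.

Lemma sum_n_0 (a : nat -> R) : sum_n a 0 = a 0%nat :> R.
Proof. apply sum_O. Qed.

Lemma sum_n_Rplus (a b : nat -> R) (n : nat) :
  sum_n (fun k => a k + b k) n = sum_n a n + sum_n b n :> R.
Proof. apply (sum_n_plus (G := R_AbelianMonoid)). Qed.

Lemma sum_n_Rmult_l (c : R) (a : nat -> R) (n : nat) :
  sum_n (fun k => c * a k) n = c * sum_n a n :> R.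
Proof. apply (sum_n_mult_l (K := R_Ring)). Qed.

Lemma sum_n_Rmult_r (c : R) (a : nat -> R) (n : nat) :
  sum_n (fun k => a k * c) n = sum_n a n * c :> R.
Proof. apply (sum_n_mult_r (K := R_Ring)). Qed.

(* [bwalk m j] is the binomial coefficient C(2m, m+j). *)
Fixpoint bwalk (m j : nat) : R :=
  match m with
  | O => match j with O => 1 | S _ => 0 end
  | S m => match j with
           | O => 2 * bwalk m 0 + 2 * bwalk m 1
           | S j' => bwalk m j' + 2 * bwalk m (S j') + bwalk m (S (S j'))
           end
  end.

Lemma bwalk_out (m j : nat) : (m < j)%nat -> bwalk m j = 0.
Proof.
  revert j. induction m as [|m IH]; intros [|j] H; try lia; [reflexivity|].
  simpl. rewrite !IH by lia. ring.
Qed.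

(** The ratio of consecutive binomial coefficients, [(m - j) / (m + j + 1)]. The product form also
    holds for [j >= m], where both sides vanish. *)
Lemma bwalk_ratio (m j : nat) :
  bwalk m (S j) * (INR m + INR j + 1) = bwalk m j * (INR m - INR j).
Proof.
  revert j. induction m as [|m IH]; intros j.
  { destruct j; simpl bwalk; simpl INR; ring. }
  assert (St : forall i, bwalk m (S i) = bwalk m i * ((INR m - INR i) / (INR m + INR i + 1))).
  { intros i. pose proof (pos_INR m). pose proof (pos_INR i). specialize (IH i).
    apply Rmult_eq_reg_r with (INR m + INR i + 1); [|lra]. rewrite IH. field. lra. }
  pose proof (pos_INR m) as Pm. pose proof (pos_INR j) as Pj.
  destruct j as [|j].
  - change (bwalk (S m) 1) with (bwalk m 0 + 2 * bwalk m 1 + bwalk m 2).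
    change (bwalk (S m) 0) with (2 * bwalk m 0 + 2 * bwalk m 1).
    rewrite (St 1%nat), (St 0%nat), !S_INR. simpl (INR 0). field. lra.
  - change (bwalk (S m) (S (S j))) with (bwalk m (S j) + 2 * bwalk m (S (S j)) + bwalk m (S (S (S j)))).
    change (bwalk (S m) (S j)) with (bwalk m j + 2 * bwalk m (S j) + bwalk m (S (S j))).
    rewrite (St (S (S j))), (St (S j)), (St j), !S_INR. pose proof (pos_INR j). field. lra.
Qed.

Lemma bwalk_0_pos (m : nat) : 0 < bwalk m 0.
Proof.
  induction m as [|m IH]; [simpl; lra|].
  change (bwalk (S m) 0) with (2 * bwalk m 0 + 2 * bwalk m 1).
  pose proof (bwalk_ratio m 0) as E. simpl (INR 0) in E. pose proof (pos_INR m).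
  assert (0 <= bwalk m 1); [|lra].
  apply Rmult_le_reg_r with (INR m + 0 + 1); [lra|]. rewrite E. nra.
Qed.

Lemma cos_prod_shift (y : R) (n : nat) :
  2 * cos (2 * y) * cos (2 * INR (S n) * y) = cos (2 * INR (S (S n)) * y) + cos (2 * INR n * y).
Proof.
  rewrite !S_INR.
  replace (2 * (INR n + 1 + 1) * y) with (2 * (INR n + 1) * y + 2 * y) by ring.
  replace (2 * INR n * y) with (2 * (INR n + 1) * y - 2 * y) by ring.
  rewrite cos_plus, cos_minus. ring.
Qed.

(** Binomial expansion of [(e^(iy) + e^(-iy))^(2m)] with opposite frequencies paired; the frequency
    0 is then counted twice, which the last term corrects. *)
Lemma bwalk_cos_sum (m N : nat) (y : R) : (m <= N)%nat ->
  (2 + 2 * cos (2 * y)) ^ m =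
  2 * sum_n (fun j => bwalk m j * cos (2 * INR j * y)) N - bwalk m 0.
Proof.
  revert N. induction m as [|m IH]; intros N HN.
  - assert (E : forall n, sum_n (fun j => bwalk 0 j * cos (2 * INR j * y)) n = 1 :> R).
    { induction n as [|n En].
      - rewrite sum_n_0. simpl. rewrite Rmult_0_r, Rmult_0_l, cos_0. ring.
      - rewrite sum_n_S, En. simpl bwalk. ring. }
    rewrite E. simpl. ring.
  - assert (Sh : forall n,
      2 * sum_n (fun j => bwalk (S m) j * cos (2 * INR j * y)) n - bwalk (S m) 0 =
      (2 + 2 * cos (2 * y)) * (2 * sum_n (fun j => bwalk m j * cos (2 * INR j * y)) n - bwalk m 0)
      + 2 * bwalk m (S n) * cos (2 * INR n * y) - 2 * bwalk m n * cos (2 * INR (S n) * y)).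
    { induction n as [|n En].
      - rewrite !sum_n_0. simpl. rewrite !Rmult_0_r, Rmult_0_l, cos_0. rewrite !Rmult_1_r. ring.
      - rewrite !sum_n_S.
        change (bwalk (S m) (S n)) with (bwalk m n + 2 * bwalk m (S n) + bwalk m (S (S n))).
        pose proof (cos_prod_shift y n) as Cs.
        set (c0 := cos (2 * INR n * y)) in *. set (c1 := cos (2 * INR (S n) * y)) in *.
        set (c2 := cos (2 * INR (S (S n)) * y)) in *. set (c := cos (2 * y)) in *.
        set (s1 := sum_n _ n) in *. set (s2 := sum_n _ n) in *.
        replace c2 with (2 * c * c1 - c0) by lra.
        lra. }
    rewrite Sh, <- IH by lia. rewrite !bwalk_out by lia. simpl. ring.
Qed.

Lemma dirichlet_kernel (x : R) (p : nat) :
  (2 * sum_n (fun k => cos (INR k * x)) p - 1) * sin (x / 2) = sin ((2 * INR p + 1) * x / 2).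
Proof.
  induction p as [|p IH].
  - rewrite sum_n_0. simpl. rewrite Rmult_0_l, cos_0. replace ((2 * 0 + 1) * x / 2) with (x / 2) by field. ring.
  - rewrite sum_n_S.
    replace ((2 * (sum_n (fun k => cos (INR k * x)) p + cos (INR (S p) * x)) - 1) * sin (x / 2)) with
      ((2 * sum_n (fun k => cos (INR k * x)) p - 1) * sin (x / 2) + 2 * cos (INR (S p) * x) * sin (x / 2)) by ring.
    rewrite IH, S_INR.
    replace ((2 * INR p + 1) * x / 2) with ((INR p + 1) * x - x / 2) by field.
    replace ((2 * (INR p + 1) + 1) * x / 2) with ((INR p + 1) * x + x / 2) by field.
    rewrite sin_plus, sin_minus. ring.
Qed.

(** For an odd order the roots of unity other than 1 fall into [p] conjugate pairs, so a sum over
    all of them is twice the sum over [0 <= k <= p] minus the term [k = 0]. *)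
Definition oddl (p : nat) : nat := (2 * p + 1)%nat.

Lemma INR_oddl (p : nat) : INR (oddl p) = 2 * INR p + 1.
Proof. unfold oddl. rewrite plus_INR, mult_INR. simpl. ring. Qed.

Lemma oddl_pos (p : nat) : 0 < INR (oddl p).
Proof. rewrite INR_oddl. pose proof (pos_INR p). lra. Qed.

Definition root_angle (p k : nat) : R := PI * INR k / INR (oddl p).

Definition root_cos_sum (p j : nat) : R :=
  2 * sum_n (fun k => cos (2 * INR j * root_angle p k)) p - 1.

Lemma root_cos_sum_dvd (p i : nat) : root_cos_sum p (oddl p * i) = INR (oddl p).
Proof.
  unfold root_cos_sum.
  rewrite (sum_n_ext _ (fun _ => 1)).
  - rewrite sum_n_const, INR_oddl, S_INR. ring.
  - intros k. unfold root_angle. pose proof (oddl_pos p).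
    replace (2 * INR (oddl p * i) * (PI * INR k / INR (oddl p))) with (0 + 2 * INR (i * k) * PI).
    + now rewrite cos_period, cos_0.
    + rewrite !mult_INR. field. lra.
Qed.

(** In the Dirichlet kernel at [x = 2 pi j / l], with [l = oddl p], the right side is
    [sin (pi j) = 0], while [sin (x / 2) = sin (pi j / l)] vanishes only if [l] divides [j]. *)
Lemma root_cos_sum_ndvd (p j : nat) : ~ Nat.divide (oddl p) j -> root_cos_sum p j = 0.
Proof.
  intros H. unfold root_cos_sum. pose proof (oddl_pos p) as Hl. pose proof PI_RGT_0 as Hpi.
  set (x := 2 * PI * INR j / INR (oddl p)).
  rewrite (sum_n_ext _ (fun k => cos (INR k * x))).
  2:{ intros k. f_equal. unfold x, root_angle. field. lra. }
  pose proof (dirichlet_kernel x p) as D.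
  rewrite <- INR_oddl in D.
  replace (INR (oddl p) * x / 2) with (INR j * PI) in D by (unfold x; field; lra).
  rewrite (sin_eq_0_1 (INR j * PI)) in D.
  2:{ exists (Z.of_nat j). now rewrite <- INR_IZR_INZ. }
  apply Rmult_integral in D as [D|D]; [exact D|exfalso]. apply H.
  apply sin_eq_0_0 in D as [k Hk].
  assert (E : INR j = IZR k * INR (oddl p)).
  { apply Rmult_eq_reg_r with PI; [|lra]. unfold x in Hk.
    apply (f_equal (fun r => r * INR (oddl p))) in Hk.
    replace (IZR k * INR (oddl p) * PI) with (IZR k * PI * INR (oddl p)) by ring. rewrite <- Hk. field. lra. }
  rewrite !INR_IZR_INZ, <- mult_IZR in E. apply eq_IZR in E.
  exists (Z.to_nat k). unfold oddl in *. nia.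
Qed.

Lemma sum_bwalk_multiples (m p J : nat) :
  sum_n (fun j => bwalk m j * root_cos_sum p j) (oddl p * J) =
  INR (oddl p) * sum_n (fun i => bwalk m (oddl p * i)) J :> R.
Proof.
  induction J as [|J IH].
  - rewrite Nat.mul_0_r, !sum_n_0. rewrite <- (root_cos_sum_dvd p 0), !Nat.mul_0_r. ring.
  - assert (Sk : forall r, (r < oddl p)%nat ->
      sum_n (fun j => bwalk m j * root_cos_sum p j) (oddl p * J + r) =
      sum_n (fun j => bwalk m j * root_cos_sum p j) (oddl p * J) :> R).
    { induction r as [|r IHr]; intros Hr; [now rewrite Nat.add_0_r|].
      rewrite Nat.add_succ_r, sum_n_S, IHr by lia. rewrite root_cos_sum_ndvd; [ring|].
      intros [q Hq]. rewrite <- Nat.add_succ_r in Hq.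
      rewrite (Nat.mul_comm q) in Hq.
      assert (oddl p * J < oddl p * q < oddl p * (J + 1))%nat as [L1 L2] by lia.
      apply Nat.mul_lt_mono_pos_l in L1; [|lia]. apply Nat.mul_lt_mono_pos_l in L2; lia. }
    replace (oddl p * S J)%nat with (S (oddl p * J + 2 * p))%nat by (unfold oddl; lia).
    rewrite sum_n_S, Sk by (unfold oddl; lia).
    replace (S (oddl p * J + 2 * p))%nat with (oddl p * S J)%nat by (unfold oddl; lia).
    rewrite root_cos_sum_dvd, sum_n_S, IH. ring.
Qed.

Lemma double_cos (y : R) : 2 + 2 * cos (2 * y) = 4 * cos y ^ 2.
Proof. rewrite cos_2a_cos. ring. Qed.

(* Summing [(2 cos y)^(2m)] over the roots of unity of order 2p+1 selects the
   binomial coefficients C(2m, m+j) with j a multiple of 2p+1. *)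
Lemma polya_identity (m p J : nat) : (m <= oddl p * J)%nat ->
  2 * sum_n (fun k => cos (root_angle p k) ^ (2 * m)) p - 1 =
  INR (oddl p) * (bwalk m 0 / 4 ^ m) *
  (2 * sum_n (fun i => bwalk m (oddl p * i) / bwalk m 0) J - 1).
Proof.
  intros HJ. set (N := (oddl p * J)%nat) in *.
  assert (P4 : 0 < 4 ^ m) by (apply pow_lt; lra).
  pose proof (bwalk_0_pos m) as Hb.
  assert (E : sum_n (fun k => 4 ^ m * cos (root_angle p k) ^ (2 * m)) p =
     2 * sum_n (fun j => bwalk m j * sum_n (fun k => cos (2 * INR j * root_angle p k)) p) N
     - INR (S p) * bwalk m 0 :> R).
  { rewrite (sum_n_ext _ (fun k => 2 * sum_n (fun j => bwalk m j * cos (2 * INR j * root_angle p k)) N + - bwalk m 0)).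
    - rewrite sum_n_Rplus, sum_n_const.
      rewrite (sum_n_Rmult_l 2 (fun k => sum_n (fun j => bwalk m j * cos (2 * INR j * root_angle p k)) N)).
      rewrite sum_n_switch.
      rewrite (sum_n_ext (fun j => sum_n (fun i => bwalk m j * cos (2 * INR j * root_angle p i)) p)
        (fun j => bwalk m j * sum_n (fun k => cos (2 * INR j * root_angle p k)) p)).
      + Rring.
      + intros j. apply sum_n_Rmult_l.
    - intros k. rewrite pow_mult, <- Rpow_mult_distr, <- double_cos.
      rewrite (bwalk_cos_sum m N) by exact HJ. reflexivity. }
  (* The expansion at [y = 0]. After multiplication by [4 ^ m] it turns the [- 1] on the left into a
     sum of coefficients, matching the [- 1] inside [root_cos_sum]. *)
  assert (T0 : 4 ^ m = 2 * sum_n (bwalk m) N - bwalk m 0).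
  { replace (4 ^ m) with ((2 + 2 * cos (2 * 0)) ^ m).
    - rewrite (bwalk_cos_sum m N) by exact HJ. do 2 f_equal. apply sum_n_ext. intros j.
      rewrite Rmult_0_r, cos_0. Rring.
    - rewrite Rmult_0_r, cos_0. f_equal. ring. }
  rewrite (sum_n_Rmult_l (4 ^ m)) in E.
  assert (F : sum_n (fun j => bwalk m j * root_cos_sum p j) N =
     2 * sum_n (fun j => bwalk m j * sum_n (fun k => cos (2 * INR j * root_angle p k)) p) N - sum_n (bwalk m) N :> R).
  { unfold root_cos_sum.
    rewrite (sum_n_ext _ (fun j => 2 * (bwalk m j * sum_n (fun k => cos (2 * INR j * root_angle p k)) p) + (-1) * bwalk m j))
      by (intros; Rring).
    rewrite sum_n_Rplus.
    rewrite (sum_n_Rmult_l 2 (fun j => bwalk m j * sum_n (fun k => cos (2 * INR j * root_angle p k)) p)).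
    rewrite (sum_n_Rmult_l (-1) (bwalk m)).
    Rring. }
  unfold N in F at 1. rewrite sum_bwalk_multiples in F.
  assert (Q : sum_n (fun i => bwalk m (oddl p * i) / bwalk m 0) J =
     sum_n (fun i => bwalk m (oddl p * i)) J * / bwalk m 0 :> R)
    by apply (sum_n_Rmult_r (/ bwalk m 0)).
  rewrite Q. rewrite S_INR in E. rewrite INR_oddl in *.
  set (S1 := sum_n (fun i => bwalk m (oddl p * i)) J) in *.
  set (S2 := sum_n (fun k => cos (root_angle p k) ^ (2 * m)) p) in *.
  apply Rmult_eq_reg_l with (4 ^ m); [|lra].
  replace (4 ^ m * (2 * S2 - 1)) with (2 * (4 ^ m * S2) - 4 ^ m) by ring.
  rewrite E.
  replace (4 ^ m * ((2 * INR p + 1) * (bwalk m 0 / 4 ^ m) * (2 * (S1 * / bwalk m 0) - 1))) with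
    ((2 * INR p + 1) * (2 * S1 - bwalk m 0)) by (field; lra).
  lra.
Qed.

(** * Passage to the limit under sums *)

Lemma Series_tail (a : nat -> R) (K : nat) : ex_series a ->
  Series a = sum_n a K + Series (fun k => a (S K + k)%nat).
Proof.
  intros H. rewrite (Series_incr_n a (S K)) by (lia || exact H).
  rewrite <- sum_n_Reals. reflexivity.
Qed.

Lemma Series_tail_lim (a : nat -> R) : ex_series a ->
  is_lim_seq (fun K => Series (fun k => a (S K + k)%nat)) 0.
Proof.
  intros H. apply is_lim_seq_ext with (fun K => Series a - sum_n a K).
  - intros K. rewrite (Series_tail a K H). ring.
  - replace (Finite 0) with (Rbar_minus (Series a) (Series a)) by (simpl; f_equal; ring).
    apply is_lim_seq_minus'; [apply is_lim_seq_const|]. exact (Series_correct a H).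
Qed.

Lemma ex_series_shift (a : nat -> R) (K : nat) : ex_series a -> ex_series (fun k => a (K + k)%nat).
Proof. apply (ex_series_incr_n (V := R_NormedModule)). Qed.

Lemma ex_series_dominated (a b : nat -> R) : (forall k, Rabs (a k) <= b k) -> ex_series b -> ex_series a.
Proof. intros H Hb. exact (ex_series_le (V := R_CompleteNormedModule) a b H Hb). Qed.

Lemma sum_n_lim_0 (w : nat -> nat -> R) (K : nat) :
  (forall k, is_lim_seq (fun n => w n k) 0) -> is_lim_seq (fun n => sum_n (w n) K) 0.
Proof.
  intros H. induction K as [|K IH].
  - apply is_lim_seq_ext with (fun n => w n 0%nat); [intros; now rewrite sum_n_0|apply H].
  - apply is_lim_seq_ext with (fun n => sum_n (w n) K + w n (S K)); [intros; now rewrite sum_n_S|].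
    replace (Finite 0) with (Finite (0 + 0)) by (f_equal; ring). apply is_lim_seq_plus'; [exact IH|apply H].
Qed.

(** Dominated convergence for series. Domination is only asked for large [n], because the order of
    the roots of unity is close to its asymptotic size only then. *)
Lemma tannery (u : nat -> nat -> R) (v M : nat -> R) :
  (forall k, is_lim_seq (fun n => u n k) (v k)) ->
  eventually (fun n => forall k, Rabs (u n k) <= M k) -> ex_series M ->
  is_lim_seq (fun n => Series (u n)) (Series v).
Proof.
  intros Hl Hd HM.
  assert (Hv : forall k, Rabs (v k) <= M k).
  { intros k. apply (is_lim_seq_le_loc (fun n => Rabs (u n k)) (fun _ => M k) (Rabs (v k)) (M k)).
    - destruct Hd as [N HN]. exists N. auto.
    - exact (is_lim_seq_abs _ _ (Hl k)).
    - apply is_lim_seq_const. }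
  set (w := fun n k => Rabs (u n k - v k)).
  assert (Hw0 : forall k, is_lim_seq (fun n => w n k) 0).
  { intros k. unfold w. replace (Finite 0) with (Rbar_abs (Finite (v k - v k))).
    - apply is_lim_seq_abs. apply is_lim_seq_minus'; [apply Hl|apply is_lim_seq_const].
    - simpl. rewrite Rminus_diag, Rabs_R0. reflexivity. }
  assert (H2M : ex_series (fun k => 2 * M k)) by apply (ex_series_scal_l 2 M HM).
  apply is_lim_seq_spec. intros eps.
  (* Since [w n k <= 2 * M k], the tail costs two quarters of [eps] and the head one. *)
  assert (He : 0 < eps / 4) by (pose proof (cond_pos eps); lra).
  destruct (proj2 (is_lim_seq_spec _ _) (Series_tail_lim M HM) (mkposreal _ He)) as [K HK].
  specialize (HK K (le_n K)). change (Rabs (Series (fun k => M (S K + k)%nat) - 0) < eps / 4) in HK.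
  destruct (proj2 (is_lim_seq_spec _ _) (sum_n_lim_0 w K Hw0) (mkposreal _ He)) as [N1 HN1]. simpl in HN1.
  destruct Hd as [N2 HN2]. exists (max N1 N2). intros n Hn.
  specialize (HN1 n ltac:(lia)). specialize (HN2 n ltac:(lia)).
  assert (Hwb : forall k, 0 <= w n k <= 2 * M k).
  { intros k. unfold w. split; [apply Rabs_pos|]. eapply Rle_trans; [apply Rabs_triang|].
    rewrite Rabs_Ropp. specialize (HN2 k). specialize (Hv k). lra. }
  assert (Ew : ex_series (w n)).
  { apply ex_series_dominated with (2 := H2M). intros k. rewrite Rabs_pos_eq; apply Hwb. }
  rewrite <- Series_minus by (eapply ex_series_dominated; eassumption).
  eapply Rle_lt_trans; [apply Series_Rabs; exact Ew|].
  change (Series (w n) < eps). rewrite (Series_tail _ K Ew).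
  assert (Series (fun k => w n (S K + k)%nat) <= 2 * Series (fun k => M (S K + k)%nat)).
  { rewrite <- Series_scal_l. apply Series_le; [intros; apply Hwb|].
    apply (ex_series_shift (fun k => 2 * M k)). exact H2M. }
  rewrite Rminus_0_r in HK, HN1. apply Rabs_lt_between in HK, HN1. lra.
Qed.

Lemma Series_finite (a : nat -> R) (N : nat) : (forall k, (N < k)%nat -> a k = 0) ->
  Series a = sum_n a N.
Proof.
  intros H. apply is_series_unique.
  apply filterlim_ext_loc with (fun _ => sum_n a N); [|apply filterlim_const].
  exists N. intros n Hn. change (sum_n a N = sum_n a n :> R). replace n with (N + (n - N))%nat by lia.
  induction (n - N)%nat as [|d IH]; [now rewrite Nat.add_0_r|].
  rewrite Nat.add_succ_r, sum_n_S, <- IH, H by lia. symmetry; apply Rplus_0_r.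
Qed.

(** * Gaussian bounds for powers of the cosine and for binomial ratios *)

Lemma exp_pow (t : R) (n : nat) : exp t ^ n = exp (INR n * t).
Proof.
  induction n as [|n IH]; [simpl; now rewrite Rmult_0_l, exp_0|].
  rewrite S_INR. simpl. rewrite IH, <- exp_plus. f_equal. ring.
Qed.

Lemma exp_neg_pow_le (c : R) (n : nat) : 0 <= c -> exp (- (c * INR n ^ 2)) <= exp (- c) ^ n.
Proof.
  intros Hc. rewrite exp_pow. apply exp_le.
  assert (INR n <= INR n ^ 2).
  { destruct n as [|n]; [simpl; lra|]. rewrite S_INR. pose proof (pos_INR n). nra. }
  nra.
Qed.

Lemma ex_series_exp_pow (c : R) : 0 < c -> ex_series (fun n => exp (- c) ^ n).
Proof.
  intros Hc. apply ex_series_geom. rewrite Rabs_pos_eq by (left; apply exp_pos).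
  rewrite <- exp_0. apply exp_increasing. lra.
Qed.

Lemma one_sub_le_exp (y : R) : 1 - y <= exp (- y).
Proof. pose proof (exp_ineq1_le (- y)). lra. Qed.

(** The inequality [1 + x <= e^x] at [x = y / (1 - y)], where [1 + x = 1 / (1 - y)]. With
    [one_sub_le_exp] it encloses [1 - y] between exponentials that agree to first order. *)
Lemma exp_le_one_sub (y : R) : y < 1 -> exp (- (y / (1 - y))) <= 1 - y.
Proof.
  intros Hy. pose proof (exp_ineq1_le (y / (1 - y))) as H. rewrite exp_Ropp.
  apply Rmult_le_reg_r with (exp (y / (1 - y))); [apply exp_pos|].
  rewrite Rinv_l by (pose proof (exp_pos (y / (1 - y))); lra).
  replace 1 with ((1 - y) * (1 + y / (1 - y))) at 1 by (field; lra).
  apply Rmult_le_compat_l; lra.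
Qed.

(** A weak form of Jordan's inequality: in [sin x = 2 sin (x/2) cos (x/2)] the cosine on [[0, PI/4]]
    is at least [1 / sqrt 2], used once for [cos (x/2)] and once for the slope of the sine. *)
Lemma sin_ge_half (x : R) : 0 <= x <= PI / 2 -> x / 2 <= sin x.
Proof.
  intros Hx. pose proof PI_RGT_0 as Hpi.
  assert (C4 : forall t, 0 <= t <= PI / 4 -> / sqrt 2 <= cos t).
  { intros t Ht. replace (/ sqrt 2) with (cos (PI / 4)) by (rewrite cos_PI4; unfold Rdiv; ring).
    apply cos_decr_1; lra. }
  assert (S2 : / sqrt 2 * / sqrt 2 = / 2) by (rewrite <- Rinv_mult, sqrt_sqrt by lra; reflexivity).
  assert (P2 : 0 < / sqrt 2) by (apply Rinv_0_lt_compat, sqrt_lt_R0; lra).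
  assert (Sh : x / 2 * / sqrt 2 <= sin (x / 2)).
  { destruct (MVT_gen sin 0 (x / 2) cos) as [c [Hc E]].
    - intros. auto_derive; [trivial|ring].
    - intros. apply continuity_sin.
    - rewrite sin_0, !Rminus_0_r in E. rewrite E, Rmult_comm.
      rewrite Rmin_left, Rmax_right in Hc by lra.
      apply Rmult_le_compat_r; [lra|]. apply C4. lra. }
  replace (sin x) with (2 * sin (x / 2) * cos (x / 2)) by (rewrite <- sin_2a; f_equal; field).
  pose proof (C4 (x / 2) ltac:(lra)) as Ch.
  assert (x / 2 * / sqrt 2 * / sqrt 2 <= sin (x / 2) * cos (x / 2)).
  { apply Rmult_le_compat; try lra. apply Rmult_le_pos; lra. }
  rewrite Rmult_assoc, S2 in H. lra.
Qed.

Lemma cos_even_pow (x : R) (m : nat) : cos x ^ (2 * m) = (1 - sin x * sin x) ^ m.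
Proof.
  rewrite pow_mult. f_equal. pose proof (sin2_cos2 x) as E. unfold Rsqr in E. simpl. lra.
Qed.

Lemma cos_even_pow_dominated (x : R) (m : nat) : 0 <= x <= PI / 2 ->
  0 <= cos x ^ (2 * m) <= exp (- (INR m * (x * x) / 4)).
Proof.
  intros Hx. rewrite cos_even_pow. pose proof (SIN_bound x). pose proof (sin_ge_half x Hx).
  split; [apply pow_le; nra|].
  eapply Rle_trans; [apply pow_incr; split; [nra|apply one_sub_le_exp]|].
  rewrite exp_pow. apply exp_le. pose proof (pos_INR m).
  assert (x * x / 4 <= sin x * sin x) by nra. nra.
Qed.

(** Sharp when [x] tends to 0 with [m x^2] convergent: both exponents then have the same limit. This
    gives the termwise limit, and [cos_even_pow_dominated] the majorant on the whole range of
    angles. *)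
Lemma cos_even_pow_bounds (x : R) (m : nat) : 0 <= x < 1 ->
  exp (- (INR m * (x * x) / (1 - x * x))) <= cos x ^ (2 * m) <=
  exp (- (INR m * (x * x) * ((1 - x) * (1 - x)))).
Proof.
  intros Hx. rewrite cos_even_pow. pose proof (pos_INR m) as Pm.
  pose proof (sin_abs_le x) as S1. apply Rsqr_le_abs_1 in S1. unfold Rsqr in S1.
  pose proof (sin_taylor1 x) as S2. apply Rabs_le_between in S2.
  split.
  - replace (- (INR m * (x * x) / (1 - x * x))) with (INR m * - (x * x / (1 - x * x))) by (field; nra).
    rewrite <- exp_pow. apply pow_incr. split; [left; apply exp_pos|].
    eapply Rle_trans; [apply exp_le_one_sub; nra|lra].
  - eapply Rle_trans; [apply pow_incr; split; [nra|apply one_sub_le_exp]|].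
    rewrite exp_pow. apply exp_le.
    assert (x * x * ((1 - x) * (1 - x)) <= sin x * sin x).
    { assert (0 <= x * (1 - x) <= sin x) by nra.
      replace (x * x * ((1 - x) * (1 - x))) with (x * (1 - x) * (x * (1 - x))) by ring.
      apply Rmult_le_compat; lra. }
    nra.
Qed.

Definition bratio (m j : nat) : R := bwalk m j / bwalk m 0.

Lemma bratio_S (m j : nat) : bratio m (S j) = bratio m j * (1 - (2 * INR j + 1) / (INR m + INR j + 1)).
Proof.
  unfold bratio. pose proof (bwalk_0_pos m). pose proof (pos_INR m). pose proof (pos_INR j).
  pose proof (bwalk_ratio m j) as E.
  replace (bwalk m (S j)) with (bwalk m j * (INR m - INR j) / (INR m + INR j + 1)).
  - field. lra.
  - rewrite <- E. field. lra.
Qed.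

(** The ratio is the product over [i < j] of [1 - y] with [y = (2 i + 1) / (m + i + 1)], and the
    numerators add up to [j^2]. The upper bound enlarges the denominators to [m + K]; the lower one
    uses [y / (1 - y) = (2 i + 1) / (m - i)]. A fixed [K] keeps the bounds stable in the induction:
    [K = j] gives the limit, [K = m] the majorant. *)
Lemma bratio_bounds (m K j : nat) : (j <= K <= m)%nat ->
  0 <= bratio m j <= exp (- (INR j ^ 2 / (INR m + INR K))) /\
  ((K < m)%nat -> exp (- (INR j ^ 2 / (INR m - INR K))) <= bratio m j).
Proof.
  intros [HjK HKm]. induction j as [|j IH].
  - unfold bratio. pose proof (bwalk_0_pos m). rewrite Rdiv_diag by lra. simpl (INR 0).
    replace (0 ^ 2) with 0 by ring. unfold Rdiv. rewrite !Rmult_0_l, Ropp_0, exp_0. lra.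
  - destruct (IH ltac:(lia)) as [[P U] L]. rewrite bratio_S.
    assert (Hj : INR j + 1 <= INR K) by (rewrite <- S_INR; apply le_INR; lia).
    assert (HK : INR K <= INR m) by (apply le_INR; lia).
    pose proof (pos_INR j) as Pj.
    set (y := (2 * INR j + 1) / (INR m + INR j + 1)).
    assert (Y1 : 1 - y = (INR m - INR j) / (INR m + INR j + 1)) by (unfold y; field; lra).
    assert (Y2 : 0 <= 1 - y) by (rewrite Y1; apply Rdiv_le_0_compat; lra).
    split; [split|].
    + now apply Rmult_le_pos.
    + replace (- (INR (S j) ^ 2 / (INR m + INR K))) with
        (- (INR j ^ 2 / (INR m + INR K)) + - ((2 * INR j + 1) / (INR m + INR K))) by (rewrite S_INR; field; lra).
      rewrite exp_plus. apply Rmult_le_compat; [exact P|exact Y2|exact U|].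
      eapply Rle_trans; [apply one_sub_le_exp|]. apply exp_le, Ropp_le_contravar.
      unfold y, Rdiv. apply Rmult_le_compat_l; [lra|]. apply Rinv_le_contravar; lra.
    + intros HK1. specialize (L HK1). apply lt_INR in HK1.
      replace (- (INR (S j) ^ 2 / (INR m - INR K))) with
        (- (INR j ^ 2 / (INR m - INR K)) + - ((2 * INR j + 1) / (INR m - INR K))) by (rewrite S_INR; field; lra).
      rewrite exp_plus. apply Rmult_le_compat; [left; apply exp_pos|left; apply exp_pos|exact L|].
      eapply Rle_trans; [|apply exp_le_one_sub].
      * apply exp_le, Ropp_le_contravar. rewrite Y1. unfold y.
        replace ((2 * INR j + 1) / (INR m + INR j + 1) / ((INR m - INR j) / (INR m + INR j + 1)))
          with ((2 * INR j + 1) / (INR m - INR j)) by (field; lra).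
        unfold Rdiv. apply Rmult_le_compat_l; [lra|]. apply Rinv_le_contravar; lra.
      * assert (0 < 1 - y); [|lra]. rewrite Y1. apply Rdiv_lt_0_compat; lra.
Qed.

Lemma bratio_out (m j : nat) : (m < j)%nat -> bratio m j = 0.
Proof. intros H. unfold bratio. rewrite bwalk_out by exact H. unfold Rdiv. ring. Qed.

(** * The functional equation of theta *)

Lemma sqrt_INR_S_pos (m : nat) : 0 < sqrt (INR (S m)).
Proof. apply sqrt_lt_R0, lt_0_INR. lia. Qed.

(** An order proportional to [sqrt (m + 1)] is the critical scaling: both [(m + 1)] times a squared
    angle and the squared multiples of the order over [m + 1] then have finite limits, so both sides
    of Polya's identity become theta series. *)
Definition half_order (tau : R) (m : nat) : nat := Z.to_nat (up (sqrt (INR (S m)) / sqrt tau)).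

(* The order l of the roots of unity used with the exponent 2(m+1), relative to
   sqrt (m+1); it tends to 2 / sqrt tau. *)
Definition order_scale (tau : R) (m : nat) : R :=
  INR (oddl (half_order tau m)) * / sqrt (INR (S m)).

Lemma order_scale_bounds (tau : R) (m : nat) : 0 < tau ->
  2 / sqrt tau + / sqrt (INR (S m)) <= order_scale tau m <=
  2 / sqrt tau + 3 * / sqrt (INR (S m)).
Proof.
  intros Ht. apply sqrt_lt_R0 in Ht. pose proof (sqrt_INR_S_pos m) as Hs.
  set (r := sqrt (INR (S m)) / sqrt tau).
  assert (Hr : 0 < r) by now apply Rdiv_lt_0_compat.
  destruct (archimed r) as [A1 A2].
  assert (E : INR (half_order tau m) = IZR (up r)).
  { unfold half_order. fold r. rewrite INR_IZR_INZ, Z2Nat.id; [reflexivity|].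
    apply le_IZR. lra. }
  unfold order_scale. rewrite INR_oddl, E.
  replace (2 / sqrt tau + / sqrt (INR (S m))) with ((2 * r + 1) * / sqrt (INR (S m))) by (unfold r; field; lra).
  replace (2 / sqrt tau + 3 * / sqrt (INR (S m))) with ((2 * r + 3) * / sqrt (INR (S m))) by (unfold r; field; lra).
  assert (0 < / sqrt (INR (S m))) by now apply Rinv_0_lt_compat.
  split; apply Rmult_le_compat_r; lra.
Qed.

Lemma is_lim_seq_inv_sqrt : is_lim_seq (fun m => / sqrt (INR (S m))) 0.
Proof.
  replace (Finite 0) with (Rbar_inv p_infty) by reflexivity.
  apply is_lim_seq_inv; [|discriminate].
  apply (is_lim_seq_le_p_loc (fun m => sqrt (INR m))).
  - exists 0%nat. intros n _. apply sqrt_le_1_alt. rewrite S_INR. lra.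
  - apply (is_lim_comp_seq sqrt INR p_infty p_infty).
    + apply filterlim_sqrt_p.
    + exists 0%nat. discriminate.
    + apply is_lim_seq_INR.
Qed.

Lemma is_lim_seq_order_scale (tau : R) : 0 < tau -> is_lim_seq (order_scale tau) (2 / sqrt tau).
Proof.
  intros Ht.
  apply (is_lim_seq_le_le (fun m => 2 / sqrt tau + / sqrt (INR (S m))) _
    (fun m => 2 / sqrt tau + 3 * / sqrt (INR (S m)))).
  - intros m. now apply order_scale_bounds.
  - replace (Finite (2 / sqrt tau)) with (Finite (2 / sqrt tau + 0)) by (f_equal; ring).
    apply is_lim_seq_plus'; [apply is_lim_seq_const|apply is_lim_seq_inv_sqrt].
  - replace (Finite (2 / sqrt tau)) with (Finite (2 / sqrt tau + 3 * 0)) by (f_equal; ring).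
    apply is_lim_seq_plus'; [apply is_lim_seq_const|].
    exact (is_lim_seq_scal_l _ 3 _ is_lim_seq_inv_sqrt).
Qed.

Lemma continuity_pt_exp (x : R) : continuity_pt exp x.
Proof. apply derivable_continuous_pt, derivable_pt_exp. Qed.

Lemma is_lim_seq_exp (u : nat -> R) (l : R) : is_lim_seq u l -> is_lim_seq (fun n => exp (u n)) (exp l).
Proof. apply is_lim_seq_continuous, continuity_pt_exp. Qed.

Lemma is_lim_seq_opp_R (u : nat -> R) (l : R) : is_lim_seq u l -> is_lim_seq (fun n => - u n) (- l).
Proof. intros H. exact (proj1 (is_lim_seq_opp u l) H). Qed.

Lemma eventually_lt_lim (u : nat -> R) (l a : R) : is_lim_seq u l -> l < a -> eventually (fun n => u n < a).
Proof.
  intros H Hl. assert (He : 0 < a - l) by lra.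
  destruct (proj2 (is_lim_seq_spec _ _) H (mkposreal _ He)) as [N HN]. exists N. intros n Hn.
  specialize (HN n Hn). simpl in HN. apply Rabs_lt_between in HN. lra.
Qed.

Lemma eventually_gt_lim (u : nat -> R) (l a : R) : is_lim_seq u l -> a < l -> eventually (fun n => a < u n).
Proof.
  intros H Hl. assert (He : 0 < l - a) by lra.
  destruct (proj2 (is_lim_seq_spec _ _) H (mkposreal _ He)) as [N HN]. exists N. intros n Hn.
  specialize (HN n Hn). simpl in HN. apply Rabs_lt_between in HN. lra.
Qed.

(** Extended by 0 past the finite range, so that the sum becomes a series and [tannery] applies.
    [bin_term] vanishes there by itself. *)
Definition cos_term (tau : R) (m k : nat) : R :=
  if Nat.leb k (half_order tau m) then cos (root_angle (half_order tau m) k) ^ (2 * S m) else 0.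

Definition bin_term (tau : R) (m j : nat) : R := bratio (S m) (oddl (half_order tau m) * j).

(** The term [k = 0] is included, so Jacobi's theta function, summed over all integers, is
    [2 * theta_half y - 1]. *)
Definition theta_half (y : R) : R := Series (fun k => exp (- (PI * INR k ^ 2 * y))).

Lemma order_scale_pos (tau : R) (m : nat) : 0 < order_scale tau m.
Proof.
  unfold order_scale. apply Rmult_lt_0_compat; [apply oddl_pos|].
  apply Rinv_0_lt_compat, sqrt_INR_S_pos.
Qed.

Lemma root_angle_scale (tau : R) (m k : nat) :
  root_angle (half_order tau m) k = PI * INR k * / sqrt (INR (S m)) / order_scale tau m.
Proof.
  unfold root_angle, order_scale. pose proof (oddl_pos (half_order tau m)). pose proof (sqrt_INR_S_pos m).
  field. lra.
Qed.

Lemma root_angle_sqr_scale (tau : R) (m k : nat) :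
  INR (S m) * (root_angle (half_order tau m) k * root_angle (half_order tau m) k) =
  PI * PI * INR k ^ 2 / (order_scale tau m * order_scale tau m).
Proof.
  unfold root_angle, order_scale. pose proof (oddl_pos (half_order tau m)). pose proof (sqrt_INR_S_pos m).
  replace (INR (S m)) with (sqrt (INR (S m)) * sqrt (INR (S m))) at 1 by (apply sqrt_sqrt, pos_INR).
  field. lra.
Qed.

Lemma root_angle_range (p k : nat) : (k <= p)%nat -> 0 <= root_angle p k <= PI / 2.
Proof.
  intros H. pose proof (oddl_pos p) as Hl. pose proof PI_RGT_0. apply le_INR in H. pose proof (pos_INR k).
  unfold root_angle. split.
  - apply Rdiv_le_0_compat; [nra|lra].
  - apply Rmult_le_reg_r with (INR (oddl p)); [lra|].
    unfold Rdiv at 1. rewrite Rmult_assoc, Rinv_l by lra. rewrite INR_oddl. nra.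
Qed.

Lemma is_lim_seq_cos_term (tau : R) (k : nat) : 0 < tau ->
  is_lim_seq (fun m => cos_term tau m k) (exp (- (PI * INR k ^ 2 * (PI * tau / 4)))).
Proof.
  intros Ht. pose proof (is_lim_seq_order_scale tau Ht) as Hq. pose proof is_lim_seq_inv_sqrt as Hs.
  pose proof (sqrt_lt_R0 _ Ht) as Hst.
  assert (Hqp : 2 / sqrt tau <> 0) by (assert (0 < 2 / sqrt tau) by (apply Rdiv_lt_0_compat; lra); lra).
  set (x := fun m => root_angle (half_order tau m) k).
  assert (Hx : is_lim_seq x 0).
  { apply is_lim_seq_ext with (fun m => PI * INR k * / sqrt (INR (S m)) / order_scale tau m).
    - intros m. symmetry. apply root_angle_scale.
    - replace (Finite 0) with (Finite (PI * INR k * 0 / (2 / sqrt tau))) by (f_equal; field; lra).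
      apply is_lim_seq_div'; [|exact Hq|exact Hqp].
      exact (is_lim_seq_scal_l _ (PI * INR k) _ Hs). }
  assert (Hy : is_lim_seq (fun m => INR (S m) * (x m * x m)) (PI * INR k ^ 2 * (PI * tau / 4))).
  { apply is_lim_seq_ext with (fun m => PI * PI * INR k ^ 2 / (order_scale tau m * order_scale tau m)).
    - intros m. symmetry. apply root_angle_sqr_scale.
    - replace (PI * INR k ^ 2 * (PI * tau / 4)) with (PI * PI * INR k ^ 2 / ((2 / sqrt tau) * (2 / sqrt tau))).
      2:{ replace (2 / sqrt tau * (2 / sqrt tau)) with (4 / (sqrt tau * sqrt tau)) by (field; lra).
          rewrite sqrt_sqrt by lra. field. lra. }
      apply is_lim_seq_div'; [apply is_lim_seq_const|now apply is_lim_seq_mult'|].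
      now apply Rmult_integral_contrapositive_currified. }
  assert (Hxx : is_lim_seq (fun m => x m * x m) 0).
  { replace (Finite 0) with (Finite (0 * 0)) by (f_equal; ring). now apply is_lim_seq_mult'. }
  assert (H1x : is_lim_seq (fun m => 1 - x m) 1).
  { replace (Finite 1) with (Finite (1 - 0)) by (f_equal; ring).
    apply is_lim_seq_minus'; [apply is_lim_seq_const|exact Hx]. }
  set (L := PI * INR k ^ 2 * (PI * tau / 4)) in *.
  apply (is_lim_seq_le_le_loc (fun m => exp (- (INR (S m) * (x m * x m) / (1 - x m * x m)))) _
     (fun m => exp (- (INR (S m) * (x m * x m) * ((1 - x m) * (1 - x m)))))).
  - destruct (eventually_lt_lim _ _ 1 Hx Rlt_0_1) as [N HN].
    (* The fixed [k] eventually enters the range in which [cos_term] is a cosine power. *)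
    assert (Hbig : eventually (fun m => (k <= half_order tau m)%nat)).
    { destruct (eventually_lt_lim _ 0 (2 / sqrt tau / (2 * INR k + 1)) Hs) as [N4 HN4].
      { pose proof (pos_INR k). apply Rdiv_lt_0_compat; [|lra]. apply Rdiv_lt_0_compat; lra. }
      exists N4. intros m Hm. specialize (HN4 m Hm).
      pose proof (proj1 (order_scale_bounds tau m Ht)) as B. unfold order_scale in B.
      pose proof (sqrt_INR_S_pos m) as Sp. assert (Ip : 0 < / sqrt (INR (S m))) by now apply Rinv_0_lt_compat.
      pose proof (pos_INR k).
      assert (C1 : / sqrt (INR (S m)) * (2 * INR k + 1) < 2 / sqrt tau).
      { apply Rmult_lt_reg_r with (/ (2 * INR k + 1)); [apply Rinv_0_lt_compat; lra|].
        rewrite Rmult_assoc, Rinv_r by lra. unfold Rdiv in *. lra. }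
      rewrite INR_oddl in B. apply INR_le.
      assert (C2 : / sqrt (INR (S m)) * (2 * INR k + 1) < / sqrt (INR (S m)) * (2 * INR (half_order tau m) + 1)) by lra.
      apply Rmult_lt_reg_l in C2; lra. }
    destruct Hbig as [N3 HN3]. exists (max N N3). intros m Hm.
    specialize (HN m ltac:(lia)). specialize (HN3 m ltac:(lia)).
    unfold cos_term. rewrite (proj2 (Nat.leb_le _ _) HN3). apply cos_even_pow_bounds.
    split; [apply root_angle_range; exact HN3|exact HN].
  - apply is_lim_seq_exp, is_lim_seq_opp_R.
    replace (Finite L) with (Finite (L / (1 - 0))) by (f_equal; field).
    apply is_lim_seq_div'; [exact Hy| |lra].
    apply is_lim_seq_minus'; [apply is_lim_seq_const|exact Hxx].
  - apply is_lim_seq_exp, is_lim_seq_opp_R.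
    replace (Finite L) with (Finite (L * (1 * 1))) by (f_equal; ring).
    apply is_lim_seq_mult'; [exact Hy|]. now apply is_lim_seq_mult'.
Qed.

Lemma cos_term_dominated (tau : R) : 0 < tau ->
  eventually (fun m => forall k, Rabs (cos_term tau m k) <= exp (- (tau / 16)) ^ k).
Proof.
  intros Ht. pose proof (is_lim_seq_order_scale tau Ht) as Hq. pose proof (sqrt_lt_R0 _ Ht) as Hst.
  (* Twice the limit of the scale [q]. Then [1 / q^2 >= tau / 16], and [PI^2 / 4 >= 1] absorbs the
     constant of [cos_even_pow_dominated]. *)
  destruct (eventually_lt_lim _ _ (4 / sqrt tau) Hq) as [N HN].
  { unfold Rdiv. apply Rmult_lt_compat_r; [now apply Rinv_0_lt_compat|lra]. }
  exists N. intros m Hm k. specialize (HN m Hm). unfold cos_term.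
  destruct (Nat.leb_spec k (half_order tau m)) as [L|L].
  - destruct (cos_even_pow_dominated (root_angle (half_order tau m) k) (S m) (root_angle_range _ _ L)) as [D0 D1].
    rewrite Rabs_pos_eq by exact D0. eapply Rle_trans; [exact D1|].
    eapply Rle_trans; [|apply exp_neg_pow_le; lra]. apply exp_le, Ropp_le_contravar.
    rewrite root_angle_sqr_scale. pose proof (order_scale_pos tau m) as Qp.
    set (q := order_scale tau m) in *.
    assert (Hqq : q * q <= 16 / tau).
    { replace (16 / tau) with (4 / sqrt tau * (4 / sqrt tau)).
      - apply Rmult_le_compat; lra.
      - replace (4 / sqrt tau * (4 / sqrt tau)) with (16 / (sqrt tau * sqrt tau)) by (field; lra).
        rewrite sqrt_sqrt by lra. reflexivity. }
    assert (Hi : tau / 16 <= / (q * q)).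
    { replace (tau / 16) with (/ (16 / tau)) by (field; lra). apply Rinv_le_contravar; nra. }
    assert (4 <= PI * PI) by (pose proof PI2_1; nra).
    pose proof (pow2_ge_0 (INR k)).
    unfold Rdiv at 2 3. replace (PI * PI * INR k ^ 2 * / (q * q) * / 4) with (PI * PI / 4 * / (q * q) * INR k ^ 2) by (field; lra).
    apply Rmult_le_compat_r; [lra|]. nra.
  - rewrite Rabs_R0. apply pow_le. left. apply exp_pos.
Qed.

Lemma INR_order_sqr (tau : R) (m : nat) :
  INR (oddl (half_order tau m)) ^ 2 = order_scale tau m ^ 2 * INR (S m).
Proof.
  unfold order_scale. pose proof (sqrt_INR_S_pos m).
  replace (INR (S m)) with (sqrt (INR (S m)) * sqrt (INR (S m))) at 2 by (apply sqrt_sqrt, pos_INR).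
  field. lra.
Qed.

Lemma is_lim_seq_bin_term (tau : R) (j : nat) : 0 < tau ->
  is_lim_seq (fun m => bin_term tau m j) (exp (- (PI * INR j ^ 2 * / (PI * tau / 4)))).
Proof.
  intros Ht. pose proof (is_lim_seq_order_scale tau Ht) as Hq. pose proof is_lim_seq_inv_sqrt as Hs.
  pose proof (sqrt_lt_R0 _ Ht) as Hst. pose proof PI_RGT_0 as Hpi.
  set (nu := fun m => (oddl (half_order tau m) * j)%nat).
  set (r := fun m => order_scale tau m * INR j * / sqrt (INR (S m))).
  assert (Hr : is_lim_seq r 0).
  { replace (Finite 0) with (Finite (2 / sqrt tau * INR j * 0)) by (f_equal; ring).
    apply is_lim_seq_mult'; [|exact Hs]. apply is_lim_seq_mult'; [exact Hq|apply is_lim_seq_const]. }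
  assert (Er : forall m, INR (nu m) = r m * INR (S m)).
  { intros m. unfold nu, r, order_scale. rewrite mult_INR. pose proof (sqrt_INR_S_pos m).
    replace (INR (S m)) with (sqrt (INR (S m)) * sqrt (INR (S m))) at 3 by (apply sqrt_sqrt, pos_INR). field. lra. }
  set (y := fun m => order_scale tau m ^ 2 * INR j ^ 2).
  assert (Ey : forall m, INR (nu m) ^ 2 = y m * INR (S m)).
  { intros m. unfold nu, y. rewrite mult_INR, Rpow_mult_distr, INR_order_sqr. ring. }
  set (L := PI * INR j ^ 2 * / (PI * tau / 4)).
  assert (Hy : is_lim_seq y L).
  { unfold y, L. replace (PI * INR j ^ 2 * / (PI * tau / 4)) with ((2 / sqrt tau * (2 / sqrt tau)) * INR j ^ 2).
    2:{ replace (2 / sqrt tau * (2 / sqrt tau)) with (4 / (sqrt tau * sqrt tau)) by (field; lra).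
        rewrite sqrt_sqrt by lra. field. lra. }
    apply is_lim_seq_mult'; [|apply is_lim_seq_const].
    apply is_lim_seq_ext with (fun m => order_scale tau m * order_scale tau m); [intros; ring|].
    now apply is_lim_seq_mult'. }
  assert (Hm : forall m, 0 < INR (S m)) by (intros; apply lt_0_INR; lia).
  apply (is_lim_seq_le_le_loc (fun m => exp (- (y m / (1 - r m)))) _ (fun m => exp (- (y m / (1 + r m))))).
  - destruct (eventually_lt_lim _ _ 1 Hr Rlt_0_1) as [N HN]. exists N. intros m Hn. specialize (HN m Hn).
    assert (Hnu : (nu m < S m)%nat) by (apply INR_lt; rewrite Er; specialize (Hm m); nra).
    destruct (bratio_bounds (S m) (nu m) (nu m) ltac:(lia)) as [[_ U] Lo]. specialize (Lo Hnu).
    specialize (Hm m). assert (Hrp : 0 <= r m).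
    { apply Rmult_le_reg_r with (INR (S m)); [lra|]. rewrite <- Er, Rmult_0_l. apply pos_INR. }
    rewrite Ey, Er in U, Lo.
    replace (y m * INR (S m) / (INR (S m) + r m * INR (S m))) with (y m / (1 + r m)) in U by (field; split; nra).
    replace (y m * INR (S m) / (INR (S m) - r m * INR (S m))) with (y m / (1 - r m)) in Lo by (field; split; nra).
    split; assumption.
  - apply is_lim_seq_exp, is_lim_seq_opp_R. replace (Finite L) with (Finite (L / (1 - 0))) by (f_equal; field).
    apply is_lim_seq_div'; [exact Hy| |lra]. apply is_lim_seq_minus'; [apply is_lim_seq_const|exact Hr].
  - apply is_lim_seq_exp, is_lim_seq_opp_R. replace (Finite L) with (Finite (L / (1 + 0))) by (f_equal; field).
    apply is_lim_seq_div'; [exact Hy| |lra]. apply is_lim_seq_plus'; [apply is_lim_seq_const|exact Hr].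
Qed.

Lemma bin_term_dominated (tau : R) : 0 < tau ->
  eventually (fun m => forall j, Rabs (bin_term tau m j) <= exp (- (/ (2 * tau))) ^ j).
Proof.
  intros Ht. pose proof (is_lim_seq_order_scale tau Ht) as Hq. pose proof (sqrt_lt_R0 _ Ht) as Hst.
  (* Half the limit of the scale [q]. With [K = S m] the exponent is
     [q^2 j^2 / 2 >= j^2 / (2 tau)]. *)
  destruct (eventually_gt_lim _ _ (1 / sqrt tau) Hq) as [N HN].
  { unfold Rdiv. apply Rmult_lt_compat_r; [now apply Rinv_0_lt_compat|lra]. }
  exists N. intros m Hm j. specialize (HN m Hm). unfold bin_term.
  assert (Hp : 0 <= exp (- / (2 * tau)) ^ j) by (apply pow_le; left; apply exp_pos).
  destruct (Nat.lt_ge_cases (S m) (oddl (half_order tau m) * j)) as [L|L].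
  - rewrite bratio_out, Rabs_R0 by exact L. exact Hp.
  - destruct (bratio_bounds (S m) (S m) _ (conj L (le_n _))) as [[P U] _].
    rewrite Rabs_pos_eq by exact P. eapply Rle_trans; [exact U|].
    assert (0 < / (2 * tau)) by (apply Rinv_0_lt_compat; lra).
    eapply Rle_trans; [|apply exp_neg_pow_le; lra]. apply exp_le, Ropp_le_contravar.
    rewrite mult_INR, Rpow_mult_distr, INR_order_sqr.
    assert (0 < INR (S m)) by (apply lt_0_INR; lia).
    set (q := order_scale tau m) in *.
    replace (q ^ 2 * INR (S m) * INR j ^ 2 / (INR (S m) + INR (S m))) with (q ^ 2 / 2 * INR j ^ 2) by (field; lra).
    apply Rmult_le_compat_r; [apply pow2_ge_0|].
    replace (/ (2 * tau)) with (1 / sqrt tau * (1 / sqrt tau) / 2).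
    + assert (0 < 1 / sqrt tau) by (apply Rdiv_lt_0_compat; lra). nra.
    + replace (1 / sqrt tau * (1 / sqrt tau)) with (1 / (sqrt tau * sqrt tau)) by (field; lra).
      rewrite sqrt_sqrt by lra. field. lra.
Qed.

(** The central binomial factor does not involve [tau]; this is what allows two values of [tau] to
    be compared in [theta_functional_equation]. *)
Lemma polya_series (tau : R) (m : nat) :
  2 * Series (cos_term tau m) - 1 =
  order_scale tau m * (sqrt (INR (S m)) * (bwalk (S m) 0 / 4 ^ S m)) * (2 * Series (bin_term tau m) - 1).
Proof.
  set (p := half_order tau m).
  rewrite (Series_finite (cos_term tau m) p).
  2:{ intros k Hk. unfold cos_term. fold p. now rewrite (proj2 (Nat.leb_gt _ _) Hk). }
  rewrite (Series_finite (bin_term tau m) (S m)).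
  2:{ intros k Hk. unfold bin_term. apply bratio_out. unfold oddl. nia. }
  rewrite (sum_n_ext_loc _ (fun k => cos (root_angle p k) ^ (2 * S m))).
  2:{ intros k Hk. unfold cos_term. fold p. now rewrite (proj2 (Nat.leb_le _ _) Hk). }
  rewrite (polya_identity (S m) p (S m)) by (unfold oddl; nia).
  unfold order_scale. fold p. pose proof (sqrt_INR_S_pos m).
  replace (INR (oddl p) * / sqrt (INR (S m)) * (sqrt (INR (S m)) * (bwalk (S m) 0 / 4 ^ S m))) with
    (INR (oddl p) * (bwalk (S m) 0 / 4 ^ S m)).
  - reflexivity.
  - field. split; [apply pow_nonzero|]; lra.
Qed.

Lemma ex_series_theta (y : R) : 0 < y -> ex_series (fun k => exp (- (PI * INR k ^ 2 * y))).
Proof.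
  intros Hy. pose proof PI_RGT_0. assert (Hpy : 0 < PI * y) by nra.
  apply ex_series_dominated with (2 := ex_series_exp_pow (PI * y) Hpy).
  intros k. rewrite Rabs_pos_eq by (left; apply exp_pos).
  replace (PI * INR k ^ 2 * y) with (PI * y * INR k ^ 2) by ring. apply exp_neg_pow_le. lra.
Qed.

Lemma theta_half_ge_1 (y : R) : 0 < y -> 1 <= theta_half y.
Proof.
  intros Hy. unfold theta_half. rewrite (Series_tail _ 0 (ex_series_theta y Hy)), sum_n_0.
  simpl (INR 0). replace (PI * 0 ^ 2 * y) with 0 by ring. rewrite Ropp_0, exp_0.
  assert (0 <= Series (fun k => exp (- (PI * INR (1 + k) ^ 2 * y)))); [|lra].
  replace 0 with (Series (fun k => 0 * exp (- (PI * INR (1 + k) ^ 2 * y)))).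
  - apply Series_le.
    + intros k. pose proof (exp_pos (- (PI * INR (1 + k) ^ 2 * y))). lra.
    + apply (ex_series_shift _ 1 (ex_series_theta y Hy)).
  - rewrite Series_scal_l. ring.
Qed.

Lemma is_lim_seq_central_binomial (tau : R) : 0 < tau ->
  is_lim_seq (fun m => order_scale tau m * (sqrt (INR (S m)) * (bwalk (S m) 0 / 4 ^ S m)))
    ((2 * theta_half (PI * tau / 4) - 1) / (2 * theta_half (/ (PI * tau / 4)) - 1)).
Proof.
  intros Ht. pose proof PI_RGT_0 as Hpi.
  assert (Hy : 0 < PI * tau / 4) by nra.
  assert (Hy' : 0 < / (PI * tau / 4)) by now apply Rinv_0_lt_compat.
  assert (LC : is_lim_seq (fun m => Series (cos_term tau m)) (theta_half (PI * tau / 4))).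
  { apply tannery with (fun k => exp (- (tau / 16)) ^ k).
    - intros k. now apply is_lim_seq_cos_term.
    - now apply cos_term_dominated.
    - apply ex_series_exp_pow. lra. }
  assert (LB : is_lim_seq (fun m => Series (bin_term tau m)) (theta_half (/ (PI * tau / 4)))).
  { apply tannery with (fun k => exp (- (/ (2 * tau))) ^ k).
    - intros k. now apply is_lim_seq_bin_term.
    - now apply bin_term_dominated.
    - apply ex_series_exp_pow. apply Rinv_0_lt_compat. lra. }
  pose proof (theta_half_ge_1 _ Hy') as T1.
  apply is_lim_seq_ext_loc with
    (fun m => (2 * Series (cos_term tau m) - 1) / (2 * Series (bin_term tau m) - 1)).
  - destruct (eventually_gt_lim _ _ (1 / 2) LB ltac:(lra)) as [N HN]. exists N. intros m Hm.
    specialize (HN m Hm). rewrite polya_series. unfold Rdiv at 1. rewrite Rmult_assoc, Rinv_r by lra. apply Rmult_1_r.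
  - apply is_lim_seq_div'; [| |lra]; (apply is_lim_seq_minus'; [|apply is_lim_seq_const]).
    + exact (is_lim_seq_scal_l _ 2 _ LC).
    + exact (is_lim_seq_scal_l _ 2 _ LB).
Qed.

(** The quotient of the theta values at [y] and [1/y] is the limit of [order_scale * b], and only
    the scale depends on [y]. At [y = 1] the quotient is 1, which forces [b] to tend to
    [1 / sqrt PI]; inserting this at [y = x] gives the equation. *)
Theorem theta_functional_equation (x : R) : 0 < x ->
  2 * theta_half (/ x) - 1 = sqrt x * (2 * theta_half x - 1).
Proof.
  intros Hx. pose proof PI_RGT_0 as Hpi.
  set (b := fun m => sqrt (INR (S m)) * (bwalk (S m) 0 / 4 ^ S m)).
  (* The parameter [tau = 4 y / PI] makes the theta argument [PI * tau / 4] equal to [y]. *)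
  assert (T : forall y, 0 < y -> is_lim_seq (fun m => order_scale (4 * y / PI) m * b m)
     ((2 * theta_half y - 1) / (2 * theta_half (/ y) - 1))).
  { intros y Hy. assert (H4 : 0 < 4 * y / PI) by (apply Rdiv_lt_0_compat; lra).
    pose proof (is_lim_seq_central_binomial _ H4) as K.
    replace (PI * (4 * y / PI) / 4) with y in K by (field; lra). exact K. }
  assert (S0 : forall y, 0 < y -> 2 / sqrt (4 * y / PI) = sqrt PI / sqrt y).
  { intros y Hy. unfold Rdiv. rewrite sqrt_mult, sqrt_mult, sqrt_inv by (try lra; try (left; apply Rinv_0_lt_compat; lra)).
    replace 4 with (2 * 2) by ring. rewrite sqrt_square by lra.
    pose proof (sqrt_lt_R0 y Hy). pose proof (sqrt_lt_R0 PI Hpi). field. lra. }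
  assert (Hx' : 0 < / x) by now apply Rinv_0_lt_compat.
  pose proof (theta_half_ge_1 x Hx) as G1. pose proof (theta_half_ge_1 (/ x) Hx') as G2.
  pose proof (theta_half_ge_1 1 Rlt_0_1) as G3.
  assert (Hb : is_lim_seq b (/ sqrt PI)).
  { apply is_lim_seq_ext with (fun m => order_scale (4 * 1 / PI) m * b m / order_scale (4 * 1 / PI) m).
    - intros m. field. pose proof (order_scale_pos (4 * 1 / PI) m). lra.
    - assert (H4 : 0 < 4 * 1 / PI) by (apply Rdiv_lt_0_compat; lra).
      replace (/ sqrt PI) with ((2 * theta_half 1 - 1) / (2 * theta_half (/ 1) - 1) / (2 / sqrt (4 * 1 / PI))).
      + apply is_lim_seq_div'; [apply T; lra|now apply is_lim_seq_order_scale|].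
        assert (0 < 2 / sqrt (4 * 1 / PI)) by (apply Rdiv_lt_0_compat; [lra|now apply sqrt_lt_R0]). lra.
      + rewrite S0, Rinv_1, sqrt_1 by lra. pose proof (sqrt_lt_R0 PI Hpi). field. lra. }
  assert (Hl : is_lim_seq (fun m => order_scale (4 * x / PI) m * b m) (2 / sqrt (4 * x / PI) * / sqrt PI)).
  { apply is_lim_seq_mult'; [|exact Hb]. apply is_lim_seq_order_scale. apply Rdiv_lt_0_compat; lra. }
  apply is_lim_seq_unique in Hl. specialize (T x Hx). apply is_lim_seq_unique in T. rewrite T in Hl.
  injection Hl as E. rewrite S0 in E by exact Hx.
  pose proof (sqrt_lt_R0 PI Hpi). pose proof (sqrt_lt_R0 x Hx).
  replace (sqrt PI / sqrt x * / sqrt PI) with (/ sqrt x) in E by (field; lra).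
  apply Rmult_eq_reg_r with (/ sqrt x * / (2 * theta_half (/ x) - 1)).
  2:{ apply Rgt_not_eq. apply Rmult_lt_0_compat; apply Rinv_0_lt_compat; lra. }
  transitivity (/ sqrt x); [field; lra|].
  transitivity ((2 * theta_half x - 1) / (2 * theta_half (/ x) - 1)); [symmetry; exact E|field; lra].
Qed.

(** * Integrals of complex-valued functions *)

Definition CInt (f : R -> C) (a b : R) : C :=
  (RInt (fun t => Re (f t)) a b, RInt (fun t => Im (f t)) a b).

Definition Ccontinuous (f : R -> C) : Prop :=
  forall t, continuous (fun t => Re (f t)) t /\ continuous (fun t => Im (f t)) t.

Definition Clim (u : nat -> C) (l : C) : Prop :=
  is_lim_seq (fun n => Re (u n)) (Re l) /\ is_lim_seq (fun n => Im (u n)) (Im l).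

Lemma continuous_Rmult (f g : R -> R) (x : R) :
  continuous f x -> continuous g x -> continuous (fun t => f t * g t) x.
Proof. exact (@continuous_mult R_UniformSpace R_AbsRing f g x). Qed.

Lemma continuous_Rplus (f g : R -> R) (x : R) :
  continuous f x -> continuous g x -> continuous (fun t => f t + g t) x.
Proof. exact (@continuous_plus R_UniformSpace R_AbsRing R_NormedModule f g x). Qed.

Lemma continuous_Rminus (f g : R -> R) (x : R) :
  continuous f x -> continuous g x -> continuous (fun t => f t - g t) x.
Proof. exact (@continuous_minus R_UniformSpace R_AbsRing R_NormedModule f g x). Qed.

Lemma Ccontinuous_plus (f g : R -> C) : Ccontinuous f -> Ccontinuous g -> Ccontinuous (fun t => f t + g t)%C.
Proof.
  intros Hf Hg t. destruct (Hf t), (Hg t). split; simpl;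
  [apply (continuous_Rplus (fun t => Re (f t)) (fun t => Re (g t)))|apply (continuous_Rplus (fun t => Im (f t)) (fun t => Im (g t)))]; assumption.
Qed.

Lemma Ccontinuous_mult (f g : R -> C) : Ccontinuous f -> Ccontinuous g -> Ccontinuous (fun t => f t * g t)%C.
Proof.
  intros Hf Hg t. destruct (Hf t), (Hg t). split; simpl.
  - apply (continuous_Rminus (fun t => Re (f t) * Re (g t)) (fun t => Im (f t) * Im (g t)));
      apply continuous_Rmult; assumption.
  - apply (continuous_Rplus (fun t => Re (f t) * Im (g t)) (fun t => Im (f t) * Re (g t)));
      apply continuous_Rmult; assumption.
Qed.

Lemma Ccontinuous_RtoC (f : R -> R) : (forall t, continuous f t) -> Ccontinuous (fun t => RtoC (f t)).
Proof. intros H t. split; simpl; [apply H|apply continuous_const]. Qed.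

Lemma Ccontinuous_const (c : C) : Ccontinuous (fun _ => c).
Proof. intros t. split; apply continuous_const. Qed.

Lemma Ccontinuous_ex_RInt (f : R -> C) (a b : R) : Ccontinuous f ->
  ex_RInt (fun t => Re (f t)) a b /\ ex_RInt (fun t => Im (f t)) a b.
Proof. intros H. split; apply ex_RInt_continuous_R; intros; apply H. Qed.

Lemma CInt_ext (f g : R -> C) (a b : R) : (forall t, f t = g t) -> CInt f a b = CInt g a b.
Proof. intros H. unfold CInt. f_equal; apply RInt_ext; intros; now rewrite H. Qed.

Lemma CInt_plus (f g : R -> C) (a b : R) : Ccontinuous f -> Ccontinuous g ->
  CInt (fun t => f t + g t)%C a b = (CInt f a b + CInt g a b)%C.
Proof.
  intros Hf Hg. destruct (Ccontinuous_ex_RInt f a b Hf), (Ccontinuous_ex_RInt g a b Hg).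
  unfold CInt, Cplus. simpl. f_equal.
  - now apply (RInt_plus (V := R_CompleteNormedModule) (fun t => Re (f t)) (fun t => Re (g t))).
  - now apply (RInt_plus (V := R_CompleteNormedModule) (fun t => Im (f t)) (fun t => Im (g t))).
Qed.

Lemma CInt_scal (c : C) (f : R -> C) (a b : R) : Ccontinuous f ->
  CInt (fun t => c * f t)%C a b = (c * CInt f a b)%C.
Proof.
  intros Hf. destruct (Ccontinuous_ex_RInt f a b Hf) as [H1 H2].
  destruct c as [p q]. unfold CInt, Cmult. simpl.
  assert (S : forall (r : R) g, ex_RInt g a b -> ex_RInt (fun t => r * g t) a b /\
     RInt (fun t => r * g t) a b = r * RInt g a b).
  { intros r g Hg. split; [exact (ex_RInt_scal (V := R_NormedModule) g a b r Hg)|].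
    exact (RInt_scal (V := R_CompleteNormedModule) g a b r Hg). }
  f_equal.
  - destruct (S p _ H1) as [E1 R1], (S q _ H2) as [E2 R2].
    rewrite <- R1, <- R2. exact (RInt_minus (V := R_CompleteNormedModule) _ _ a b E1 E2).
  - destruct (S p _ H2) as [E1 R1], (S q _ H1) as [E2 R2].
    rewrite <- R1, <- R2. exact (RInt_plus (V := R_CompleteNormedModule) _ _ a b E1 E2).
Qed.

Lemma CInt_Chasles (f : R -> C) (a b c : R) : Ccontinuous f ->
  CInt f a c = (CInt f a b + CInt f b c)%C.
Proof.
  intros Hf. destruct (Ccontinuous_ex_RInt f a b Hf) as [A1 A2], (Ccontinuous_ex_RInt f b c Hf) as [B1 B2].
  apply injective_projections; symmetry.
  - exact (RInt_Chasles (V := R_CompleteNormedModule) (fun t => Re (f t)) a b c A1 B1).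
  - exact (RInt_Chasles (V := R_CompleteNormedModule) (fun t => Im (f t)) a b c A2 B2).
Qed.

Lemma CInt_opp_var (f : R -> C) (T : R) : Ccontinuous f ->
  CInt (fun t => f (- t)) 0 T = CInt f (- T) 0.
Proof.
  intros Hf. assert (S : forall g : R -> R, (forall t, continuous g t) ->
    RInt (fun t => g (- t)) 0 T = RInt g (- T) 0).
  { intros g Hg. apply is_RInt_unique.
    assert (E : ex_RInt g (- T) 0) by now apply ex_RInt_continuous_R.
    apply (RInt_correct (V := R_CompleteNormedModule)) in E.
    apply (is_RInt_swap (V := R_NormedModule)) in E.
    rewrite <- Ropp_0 in E at 1.
    apply (is_RInt_comp_opp (V := R_NormedModule)) in E. apply (is_RInt_opp (V := R_NormedModule)) in E.
    rewrite opp_opp in E.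
    apply (is_RInt_ext (V := R_NormedModule)) with (2 := E). intros x _. apply opp_opp. }
  unfold CInt. f_equal.
  - apply (S (fun t => Re (f t))). intros; apply Hf.
  - apply (S (fun t => Im (f t))). intros; apply Hf.
Qed.

(** Bounding the two coordinates separately costs the factor 2, harmless since only rates of decay
    matter. The same holds for [Clim_bound]. *)
Lemma CInt_bound (f : R -> C) (g : R -> R) (a b : R) : a <= b -> Ccontinuous f ->
  (forall t, continuous g t) -> (forall t, a <= t <= b -> Cmod (f t) <= g t) ->
  Cmod (CInt f a b) <= 2 * RInt g a b.
Proof.
  intros Hab Hf Hg H. destruct (Ccontinuous_ex_RInt f a b Hf) as [H1 H2].
  assert (Eg : ex_RInt g a b) by now apply ex_RInt_continuous_R.
  eapply Rle_trans; [apply Cmod_le_Re_Im|]. unfold CInt. simpl.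
  assert (B : forall k : R -> R, ex_RInt k a b -> (forall t, a <= t <= b -> Rabs (k t) <= g t) ->
     Rabs (RInt k a b) <= RInt g a b).
  { intros k Hk Hkg.
    exact (norm_RInt_le (V := R_NormedModule) k g a b _ _ Hab Hkg
       (RInt_correct (V := R_CompleteNormedModule) k a b Hk) (RInt_correct (V := R_CompleteNormedModule) g a b Eg)). }
  pose proof (B _ H1 (fun t Ht => Rle_trans _ _ _ (re_le_Cmod (f t)) (H t Ht))).
  pose proof (B _ H2 (fun t Ht => Rle_trans _ _ _ (Im_le_Cmod (f t)) (H t Ht))). lra.
Qed.

Lemma RInt_derive_R (F f : R -> R) (a b : R) : (forall t, is_derive F t (f t)) ->
  (forall t, continuous f t) -> RInt f a b = F b - F a.
Proof.
  intros HF Hf. apply is_RInt_unique.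
  apply (is_RInt_derive (V := R_CompleteNormedModule) F f); intros; auto.
Qed.

Lemma RInt_exp_neg (K a b : R) : RInt (fun t => K * exp (- t)) a b = K * exp (- a) - K * exp (- b).
Proof.
  rewrite (RInt_derive_R (fun t => - (K * exp (- t)))).
  - Rring.
  - intros t. auto_derive; [trivial|ring].
  - intros t. apply (ex_derive_continuous (V := R_NormedModule)). auto_derive. trivial.
Qed.

Lemma CInt_bound_exp_neg (f : R -> C) (K a b : R) : 0 <= K -> a <= b -> Ccontinuous f ->
  (forall t, a <= t <= b -> Cmod (f t) <= K * exp (- t)) ->
  Cmod (CInt f a b) <= 2 * K * exp (- a).
Proof.
  intros HK Hab Hf H. eapply Rle_trans; [apply (CInt_bound f (fun t => K * exp (- t))); auto|].
  - intros t. apply (ex_derive_continuous (V := R_NormedModule)). auto_derive. trivial.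
  - rewrite RInt_exp_neg. pose proof (exp_pos (- b)). nra.
Qed.

Lemma Im_minus (z w : C) : Im (z - w)%C = Im z - Im w.
Proof. destruct z, w. reflexivity. Qed.

Lemma Clim_plus (u v : nat -> C) (a b : C) : Clim u a -> Clim v b -> Clim (fun n => u n + v n)%C (a + b)%C.
Proof. intros [H1 H2] [H3 H4]. split; simpl; now apply is_lim_seq_plus'. Qed.

Lemma Clim_const (c : C) : Clim (fun _ => c) c.
Proof. split; apply is_lim_seq_const. Qed.

Lemma Clim_mult (u v : nat -> C) (a b : C) : Clim u a -> Clim v b -> Clim (fun n => u n * v n)%C (a * b)%C.
Proof.
  intros [H1 H2] [H3 H4]. split; simpl.
  - apply (is_lim_seq_minus' (fun n => Re (u n) * Re (v n))); now apply is_lim_seq_mult'.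
  - apply (is_lim_seq_plus' (fun n => Re (u n) * Im (v n))); now apply is_lim_seq_mult'.
Qed.

Lemma Clim_ext (u v : nat -> C) (l : C) : (forall n, u n = v n) -> Clim u l -> Clim v l.
Proof.
  intros E [H1 H2]. split; (eapply is_lim_seq_ext; [|eassumption]); intros; simpl; now rewrite E.
Qed.

Lemma Clim_unique (u : nat -> C) (a b : C) : Clim u a -> Clim u b -> a = b.
Proof.
  intros [H1 H2] [H3 H4]. apply is_lim_seq_unique in H1, H2, H3, H4.
  rewrite H1 in H3. rewrite H2 in H4. injection H3. injection H4.
  intros. now apply injective_projections.
Qed.

Lemma Clim_bound (u : nat -> C) (l : C) (B : R) : (forall n, Cmod (u n) <= B) -> Clim u l -> Cmod l <= 2 * B.
Proof.
  intros H [H1 H2]. eapply Rle_trans; [apply Cmod_le_Re_Im|].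
  assert (Rabs (Re l) <= B).
  { apply (is_lim_seq_le (fun n => Rabs (Re (u n))) (fun _ => B) (Rabs (Re l)) B).
    - intros n. eapply Rle_trans; [apply re_le_Cmod|apply H].
    - exact (is_lim_seq_abs _ _ H1).
    - apply is_lim_seq_const. }
  assert (Rabs (Im l) <= B); [|lra].
  apply (is_lim_seq_le (fun n => Rabs (Im (u n))) (fun _ => B) (Rabs (Im l)) B).
  - intros n. eapply Rle_trans; [apply Im_le_Cmod|apply H].
  - exact (is_lim_seq_abs _ _ H2).
  - apply is_lim_seq_const.
Qed.

Lemma Clim_squeeze (u : nat -> C) (l : C) (e : nat -> R) :
  (forall n, Cmod (u n - l)%C <= e n) -> is_lim_seq e 0 -> Clim u l.
Proof.
  intros H He.
  assert (S : forall (v : nat -> R) (a : R), (forall n, Rabs (v n - a) <= e n) -> is_lim_seq v a).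
  { intros v a Hv. apply (is_lim_seq_le_le (fun n => a - e n) v (fun n => a + e n)).
    - intros n. specialize (Hv n). apply Rabs_le_between in Hv. lra.
    - replace (Finite a) with (Finite (a - 0)) by (f_equal; ring). apply is_lim_seq_minus'; [apply is_lim_seq_const|exact He].
    - replace (Finite a) with (Finite (a + 0)) by (f_equal; ring). apply is_lim_seq_plus'; [apply is_lim_seq_const|exact He]. }
  split; apply S; intros n; (eapply Rle_trans; [|apply (H n)]).
  - rewrite <- Re_minus. apply re_le_Cmod.
  - rewrite <- Im_minus. apply Im_le_Cmod.
Qed.

Lemma is_lim_seq_exp_neg : is_lim_seq (fun n => exp (- INR n)) 0.
Proof.
  apply is_lim_seq_ext with (fun n => exp (- (1)) ^ n).
  - intros n. rewrite exp_pow. f_equal. ring.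
  - apply is_lim_seq_geom. rewrite Rabs_pos_eq by (left; apply exp_pos).
    assert (L : exp (- (1)) < exp 0) by (apply exp_increasing; lra). rewrite exp_0 in L. exact L.
Qed.

Lemma Clim_cauchy_exp (u : nat -> C) (K : R) :
  (forall n m, (n <= m)%nat -> Cmod (u m - u n)%C <= K * exp (- INR n)) -> exists l, Clim u l.
Proof.
  intros H.
  assert (S : forall v : nat -> R, (forall n m, (n <= m)%nat -> Rabs (v m - v n) <= K * exp (- INR n)) ->
    ex_finite_lim_seq v).
  { intros v Hv. apply ex_lim_seq_cauchy_corr. intros eps.
    assert (L : is_lim_seq (fun n => K * exp (- INR n)) 0).
    { replace (Finite 0) with (Finite (K * 0)) by (f_equal; ring).
      exact (is_lim_seq_scal_l _ K _ is_lim_seq_exp_neg). }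
    destruct (eventually_lt_lim _ _ (eps / 2) L) as [N HN]; [pose proof (cond_pos eps); lra|].
    exists N. intros n m Hn Hm. specialize (HN N (le_n N)).
    pose proof (Hv N n Hn) as A. pose proof (Hv N m Hm) as B.
    replace (v n - v m) with ((v n - v N) - (v m - v N)) by ring.
    eapply Rle_lt_trans; [apply Rabs_triang|]. rewrite Rabs_Ropp. lra. }
  destruct (S (fun n => Re (u n))) as [a Ha].
  { intros n m Hnm. eapply Rle_trans; [|apply (H n m Hnm)]. rewrite <- Re_minus. apply re_le_Cmod. }
  destruct (S (fun n => Im (u n))) as [b Hb].
  { intros n m Hnm. eapply Rle_trans; [|apply (H n m Hnm)]. rewrite <- Im_minus. apply Im_le_Cmod. }
  exists (a, b). split; assumption.
Qed.

(** * Laplace transforms of rapidly decaying weights *)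

Definition laplace_integrand (w : R -> R) (s : C) (u : R) : C := (w u * Cexp (s * u))%C.

Lemma Cmod_laplace_integrand (w : R -> R) (s : C) (u : R) :
  Cmod (laplace_integrand w s u) = Rabs (w u) * exp (Re s * u).
Proof.
  unfold laplace_integrand. rewrite Cmod_mult, Cmod_R, Cmod_Cexp. do 2 f_equal.
  destruct s. simpl. ring.
Qed.

Lemma Ccontinuous_Cexp_line (s : C) : Ccontinuous (fun u => Cexp (s * u)).
Proof.
  intros t. destruct s as [p q].
  split; simpl; apply (ex_derive_continuous (V := R_NormedModule)); auto_derive; trivial.
Qed.

Lemma Ccontinuous_laplace (w : R -> R) (s : C) : (forall u, continuous w u) ->
  Ccontinuous (laplace_integrand w s).
Proof.
  intros Hw. apply (Ccontinuous_mult (fun u => RtoC (w u)) (fun u => Cexp (s * u))).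
  - now apply Ccontinuous_RtoC.
  - apply Ccontinuous_Cexp_line.
Qed.

(** Made total by [Lim_seq], along integer end points; [laplace_Clim] shows that it is a genuine
    limit for decaying weights. *)
Definition laplace (w : R -> R) (s : C) : C :=
  (real (Lim_seq (fun n => Re (CInt (laplace_integrand w s) 0 (INR n)))),
   real (Lim_seq (fun n => Im (CInt (laplace_integrand w s) 0 (INR n))))).

Lemma laplace_Clim (w : R -> R) (s : C) (K : R) : 0 <= K -> (forall u, continuous w u) ->
  (forall u, 0 <= u -> Rabs (w u) * exp (Re s * u) <= K * exp (- u)) ->
  Clim (fun n => CInt (laplace_integrand w s) 0 (INR n)) (laplace w s) /\
  forall n, Cmod (CInt (laplace_integrand w s) 0 (INR n)) <= 2 * K.
Proof.
  intros HK Hw H. pose proof (Ccontinuous_laplace w s Hw) as Hc. split.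
  - destruct (Clim_cauchy_exp (fun n => CInt (laplace_integrand w s) 0 (INR n)) (2 * K)) as [l Hl].
    + intros n m Hnm. apply le_INR in Hnm. pose proof (pos_INR n).
      rewrite (CInt_Chasles _ 0 (INR n) (INR m) Hc).
      replace (_ + _ - _)%C with (CInt (laplace_integrand w s) (INR n) (INR m)) by ring.
      apply CInt_bound_exp_neg; auto. intros t Ht. rewrite Cmod_laplace_integrand. apply H. lra.
    + destruct Hl as [H1 H2]. unfold laplace.
      rewrite (is_lim_seq_unique _ _ H1), (is_lim_seq_unique _ _ H2). split; assumption.
  - intros n. replace (2 * K) with (2 * K * exp (- 0)) by (rewrite Ropp_0, exp_0; ring).
    apply CInt_bound_exp_neg; auto; [apply pos_INR|].
    intros t Ht. rewrite Cmod_laplace_integrand. apply H. lra.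
Qed.

Definition superexp_decay (w : R -> R) : Prop :=
  forall b : nat, exists K, 0 <= K /\ forall u, 0 <= u -> Rabs (w u) <= K * exp (- (INR b * u)).

(** The factor [(1 + u)^2] dominates 1, [u] and [u^2] at once, the weights in the transform, in its
    derivative and in the second-order remainder. *)
Lemma superexp_decay_poly (w : R -> R) (sigma : R) : superexp_decay w ->
  exists K, 0 <= K /\ forall u, 0 <= u ->
    (1 + u) * (1 + u) * (Rabs (w u) * exp (sigma * u)) <= K * exp (- u).
Proof.
  intros H. destruct (INR_unbounded (sigma + 3)) as [b Hb]. destruct (H b) as [K [HK Hw]].
  exists K. split; [exact HK|]. intros u Hu. specialize (Hw u Hu).
  pose proof (exp_ineq1_le u) as E1.
  apply Rle_trans with (exp u * exp u * (K * exp (- (INR b * u)) * exp (sigma * u))).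
  - pose proof (exp_pos (sigma * u)). apply Rmult_le_compat.
    + nra.
    + apply Rmult_le_pos; [apply Rabs_pos|lra].
    + apply Rmult_le_compat; lra.
    + apply Rmult_le_compat_r; lra.
  - replace (exp u * exp u * (K * exp (- (INR b * u)) * exp (sigma * u))) with
      (K * exp (u + u + (- (INR b * u) + sigma * u))) by (rewrite !exp_plus; ring).
    apply Rmult_le_compat_l; [exact HK|]. apply exp_le. nra.
Qed.

Lemma Ccontinuous_scal (c : C) (f : R -> C) : Ccontinuous f -> Ccontinuous (fun t => c * f t)%C.
Proof. intros H. apply (Ccontinuous_mult (fun _ => c) f); [apply Ccontinuous_const|exact H]. Qed.

Lemma Ccontinuous_linear (f g k : R -> C) (a b : C) : Ccontinuous f -> Ccontinuous g -> Ccontinuous k ->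
  Ccontinuous (fun t => f t + a * g t + b * k t)%C.
Proof.
  intros Hf Hg Hk. apply (Ccontinuous_plus (fun t => f t + a * g t)%C (fun t => b * k t)%C).
  - apply (Ccontinuous_plus f (fun t => a * g t)%C); [exact Hf|now apply Ccontinuous_scal].
  - now apply Ccontinuous_scal.
Qed.

Lemma CInt_linear (f g k : R -> C) (a b : C) (x y : R) : Ccontinuous f -> Ccontinuous g -> Ccontinuous k ->
  CInt (fun t => f t + a * g t + b * k t)%C x y = (CInt f x y + a * CInt g x y + b * CInt k x y)%C.
Proof.
  intros Hf Hg Hk. pose proof (Ccontinuous_scal a g Hg) as Ha. pose proof (Ccontinuous_scal b k Hk) as Hb.
  rewrite (CInt_plus (fun t => f t + a * g t)%C (fun t => b * k t)%C) by
    (try exact Hb; apply (Ccontinuous_plus f (fun t => a * g t)%C); assumption).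
  rewrite (CInt_plus f (fun t => a * g t)%C) by assumption.
  now rewrite !CInt_scal by assumption.
Qed.

(** The derivative is the transform of [u * w u]. For [Cmod h < 1] the remainder of [exp (h u)] is
    at most [2 (|h| u)^2 exp u], so the shift to [Re s + 1] makes it integrable. *)
Lemma entire_laplace (w : R -> R) : (forall u, continuous w u) -> superexp_decay w -> entire (laplace w).
Proof.
  intros Hw Hd s. apply holomorphic_Cderiv.
  destruct (superexp_decay_poly w (Re s + 1) Hd) as [K [HK H]].
  set (v := fun u => u * w u).
  assert (Hv : forall u, continuous v u) by (intros; apply continuous_Rmult; [apply continuous_id|apply Hw]).
  assert (He : forall u, 0 <= u -> exp (Re s * u) <= exp ((Re s + 1) * u)) by (intros; apply exp_le; nra).
  assert (Hp : forall u, 0 <= Rabs (w u) * exp ((Re s + 1) * u)).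
  { intros u. apply Rmult_le_pos; [apply Rabs_pos|left; apply exp_pos]. }
  destruct (laplace_Clim w s K HK Hw) as [Ls _].
  { intros u Hu. specialize (H u Hu). specialize (Hp u). specialize (He u Hu).
    pose proof (Rabs_pos (w u)). nra. }
  destruct (laplace_Clim v s K HK Hv) as [Lv _].
  { intros u Hu. specialize (H u Hu). specialize (Hp u). specialize (He u Hu).
    pose proof (Rabs_pos (w u)). unfold v. rewrite Rabs_mult, (Rabs_pos_eq u) by exact Hu.
    assert (u * (Rabs (w u) * exp (Re s * u)) <= u * (Rabs (w u) * exp ((Re s + 1) * u))).
    { apply Rmult_le_compat_l; [exact Hu|]. apply Rmult_le_compat_l; lra. }
    nra. }
  exists (laplace v s). apply Cderiv_eps.
  assert (Q : forall h, Cmod h < 1 ->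
    Cmod (laplace w (s + h) - laplace w s - h * laplace v s)%C <= 8 * K * (Cmod h * Cmod h)).
  { intros h Hh. pose proof (Cmod_ge_0 h) as Hh0.
    assert (Hre : Re h <= Cmod h) by (eapply Rle_trans; [apply Rle_abs|apply re_le_Cmod]).
    destruct (laplace_Clim w (s + h)%C K HK Hw) as [Lh _].
    { intros u Hu. specialize (H u Hu). specialize (Hp u).
      assert (exp (Re (s + h)%C * u) <= exp ((Re s + 1) * u)) by (apply exp_le; destruct s, h; simpl in *; nra).
      pose proof (Rabs_pos (w u)). nra. }
    (* One factor 2 each for [Clim_bound], [CInt_bound_exp_neg] and [Cexp_taylor1]. *)
    replace (8 * K * (Cmod h * Cmod h)) with (2 * (2 * (2 * (Cmod h * Cmod h) * K))) by ring.
    apply Clim_bound with (fun n => CInt (laplace_integrand w (s + h)) 0 (INR n) +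
      (- (1)) * CInt (laplace_integrand w s) 0 (INR n) + (- h) * CInt (laplace_integrand v s) 0 (INR n))%C.
    - intros n. rewrite <- CInt_linear by (apply Ccontinuous_laplace; assumption).
      replace (2 * (2 * (Cmod h * Cmod h) * K)) with (2 * (2 * (Cmod h * Cmod h) * K) * exp (- 0)) by (rewrite Ropp_0, exp_0; ring).
      apply CInt_bound_exp_neg.
      + nra.
      + apply pos_INR.
      + apply Ccontinuous_linear; apply Ccontinuous_laplace; assumption.
      + intros u [Hu _].
        replace (laplace_integrand w (s + h) u + - (1) * laplace_integrand w s u + - h * laplace_integrand v s u)%C
          with (laplace_integrand w s u * (Cexp (h * u) - 1 - h * u))%C.
        2:{ unfold laplace_integrand, v. rewrite Cmult_plus_distr_r, Cexp_plus, RtoC_mult. ring. }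
        rewrite Cmod_mult, Cmod_laplace_integrand.
        assert (Hm : Cmod (h * u)%C = Cmod h * u) by (rewrite Cmod_mult, Cmod_R, Rabs_pos_eq by exact Hu; reflexivity).
        pose proof (Cexp_taylor1 (h * u)%C) as T. rewrite Hm in T.
        specialize (H u Hu).
        apply Rle_trans with (Rabs (w u) * exp (Re s * u) * (2 * (Cmod h * u) ^ 2 * exp u)).
        * apply Rmult_le_compat_l; [apply Rmult_le_pos; [apply Rabs_pos|left; apply exp_pos]|].
          eapply Rle_trans; [exact T|]. apply Rmult_le_compat_l; [pose proof (pow2_ge_0 (Cmod h * u)); lra|].
          apply exp_le. nra.
        * replace (Rabs (w u) * exp (Re s * u) * (2 * (Cmod h * u) ^ 2 * exp u)) with
            (2 * (Cmod h * Cmod h) * (u * u * (Rabs (w u) * exp ((Re s + 1) * u)))).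
          2:{ rewrite Rmult_plus_distr_r, Rmult_1_l, exp_plus. ring. }
          rewrite (Rmult_assoc (2 * (Cmod h * Cmod h)) K).
          apply Rmult_le_compat_l; [nra|]. eapply Rle_trans; [|exact H].
          apply Rmult_le_compat_r; [apply Hp|nra].
    - replace (laplace w (s + h) - laplace w s - h * laplace v s)%C with
        (laplace w (s + h) + (- (1)) * laplace w s + (- h) * laplace v s)%C by ring.
      apply Clim_plus; [apply Clim_plus; [exact Lh|]|];
        (apply (Clim_mult (fun _ => _)); [apply Clim_const|assumption]). }
  intros eps Heps. exists (Rmin 1 (eps / (8 * K + 1))). split.
  { apply Rmin_glb_lt; [lra|]. apply Rdiv_lt_0_compat; lra. }
  intros h Hh. eapply Rle_trans; [apply Q; eapply Rlt_le_trans; [exact Hh|apply Rmin_l]|].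
  assert (Hh2 : Cmod h < eps / (8 * K + 1)) by (eapply Rlt_le_trans; [exact Hh|apply Rmin_r]).
  pose proof (Cmod_ge_0 h).
  assert (Cmod h * (8 * K + 1) <= eps).
  { apply Rmult_le_reg_r with (/ (8 * K + 1)); [apply Rinv_0_lt_compat; lra|].
    rewrite Rmult_assoc, Rinv_r by lra. unfold Rdiv in Hh2. lra. }
  rewrite <- Rmult_assoc. apply Rmult_le_compat_r; nra.
Qed.

(** * The theta tail and its Mellin transform *)

Definition theta_term (n : nat) (u : R) : R := exp (- (PI * INR (S n) ^ 2 * exp (2 * u))).

(** In the variable [x = e^(2u)] the inversion [x -> 1/x] becomes [u -> - u], and the Mellin
    transform becomes a two-sided Laplace transform. *)
Definition theta_tail (u : R) : R := Series (fun n => theta_term n u).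

Lemma ex_series_theta_term (u : R) : ex_series (fun n => theta_term n u).
Proof. exact (ex_series_shift _ 1 (ex_series_theta (exp (2 * u)) (exp_pos _))). Qed.

Lemma theta_tail_half (u : R) : theta_half (exp (2 * u)) = 1 + theta_tail u.
Proof.
  unfold theta_half. rewrite (Series_tail _ 0 (ex_series_theta _ (exp_pos _))), sum_n_0.
  simpl (INR 0). replace (PI * 0 ^ 2 * exp (2 * u)) with 0 by ring. rewrite Ropp_0, exp_0. reflexivity.
Qed.

(** The functional equation with the constant term of theta split off; the extra [(exp u - 1) / 2]
    is the source of the poles at 1 and 0. *)
Lemma theta_tail_opp (u : R) : theta_tail (- u) = exp u * theta_tail u + (exp u - 1) / 2.
Proof.
  pose proof (theta_functional_equation (exp (2 * u)) (exp_pos _)) as E.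
  rewrite <- exp_Ropp in E. replace (- (2 * u)) with (2 * - u) in E by ring.
  rewrite !theta_tail_half in E.
  replace (sqrt (exp (2 * u))) with (exp u) in E.
  - lra.
  - replace (2 * u) with (u + u) by ring. rewrite exp_plus. symmetry. apply sqrt_square. left. apply exp_pos.
Qed.

Definition inv_sqr (n : nat) : R := / INR (S n) ^ 2.

Lemma inv_sqr_pos (n : nat) : 0 < inv_sqr n.
Proof. apply Rinv_0_lt_compat, pow_lt, lt_0_INR. lia. Qed.

Lemma ex_series_inv_sqr : ex_series inv_sqr.
Proof.
  apply ex_series_dominated with (fun n => 2 * (/ INR (S n) - / INR (S (S n)))).
  - intros k. rewrite Rabs_pos_eq by (left; apply inv_sqr_pos). unfold inv_sqr. rewrite !S_INR.
    pose proof (pos_INR k).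
    replace (2 * (/ (INR k + 1) - / (INR k + 1 + 1))) with (2 / ((INR k + 1) * (INR k + 2))) by (field; lra).
    apply Rmult_le_reg_r with ((INR k + 1) ^ 2 * (INR k + 2)); [nra|].
    replace (/ (INR k + 1) ^ 2 * ((INR k + 1) ^ 2 * (INR k + 2))) with (INR k + 2) by (field; lra).
    replace (2 / ((INR k + 1) * (INR k + 2)) * ((INR k + 1) ^ 2 * (INR k + 2))) with (2 * (INR k + 1)) by (field; lra).
    lra.
  - apply (ex_series_scal_l (K := R_AbsRing) 2 (fun n => / INR (S n) - / INR (S (S n)))). exists 1.
    change (is_lim_seq (sum_n (fun n => / INR (S n) - / INR (S (S n)))) 1).
    apply (is_lim_seq_ext (fun n => 1 - / INR (S (S n)))).
    + intros n. induction n as [|n IH].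
      * rewrite sum_n_0. simpl. field.
      * rewrite sum_n_S, <- IH. ring.
    + replace (Finite 1) with (Finite (1 - 0)) by (f_equal; ring).
      apply is_lim_seq_minus'; [apply is_lim_seq_const|].
      replace (Finite 0) with (Rbar_inv p_infty) by reflexivity.
      apply is_lim_seq_inv; [|discriminate].
      apply is_lim_seq_ext with (fun n => INR (n + 2)); [intros; f_equal; lia|].
      apply (is_lim_seq_incr_n INR 2 p_infty), is_lim_seq_INR.
Qed.

(* From [e^(y/b) >= y/b]. *)
Lemma exp_neg_le_pow (y : R) (b : nat) : 0 < y -> (0 < b)%nat -> exp (- y) <= (INR b / y) ^ b.
Proof.
  intros Hy Hb. apply lt_0_INR in Hb.
  replace (- y) with (INR b * - (y / INR b)) by (field; lra).
  rewrite <- exp_pow. apply pow_incr. split; [left; apply exp_pos|].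
  rewrite exp_Ropp. replace (INR b / y) with (/ (y / INR b)) by (field; lra).
  apply Rinv_le_contravar; [now apply Rdiv_lt_0_compat|].
  pose proof (exp_ineq1_le (y / INR b)). lra.
Qed.

(** Valid for both signs of [u]: [b = 1] gives the least growth as [u] tends to -infinity, a large
    [b] any exponential decay at +infinity. The factor [inv_sqr n] makes the bound summable in
    [n]. *)
Lemma theta_term_bound (b n : nat) (u : R) : (0 < b)%nat ->
  0 <= theta_term n u <= INR b ^ b * exp (- (2 * INR b * u)) * inv_sqr n.
Proof.
  intros Hb. split; [left; apply exp_pos|]. unfold theta_term, inv_sqr.
  set (N := INR (S n)). assert (HN : 1 <= N).
  { unfold N. rewrite S_INR. pose proof (pos_INR n). lra. }
  assert (Hpi : 1 <= PI) by (pose proof PI2_1; lra). pose proof (exp_pos (2 * u)) as He.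
  assert (H0 : 0 < N ^ 2 * exp (2 * u)) by (apply Rmult_lt_0_compat; [nra|exact He]).
  apply Rle_trans with (exp (- (N ^ 2 * exp (2 * u)))).
  { apply exp_le. nra. }
  eapply Rle_trans; [apply (exp_neg_le_pow _ b H0 Hb)|].
  unfold Rdiv. rewrite Rpow_mult_distr, Rmult_assoc. apply Rmult_le_compat_l; [apply pow_le, pos_INR|].
  rewrite pow_inv, Rpow_mult_distr, exp_pow, Rinv_mult.
  rewrite Rmult_comm. apply Rmult_le_compat.
  - left. apply Rinv_0_lt_compat, exp_pos.
  - left. apply Rinv_0_lt_compat, pow_lt. nra.
  - rewrite <- exp_Ropp. right. f_equal. ring.
  - apply Rinv_le_contravar; [nra|]. rewrite <- (pow_1 (N ^ 2)) at 1. apply Rle_pow; [nra|lia].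
Qed.

Definition inv_sqr_tail (N : nat) : R := Series (fun k => inv_sqr (S N + k)).

Lemma theta_tail_partial (b N : nat) (u : R) : (0 < b)%nat ->
  0 <= theta_tail u - sum_n (fun n => theta_term n u) N <= INR b ^ b * exp (- (2 * INR b * u)) * inv_sqr_tail N.
Proof.
  intros Hb. unfold theta_tail, inv_sqr_tail. rewrite (Series_tail _ N (ex_series_theta_term u)).
  replace (_ + _ - _) with (Series (fun k => theta_term (S N + k) u)) by Rring.
  rewrite <- Series_scal_l. split.
  - replace 0 with (Series (fun k => 0 * theta_term (S N + k) u)) by (rewrite Series_scal_l; ring).
    apply Series_le; [|exact (ex_series_shift _ (S N) (ex_series_theta_term u))].
    intros k. pose proof (theta_term_bound b (S N + k) u Hb). lra.
  - apply Series_le; [intros k; now apply theta_term_bound|].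
    exact (ex_series_scal_l (K := R_AbsRing) _ (fun n => inv_sqr (S N + n)) (ex_series_shift _ (S N) ex_series_inv_sqr)).
Qed.

Lemma theta_tail_bound (b : nat) (u : R) : (0 < b)%nat ->
  0 <= theta_tail u <= INR b ^ b * exp (- (2 * INR b * u)) * Series inv_sqr.
Proof.
  intros Hb. unfold theta_tail. rewrite <- Series_scal_l. split.
  - replace 0 with (Series (fun k => 0 * theta_term k u)) by (rewrite Series_scal_l; ring).
    apply Series_le; [|exact (ex_series_theta_term u)].
    intros k. pose proof (theta_term_bound b k u Hb). lra.
  - apply Series_le; [intros k; now apply theta_term_bound|].
    exact (ex_series_scal_l (K := R_AbsRing) _ inv_sqr ex_series_inv_sqr).
Qed.

Lemma inv_sqr_tail_lim : is_lim_seq inv_sqr_tail 0.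
Proof. exact (Series_tail_lim inv_sqr ex_series_inv_sqr). Qed.

Lemma continuous_theta_term (n : nat) (u : R) : continuous (theta_term n) u.
Proof.
  apply (ex_derive_continuous (V := R_NormedModule)). unfold theta_term. auto_derive. trivial.
Qed.

Lemma continuous_theta_sum (N : nat) (u : R) : continuous (fun t => sum_n (fun n => theta_term n t) N : R) u.
Proof.
  induction N as [|N IH].
  - apply (continuous_ext (theta_term 0)); [intros; symmetry; apply sum_n_0|apply continuous_theta_term].
  - apply (continuous_ext (fun t => (sum_n (fun n => theta_term n t) N : R) + theta_term (S N) t)).
    + intros; symmetry; apply sum_n_S.
    + apply continuous_Rplus; [exact IH|apply continuous_theta_term].
Qed.

Lemma continuous_theta_tail (u : R) : continuous theta_tail u.
Proof.
  apply continuity_pt_filterlim.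
  apply (CVU_cont_open (fun N t => sum_n (fun n => theta_term n t) N) (fun t => u - 1 < t)).
  - apply open_gt.
  (* On the half-line [t > u - 1] the factor [exp (- 2 t)] is bounded, so the partial sums converge
     uniformly there. *)
  - intros eps. set (K := INR 1 ^ 1 * exp (- (2 * INR 1 * (u - 1)))).
    assert (HK : 0 < K) by (unfold K; simpl; pose proof (exp_pos (- (2 * 1 * (u - 1)))); lra).
    assert (L : is_lim_seq (fun N => K * inv_sqr_tail N) 0).
    { replace (Finite 0) with (Finite (K * 0)) by (f_equal; ring).
      exact (is_lim_seq_scal_l _ K _ inv_sqr_tail_lim). }
    destruct (eventually_lt_lim _ _ eps L (cond_pos eps)) as [N HN]. exists N. intros n Hn t Ht.
    specialize (HN n Hn). pose proof (theta_tail_partial 1 n t ltac:(lia)) as B.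
    change (Rabs (sum_n (fun n => theta_term n t) n - theta_tail t) < eps).
    rewrite Rabs_minus_sym, Rabs_pos_eq by lra. eapply Rle_lt_trans; [apply B|].
    eapply Rle_lt_trans; [|exact HN]. apply Rmult_le_compat_r.
    + unfold inv_sqr_tail. replace 0 with (Series (fun k => 0 * inv_sqr (S n + k))) by (rewrite Series_scal_l; ring).
      apply Series_le; [|exact (ex_series_shift _ (S n) ex_series_inv_sqr)].
      intros k. pose proof (inv_sqr_pos (S n + k)). lra.
    + unfold K. apply Rmult_le_compat_l; [simpl; lra|]. apply exp_le. simpl. lra.
  - intros n t _. apply continuity_pt_filterlim, continuous_theta_sum.
  - lra.
Qed.

Lemma superexp_decay_theta_tail : superexp_decay theta_tail.
Proof.
  intros b. exists (INR (S b) ^ S b * Series inv_sqr).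
  assert (HS : 0 <= Series inv_sqr).
  { pose proof (theta_tail_bound 1 0 ltac:(lia)) as B. rewrite Rmult_0_r, Ropp_0, exp_0 in B. simpl in B. lra. }
  split.
  - apply Rmult_le_pos; [apply pow_le, pos_INR|exact HS].
  - intros u Hu. pose proof (theta_tail_bound (S b) u ltac:(lia)) as B.
    rewrite Rabs_pos_eq by apply B. eapply Rle_trans; [apply B|].
    replace (INR (S b) ^ S b * exp (- (2 * INR (S b) * u)) * Series inv_sqr) with
      (INR (S b) ^ S b * Series inv_sqr * exp (- (2 * INR (S b) * u))) by ring.
    apply Rmult_le_compat_l; [apply Rmult_le_pos; [apply pow_le, pos_INR|exact HS]|].
    apply exp_le. rewrite S_INR. pose proof (pos_INR b). nra.
Qed.

Lemma Re_div_2 (s : C) : Re (s / 2)%C = Re s / 2.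
Proof. destruct s. simpl. field. Qed.

Lemma C2_neq_0 : RtoC 2 <> 0%C.
Proof. intros E. apply (f_equal Re) in E. simpl in E. lra. Qed.

Lemma CInt_Cexp (c : C) (T : R) : (c * CInt (fun u => Cexp (c * u)) 0 T)%C = (Cexp (c * T) - 1)%C.
Proof.
  assert (Hc : Ccontinuous (fun u => c * Cexp (c * u))%C).
  { apply (Ccontinuous_mult (fun _ => c)); [apply Ccontinuous_const|apply Ccontinuous_Cexp_line]. }
  rewrite <- CInt_scal by apply Ccontinuous_Cexp_line.
  apply injective_projections; unfold CInt; simpl fst; simpl snd.
  - rewrite (RInt_derive_R (fun u => Re (Cexp (c * u)))).
    + destruct c as [p q]. simpl. replace (p * 0 - q * 0) with 0 by ring. replace (p * 0 + q * 0) with 0 by ring.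
      rewrite exp_0, cos_0. Rring.
    + intros t. destruct c as [p q]. simpl. auto_derive; [trivial|unfold Rminus; ring].
    + intros t. apply Hc.
  - rewrite (RInt_derive_R (fun u => Im (Cexp (c * u)))).
    + destruct c as [p q]. simpl. replace (p * 0 - q * 0) with 0 by ring. replace (p * 0 + q * 0) with 0 by ring.
      rewrite sin_0. Rring.
    + intros t. destruct c as [p q]. simpl. auto_derive; [trivial|unfold Rminus; ring].
    + intros t. apply Hc.
Qed.

Lemma Clim_CInt_Cexp (c : C) : Re c <= -1 -> Clim (fun n => CInt (fun u => Cexp (c * u)) 0 (INR n)) (- / c)%C.
Proof.
  intros Hc. assert (Hc0 : c <> 0%C) by (intros ->; simpl in Hc; lra).
  apply Clim_ext with (fun n => / c * (Cexp (c * INR n) + - (1)))%C.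
  - intros n. replace (Cexp (c * INR n) + - (1))%C with (Cexp (c * INR n) - 1)%C by ring.
    rewrite <- CInt_Cexp. field. exact Hc0.
  - replace (- / c)%C with (/ c * (0 + - (1)))%C by ring.
    apply Clim_mult; [apply Clim_const|]. apply Clim_plus; [|apply Clim_const].
    (* The error sequence is taken to be the modulus itself. *)
    apply (Clim_squeeze _ _ _ (fun n => Req_le _ _ eq_refl)).
    apply (is_lim_seq_le_le (fun _ => 0) _ (fun n => exp (- INR n))).
    + intros n. split; [apply Cmod_ge_0|].
      replace (Cexp (c * INR n) - 0)%C with (Cexp (c * INR n)) by ring.
      rewrite Cmod_Cexp. apply exp_le. pose proof (pos_INR n). destruct c as [p q]. simpl in *. nra.
    + apply is_lim_seq_const.
    + apply is_lim_seq_exp_neg.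
Qed.

Lemma laplace_theta_Clim (s : C) :
  Clim (fun n => CInt (laplace_integrand theta_tail s) 0 (INR n)) (laplace theta_tail s).
Proof.
  destruct (superexp_decay_poly theta_tail (Re s) superexp_decay_theta_tail) as [K [HK H]].
  apply (laplace_Clim theta_tail s K HK continuous_theta_tail).
  intros u Hu. eapply Rle_trans; [|exact (H u Hu)].
  assert (0 <= Rabs (theta_tail u) * exp (Re s * u)) by (apply Rmult_le_pos; [apply Rabs_pos|left; apply exp_pos]).
  nra.
Qed.

(** The negative half-line, folded by [theta_tail_opp], gives the transform at [1 - s] and two pure
    exponentials, whose integrals add up to [(1 / (s - 1) - 1 / s) / 2]. *)
Lemma theta_mellin_symmetric (s : C) : 3 < Re s ->
  Clim (fun n => CInt (laplace_integrand theta_tail s) (- INR n) (INR n))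
    (laplace theta_tail s + laplace theta_tail (1 - s) + / (2 * s * (s - 1)))%C.
Proof.
  intros Hs.
  assert (Hc : forall z, Ccontinuous (laplace_integrand theta_tail z))
    by (intros; apply Ccontinuous_laplace, continuous_theta_tail).
  assert (Hs0 : s <> 0%C) by (intros ->; simpl in Hs; lra).
  assert (Hs1 : (s - 1)%C <> 0%C).
  { intros E. apply (f_equal Re) in E. rewrite Re_minus in E. simpl in E. lra. }
  assert (Hs1' : (1 - s)%C <> 0%C).
  { intros E. apply (f_equal Re) in E. rewrite Re_minus in E. simpl in E. lra. }
  apply Clim_ext with (fun n => CInt (laplace_integrand theta_tail s) 0 (INR n) +
     (CInt (laplace_integrand theta_tail (1 - s)) 0 (INR n) +
     / 2 * CInt (fun u => Cexp ((1 - s) * u)) 0 (INR n) + - / 2 * CInt (fun u => Cexp ((- s) * u)) 0 (INR n)))%C.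
  - intros n. rewrite (CInt_Chasles _ (- INR n) 0 (INR n) (Hc s)), <- CInt_opp_var by apply Hc.
    rewrite (CInt_ext (fun t => laplace_integrand theta_tail s (- t))
      (fun t => laplace_integrand theta_tail (1 - s) t + / 2 * Cexp ((1 - s) * t) + - / 2 * Cexp ((- s) * t))%C).
    + rewrite (CInt_linear _ _ _ _ _ 0 (INR n) (Hc (1 - s)%C) (Ccontinuous_Cexp_line (1 - s))
        (Ccontinuous_Cexp_line (- s))). ring.
    + intros t. unfold laplace_integrand. rewrite theta_tail_opp.
      replace ((1 - s) * t)%C with (t + (- s) * t)%C by ring.
      rewrite Cexp_plus, Cexp_RtoC, RtoC_plus, RtoC_mult, RtoC_div, RtoC_minus, RtoC_opp by lra.
      replace (s * - t)%C with (- s * t)%C by ring. field.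
  - replace (/ (2 * s * (s - 1)))%C with (/ 2 * - / (1 - s) + - / 2 * - / (- s))%C.
  2:{ field. pose proof C2_neq_0. repeat split; assumption. }
    replace (laplace theta_tail s + laplace theta_tail (1 - s) + (/ 2 * - / (1 - s) + - / 2 * - / - s))%C with
      (laplace theta_tail s + (laplace theta_tail (1 - s) + / 2 * - / (1 - s) + - / 2 * - / - s))%C by ring.
    apply Clim_plus; [apply laplace_theta_Clim|].
    apply Clim_plus; [apply Clim_plus; [apply laplace_theta_Clim|]|]; (apply (Clim_mult (fun _ => _)); [apply Clim_const|]); apply Clim_CInt_Cexp;
      destruct s; simpl in *; lra.
Qed.

(** * Gamma and zeta *)

Lemma continuous_C_pair (a b : R -> R) (x : R) : continuous a x -> continuous b x ->
  continuous (T := R_UniformSpace) (U := C_R_CompleteNormedModule) (fun t => (a t, b t)) x.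
Proof.
  intros Ha Hb P [eps HP].
  assert (E : locally x (fun t => ball (a x) eps (a t) /\ ball (b x) eps (b t))).
  { apply filter_and; [apply Ha|apply Hb]; now exists eps. }
  destruct E as [d Hd]. exists d. intros y Hy. apply HP. exact (Hd y Hy).
Qed.

Lemma gamma_integrand_continuous (z : C) (x : R) : 0 < x ->
  continuous (T := R_UniformSpace) (U := C_R_CompleteNormedModule) (fun x => (Rcpow x z * exp (- x))%C) x.
Proof.
  intros Hx. destruct z as [p q].
  apply (continuous_ext (U := C_R_CompleteNormedModule)
    (fun t => (Re (Rcpow t (p, q) * exp (- t))%C, Im (Rcpow t (p, q) * exp (- t))%C)));
    [intros t; apply surjective_pairing|].
  apply continuous_C_pair; simpl; apply (ex_derive_continuous (V := R_NormedModule)); auto_derive; auto.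
Qed.

(* Substitution x = c e^(2u). *)
Lemma gamma_substitution (Gamma : C -> C) (z : C) (c : R) : is_gamma Gamma -> 0 < Re z -> 0 < c ->
  Clim (fun k => CInt (fun u => RtoC 2 * Cexp (z * ln c) * (exp (- (c * exp (2 * u))) * Cexp ((2 * z) * u)))%C (- INR k) (INR k))
    (Gamma z).
Proof.
  intros [HG _] Hz Hc. specialize (HG z Hz).
  set (f := fun x : R => (Rcpow x (z - 1) * exp (- x))%C).
  set (g := fun u => c * exp (2 * u)). set (dg := fun u => 2 * (c * exp (2 * u))).
  set (F := fun u => (RtoC 2 * Cexp (z * ln c) * (exp (- (c * exp (2 * u))) * Cexp ((2 * z) * u)))%C).
  assert (Hg : forall u, 0 < g u) by (intros u; apply Rmult_lt_0_compat; [exact Hc|apply exp_pos]).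
  assert (Hsub : forall u, (dg u * f (g u))%C = F u).
  { intros u. unfold f, F, Rcpow.
    assert (Hl : ln (g u) = ln c + 2 * u) by (unfold g; rewrite ln_mult, ln_exp by (auto; apply exp_pos); reflexivity).
    rewrite Hl. fold (g u).
    replace (dg u) with (2 * exp (ln c + 2 * u)) by (rewrite <- Hl, exp_ln by apply Hg; reflexivity).
    rewrite RtoC_mult, <- (Cexp_RtoC (ln c + 2 * u)).
    replace (RtoC 2 * Cexp (ln c + 2 * u)%R * (Cexp ((z - 1) * (ln c + 2 * u)%R) * exp (- g u)))%C with
      (RtoC 2 * (Cexp (ln c + 2 * u)%R * Cexp ((z - 1) * (ln c + 2 * u)%R)) * exp (- g u))%C by ring.
    rewrite <- Cexp_plus.
    replace ((ln c + 2 * u)%R + (z - 1) * (ln c + 2 * u)%R)%C with (z * ln c + 2 * z * u)%C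
      by (rewrite RtoC_plus, RtoC_mult; ring).
    rewrite Cexp_plus. ring. }
  assert (Key : forall k, is_RInt (V := C_R_NormedModule) (fun u => F u) (- INR k) (INR k)
    (RInt (V := C_R_CompleteNormedModule) f (g (- INR k)) (g (INR k)))).
  { intros k.
    apply (is_RInt_ext (V := C_R_NormedModule) (fun u => scal (dg u) (f (g u)))).
    - intros u _. rewrite <- Hsub. destruct (f (g u)) as [a b].
      apply injective_projections; simpl; unfold scal; simpl; unfold mult; simpl; ring.
    - apply (is_RInt_comp (V := C_R_CompleteNormedModule) f g dg).
      + intros u _. apply gamma_integrand_continuous, Hg.
      + intros u _. split.
        * unfold g, dg. auto_derive; [trivial|ring].
        * apply (ex_derive_continuous (V := R_NormedModule)). unfold dg. auto_derive. trivial. }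
  assert (Comp : forall k, CInt F (- INR k) (INR k) = RInt (V := C_R_CompleteNormedModule) f (g (- INR k)) (g (INR k))).
  { intros k. specialize (Key k). apply injective_projections.
    - apply is_RInt_unique. exact (is_RInt_fct_extend_fst (U := R_NormedModule) (V := R_NormedModule) _ _ _ _ Key).
    - apply is_RInt_unique. exact (is_RInt_fct_extend_snd (U := R_NormedModule) (V := R_NormedModule) _ _ _ _ Key). }
  (* The improper integral converges as its end points vary independently; it is evaluated at
     [g (- k)] and [g k], which tend to 0 and to +infinity. *)
  assert (HL : forall eps : posreal, eventually (fun k => ball (Gamma z) eps (CInt F (- INR k) (INR k) : C))).
  { intros eps. destruct (HG (ball (Gamma z) eps) (locally_ball _ _)) as [Q S HQ HS HQS].
    destruct HQ as [d Hd]. destruct HS as [M HM].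
    assert (L1 : is_lim_seq (fun k => c * exp (- INR k)) 0).
    { replace (Finite 0) with (Finite (c * 0)) by (f_equal; ring). exact (is_lim_seq_scal_l _ c _ is_lim_seq_exp_neg). }
    destruct (eventually_lt_lim _ _ d L1 (cond_pos d)) as [N1 HN1].
    destruct (INR_unbounded (M / c)) as [N2 HN2].
    exists (max N1 N2). intros k Hk. rewrite Comp.
    assert (A1 : Q (g (- INR k))).
    { apply Hd; [|apply Hg]. specialize (HN1 k ltac:(lia)). specialize (Hg (- INR k)).
      unfold ball; simpl; unfold AbsRing_ball, abs, minus, plus, opp; simpl.
      rewrite Ropp_0, Rplus_0_r, Rabs_pos_eq by lra. eapply Rle_lt_trans; [|exact HN1].
      unfold g. apply Rmult_le_compat_l; [lra|]. apply exp_le. pose proof (pos_INR k). lra. }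
    assert (A2 : S (g (INR k))).
    { apply HM. assert (INR N2 <= INR k) by (apply le_INR; lia). pose proof (exp_ineq1_le (2 * INR k)) as E.
      pose proof (pos_INR k).
      apply Rmult_lt_reg_r with (/ c); [now apply Rinv_0_lt_compat|]. unfold g.
      replace (c * exp (2 * INR k) * / c) with (exp (2 * INR k)) by (field; lra). unfold Rdiv in HN2. lra. }
    destruct (HQS _ _ A1 A2) as [y [Hy By]]. simpl in Hy.
    rewrite (is_RInt_unique (V := C_R_CompleteNormedModule) f _ _ _ Hy). exact By. }
  split; apply is_lim_seq_spec; intros eps; destruct (HL eps) as [N HN]; exists N; intros k Hk;
    destruct (HN k Hk) as [B1 B2].
  - exact B1.
  - exact B2.
Qed.

Fixpoint csum (a : nat -> C) (N : nat) : C :=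
  match N with O => a 0%nat | S n => (csum a n + a (S n))%C end.

Lemma is_series_Clim (a : nat -> C) (l : C) :
  @is_series C_AbsRing C_NormedModule a l -> Clim (csum a) l.
Proof.
  intros H.
  assert (E : forall n, sum_n (G := NormedModule.AbelianMonoid C_AbsRing C_NormedModule) a n = csum a n).
  { induction n as [|n IH]; [rewrite sum_O; reflexivity|]. rewrite sum_Sn, IH. reflexivity. }
  assert (HL : forall eps : posreal, eventually (fun k => ball (l : C_UniformSpace) eps (csum a k))).
  { intros eps. destruct (H (ball (l : C_UniformSpace) eps) (locally_ball _ _)) as [N HN]. exists N. intros n Hn.
    rewrite <- E. exact (HN n Hn). }
  split; apply is_lim_seq_spec; intros eps; destruct (HL eps) as [N HN]; exists N; intros k Hk;
    destruct (HN k Hk) as [B1 B2].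
  - exact B1.
  - exact B2.
Qed.

Lemma csum_scal (c : C) (a : nat -> C) (N : nat) : csum (fun n => c * a n)%C N = (c * csum a N)%C.
Proof. induction N as [|N IH]; simpl; [reflexivity|]. rewrite IH. ring. Qed.

Lemma csum_Clim (u : nat -> nat -> C) (l : nat -> C) (N : nat) :
  (forall n, Clim (fun k => u n k) (l n)) -> Clim (fun k => csum (fun n => u n k) N) (csum l N).
Proof.
  intros H. induction N as [|N IH]; simpl; [apply H|].
  apply (Clim_plus (fun k => csum (fun n => u n k) N)); [exact IH|apply H].
Qed.

Lemma csum_CInt_theta (s : C) (a b : R) (N : nat) :
  csum (fun n => CInt (laplace_integrand (theta_term n) s) a b) N =
  CInt (laplace_integrand (fun u => sum_n (fun n => theta_term n u) N) s) a b.
Proof.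
  induction N as [|N IH]; simpl csum.
  - apply CInt_ext. intros t. unfold laplace_integrand. now rewrite sum_n_0.
  - rewrite IH, <- CInt_plus.
    + apply CInt_ext. intros t. unfold laplace_integrand. rewrite sum_n_S, RtoC_plus. ring.
    + apply Ccontinuous_laplace, continuous_theta_sum.
    + apply Ccontinuous_laplace, continuous_theta_term.
Qed.

Lemma inv_sqr_tail_nonneg (N : nat) : 0 <= inv_sqr_tail N.
Proof.
  pose proof (theta_tail_partial 1 N 0 ltac:(lia)) as B. rewrite Rmult_0_r, Ropp_0, exp_0 in B. simpl in B. lra.
Qed.

Lemma Ccontinuous_opp_arg (f : R -> C) : Ccontinuous f -> Ccontinuous (fun t => f (- t)).
Proof.
  intros H t.
  assert (O : continuous Ropp t) by apply (continuous_opp (V := R_NormedModule) (fun x => x)), continuous_id.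
  split.
  - apply (continuous_comp Ropp (fun t => Re (f t))); [exact O|apply H].
  - apply (continuous_comp Ropp (fun t => Im (f t))); [exact O|apply H].
Qed.

(** Uniformity in the end point [k] is the point: it lets the sum over [n] and the improper integral
    be exchanged. *)
Lemma theta_remainder_bound (s : C) : 3 < Re s -> exists K, 0 <= K /\ forall N k,
  Cmod (CInt (laplace_integrand (fun u => theta_tail u - sum_n (fun n => theta_term n u) N) s) (- INR k) (INR k))
    <= K * inv_sqr_tail N.
Proof.
  intros Hs. destruct (INR_unbounded (Re s + 1)) as [b Hb].
  assert (Hb0 : (0 < b)%nat) by (apply INR_lt; simpl; lra).
  assert (HB : 0 <= INR b ^ b) by (apply pow_le, pos_INR).
  exists (2 + 2 * INR b ^ b). split; [lra|]. intros N k.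
  set (r := fun u => theta_tail u - sum_n (fun n => theta_term n u) N).
  assert (Hr : forall u, continuous r u).
  { intros u. apply continuous_Rminus; [apply continuous_theta_tail|apply continuous_theta_sum]. }
  pose proof (Ccontinuous_laplace r s Hr) as Hc. pose proof (inv_sqr_tail_nonneg N) as He.
  set (e := inv_sqr_tail N) in *.
  rewrite (CInt_Chasles _ (- INR k) 0 (INR k) Hc), <- CInt_opp_var by exact Hc.
  eapply Rle_trans; [apply Cmod_triangle|].
  pose proof (pos_INR k) as Hk.
  (* At [u = - t] the bound with [b = 1] grows like [exp (2 t)] against [exp (- t Re s)]; this is
     where 3 comes from, as [exp (- t)] must remain. *)
  assert (B1 : Cmod (CInt (fun t => laplace_integrand r s (- t)) 0 (INR k)) <= 2 * e * exp (- 0)).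
  { apply CInt_bound_exp_neg; [exact He|exact Hk| |].
    - now apply Ccontinuous_opp_arg.
    - intros t [Ht _]. rewrite Cmod_laplace_integrand.
      pose proof (theta_tail_partial 1 N (- t) ltac:(lia)) as B. fold (r (- t)) e in B.
      rewrite Rabs_pos_eq by apply B. simpl (INR 1) in B. simpl (1 ^ 1) in B.
      apply Rle_trans with (1 * 1 * exp (- (2 * 1 * - t)) * e * exp (Re s * - t)).
      + apply Rmult_le_compat_r; [left; apply exp_pos|apply B].
      + replace (1 * 1 * exp (- (2 * 1 * - t)) * e * exp (Re s * - t)) with (e * exp (- (2 * 1 * - t) + Re s * - t)) by (rewrite exp_plus; ring).
        apply Rmult_le_compat_l; [exact He|]. apply exp_le. nra. }
  assert (B2 : Cmod (CInt (laplace_integrand r s) 0 (INR k)) <= 2 * (INR b ^ b * e) * exp (- 0)).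
  { apply CInt_bound_exp_neg; [now apply Rmult_le_pos|exact Hk|exact Hc|].
    intros t [Ht _]. rewrite Cmod_laplace_integrand.
    pose proof (theta_tail_partial b N t Hb0) as B. fold (r t) e in B.
    rewrite Rabs_pos_eq by apply B.
    apply Rle_trans with (INR b ^ b * exp (- (2 * INR b * t)) * e * exp (Re s * t)).
    - apply Rmult_le_compat_r; [left; apply exp_pos|apply B].
    - replace (INR b ^ b * exp (- (2 * INR b * t)) * e * exp (Re s * t)) with (INR b ^ b * e * exp (- (2 * INR b * t) + Re s * t)) by (rewrite exp_plus; ring).
      apply Rmult_le_compat_l; [now apply Rmult_le_pos|]. apply exp_le. nra. }
  rewrite Ropp_0, exp_0 in B1, B2. lra.
Qed.

(** With [c = PI n^2] in [gamma_substitution], the transform of the [n]-th theta term is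
    [g0 * n^(-s)]. The sums of these tend to the left side by the Dirichlet series and to the right
    side by the uniform remainder bound. *)
Lemma zeta_gamma_theta (zeta Gamma : C -> C) (s : C) :
  is_riemann_zeta zeta -> is_gamma Gamma -> 3 < Re s ->
  (/ 2 * Rcpow PI (- s / 2) * Gamma (s / 2) * zeta s)%C =
  (laplace theta_tail s + laplace theta_tail (1 - s) + / (2 * s * (s - 1)))%C.
Proof.
  intros [HZ _] HG Hs. pose proof PI_RGT_0 as Hpi.
  set (g0 := (/ 2 * Rcpow PI (- s / 2) * Gamma (s / 2))%C).
  set (J := (laplace theta_tail s + laplace theta_tail (1 - s) + / (2 * s * (s - 1)))%C).
  assert (HI : forall n, Clim (fun k => CInt (laplace_integrand (theta_term n) s) (- INR k) (INR k))
     (g0 * Rcpow (INR (S n)) (- s))%C).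
  { intros n. set (c := PI * INR (S n) ^ 2).
    assert (Hn : 0 < INR (S n)) by (apply lt_0_INR; lia).
    assert (Hc : 0 < c) by (apply Rmult_lt_0_compat; [lra|apply pow_lt; exact Hn]).
    pose proof (gamma_substitution Gamma (s / 2)%C c HG ltac:(rewrite Re_div_2; lra) Hc) as L.
    apply Clim_ext with (fun k => (/ 2 * Cexp (- (s / 2 * ln c))) *
       CInt (fun u => RtoC 2 * Cexp (s / 2 * ln c) * (exp (- (c * exp (2 * u))) * Cexp ((2 * (s / 2)) * u)))%C (- INR k) (INR k))%C.
    - intros k. rewrite <- CInt_scal.
      + apply CInt_ext. intros t. unfold laplace_integrand, theta_term. fold c.
        replace (2 * (s / 2) * t)%C with (s * t)%C by (field; exact C2_neq_0).
        replace (/ 2 * Cexp (- (s / 2 * ln c)) * (2 * Cexp (s / 2 * ln c) * (exp (- (c * exp (2 * t))) * Cexp (s * t))))%C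
          with ((Cexp (- (s / 2 * ln c)) * Cexp (s / 2 * ln c)) * (exp (- (c * exp (2 * t))) * Cexp (s * t)))%C
          by (field; exact C2_neq_0).
        rewrite <- Cexp_plus. replace (- (s / 2 * ln c) + s / 2 * ln c)%C with (RtoC 0) by ring.
        rewrite Cexp_0. ring.
      + apply Ccontinuous_scal.
        apply (Ccontinuous_laplace (fun u => exp (- (c * exp (2 * u)))) (2 * (s / 2))).
        intros u. apply (ex_derive_continuous (V := R_NormedModule)). auto_derive. trivial.
    - replace (g0 * Rcpow (INR (S n)) (- s))%C with ((/ 2 * Cexp (- (s / 2 * ln c))) * Gamma (s / 2))%C.
      + apply Clim_mult; [apply Clim_const|exact L].
      + unfold g0, Rcpow.
        assert (El : ln c = ln PI + 2 * ln (INR (S n))).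
        { unfold c. replace (INR (S n) ^ 2) with (INR (S n) * INR (S n)) by ring.
          rewrite (ln_mult PI), (ln_mult (INR (S n))); try assumption; [ring|now apply Rmult_lt_0_compat]. }
        replace (- (s / 2 * ln c))%C with (- s / 2 * ln PI + - s * ln (INR (S n)))%C.
        * rewrite Cexp_plus. ring.
        * rewrite El, RtoC_plus, RtoC_mult. field. }
  apply Clim_unique with (csum (fun n => g0 * Rcpow (INR (S n)) (- s))%C).
  - apply Clim_ext with (fun N => g0 * csum (fun n => Rcpow (INR (S n)) (- s)) N)%C.
    + intros N. symmetry. apply csum_scal.
    + apply Clim_mult; [apply Clim_const|]. apply is_series_Clim, HZ. lra.
  - destruct (theta_remainder_bound s Hs) as [K [HK HB]].
    apply Clim_squeeze with (fun N => 2 * (K * inv_sqr_tail N)).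
    + intros N. apply Clim_bound with (fun k => csum (fun n => CInt (laplace_integrand (theta_term n) s) (- INR k) (INR k)) N
        + (- (1)) * CInt (laplace_integrand theta_tail s) (- INR k) (INR k))%C.
      * intros k. rewrite csum_CInt_theta.
        rewrite <- CInt_scal, <- CInt_plus.
        -- rewrite (CInt_ext _ (fun t => (- (1)) *
             laplace_integrand (fun u => (theta_tail u - sum_n (fun n => theta_term n u) N)%R) s t)%C).
           ++ rewrite CInt_scal, Cmod_mult, Cmod_m1, Rmult_1_l; [apply HB|].
              apply Ccontinuous_laplace. intros u.
              apply continuous_Rminus; [apply continuous_theta_tail|apply continuous_theta_sum].
           ++ intros t. unfold laplace_integrand. rewrite RtoC_minus. ring.
        -- apply Ccontinuous_laplace, continuous_theta_sum.
        -- apply Ccontinuous_scal, Ccontinuous_laplace, continuous_theta_tail.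
        -- apply Ccontinuous_laplace, continuous_theta_tail.
      * replace (csum (fun n => g0 * Rcpow (INR (S n)) (- s)) N - J)%C with
          (csum (fun n => g0 * Rcpow (INR (S n)) (- s)) N + (- (1)) * J)%C by ring.
        apply Clim_plus; [now apply csum_Clim|].
        apply Clim_mult; [apply Clim_const|]. now apply theta_mellin_symmetric.
    + replace (Finite 0) with (Finite (2 * (K * 0))) by (f_equal; ring).
      apply (is_lim_seq_scal_l (fun N => K * inv_sqr_tail N) 2 (K * 0)).
      exact (is_lim_seq_scal_l _ K _ inv_sqr_tail_lim).
Qed.

(** * The saddle point *)

(** Riemann's form, invariant under [s -> 1 - s]: the factor [s (s - 1)] turns the polar part
    [1 / (2 s (s - 1))] into the constant 1/2. *)
Definition xi_theta (s : C) : C :=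
  (s * (s - 1) * (laplace theta_tail s + laplace theta_tail (1 - s)) + / 2)%C.

Lemma entire_xi_theta : entire xi_theta.
Proof.
  pose proof (entire_laplace theta_tail continuous_theta_tail superexp_decay_theta_tail) as HA.
  assert (H1 : entire (fun s => 1 - s)%C).
  { apply entire_ext with (fun s => 1 + (- (1)) * s)%C; [intros; ring|].
    apply entire_plus; [apply entire_const|]. apply entire_mult; [apply entire_const|apply entire_id]. }
  apply (entire_plus (fun s => s * (s - 1) * (laplace theta_tail s + laplace theta_tail (1 - s)))%C);
    [|apply entire_const].
  apply (entire_mult (fun s => s * (s - 1))%C).
  - apply (entire_mult (fun s => s)); [apply entire_id|]. apply (entire_plus (fun s => s)); [apply entire_id|apply entire_const].
  - apply entire_plus; [exact HA|]. exact (entire_comp _ _ HA H1).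
Qed.

Lemma xi_eq_xi_theta (xi : C -> C) : is_riemann_xi xi -> forall s, xi s = xi_theta s.
Proof.
  intros [Hent (zeta & Gamma & Hz & HG & Hxi)] s.
  assert (D : entire (fun s => xi s + (- (1)) * xi_theta s)%C).
  { apply entire_plus; [exact Hent|]. apply entire_mult; [apply entire_const|apply entire_xi_theta]. }
  pose proof (entire_zero_half_plane _ 3 D) as Z.
  assert (E : (xi s + - (1) * xi_theta s)%C = 0%C).
  { apply Z. clear s Z. intros s Hs.
    assert (Hs0 : s <> 0%C) by (intros ->; simpl in Hs; lra).
    assert (Hs1 : (s - 1)%C <> 0%C).
    { intros E. apply (f_equal Re) in E. rewrite Re_minus in E. simpl in E. lra. }
    rewrite Hxi.
    - replace (s * (s - 1) / 2 * Rcpow PI (- s / 2) * Gamma (s / 2) * zeta s)%C with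
        (s * (s - 1) * (/ 2 * Rcpow PI (- s / 2) * Gamma (s / 2) * zeta s))%C by (field; exact C2_neq_0).
      rewrite (zeta_gamma_theta zeta Gamma s Hz HG Hs). unfold xi_theta. field.
      pose proof C2_neq_0. repeat split; assumption.
    - intros ->. simpl in Hs. lra.
    - intros n ->. simpl in Hs. pose proof (pos_INR n). lra. }
  replace (xi s) with ((xi s + - (1) * xi_theta s) + xi_theta s)%C by ring. rewrite E. ring.
Qed.

Lemma laplace_theta_conj_Im (s : C) : Im (laplace theta_tail (Cconj s)) = - Im (laplace theta_tail s).
Proof.
  pose proof (proj2 (laplace_theta_Clim (Cconj s))) as H1. pose proof (proj2 (laplace_theta_Clim s)) as H2.
  apply is_lim_seq_opp_R in H2. apply is_lim_seq_unique in H1, H2.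
  apply Rbar_finite_eq. rewrite <- H1, <- H2. apply Lim_seq_ext. intros n.
  pose proof (proj2 (Ccontinuous_ex_RInt _ 0 (INR n) (Ccontinuous_laplace theta_tail s continuous_theta_tail))) as E.
  transitivity (RInt (fun t => - Im (laplace_integrand theta_tail s t)) 0 (INR n));
    [|exact (RInt_opp (V := R_CompleteNormedModule) _ _ _ E)].
  apply RInt_ext. intros t _. destruct s as [p q]. simpl.
  replace (p * 0 + - q * t) with (- (p * 0 + q * t)) by ring. rewrite sin_neg.
  replace (p * t - - q * 0) with (p * t - q * 0) by ring. ring.
Qed.

(** On this line [1 - s] is the conjugate of [s], so the two transforms are conjugate to each other
    and [s (s - 1) = - |s|^2] is real. *)
Lemma xi_theta_critical_line (t : R) : Im (xi_theta (1 / 2, t)) = 0.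
Proof.
  unfold xi_theta. set (s := (1 / 2, t) : C).
  replace (1 - s)%C with (Cconj s) by (unfold s; apply injective_projections; simpl; field).
  pose proof (laplace_theta_conj_Im s) as E.
  destruct (laplace theta_tail s) as [a b], (laplace theta_tail (Cconj s)) as [a' b']. simpl in *. subst b'.
  field.
Qed.

Lemma theta_tail_pos (u : R) : 0 < theta_tail u.
Proof.
  pose proof (theta_tail_partial 1 0 u ltac:(lia)) as B. rewrite sum_n_0 in B.
  assert (0 < theta_term 0 u) by apply exp_pos. lra.
Qed.

Lemma laplace_theta_real_pos (x : R) : 0 < Re (laplace theta_tail x).
Proof.
  pose proof (proj1 (laplace_theta_Clim x)) as H.
  set (f := fun t => Re (laplace_integrand theta_tail x t)).
  assert (Hc : forall t, continuous f t).
  { intros t. apply (Ccontinuous_laplace theta_tail x continuous_theta_tail). }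
  assert (Hp : forall t, 0 < f t).
  { intros t. unfold f, laplace_integrand. replace (x * t)%C with (RtoC (x * t)) by apply RtoC_mult.
    rewrite Cexp_RtoC, <- RtoC_mult. simpl. apply Rmult_lt_0_compat; [apply theta_tail_pos|apply exp_pos]. }
  apply Rlt_le_trans with (RInt f 0 1).
  - apply RInt_gt_0; [lra|auto|auto].
  - apply (is_lim_seq_le_loc (fun _ => RInt f 0 1) (fun n => RInt f 0 (INR n)) (RInt f 0 1) (Re (laplace theta_tail x))).
    + exists 1%nat. intros n Hn. apply le_INR in Hn. simpl in Hn.
      rewrite <- (RInt_Chasles (V := R_CompleteNormedModule) f 0 1 (INR n)) by now apply ex_RInt_continuous_R.
      assert (0 <= RInt f 1 (INR n)).
      { apply RInt_ge_0; [exact Hn|now apply ex_RInt_continuous_R|]. intros y _. left. apply Hp. }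
      unfold plus; simpl. lra.
    + apply is_lim_seq_const.
    + exact H.
Qed.

(** The value at 0 is 1/2; at 2 it is 1/2 plus twice the transforms at 2 and -1, whose real parts
    are positive. *)
Lemma xi_theta_not_constant : xi_theta 0 <> xi_theta 2.
Proof.
  intros E. unfold xi_theta in E.
  pose proof (laplace_theta_real_pos 2) as P2. pose proof (laplace_theta_real_pos (-1)) as P1.
  replace (1 - 2)%C with (RtoC (-1)) in E by (apply injective_projections; simpl; ring).
  apply (f_equal Re) in E.
  destruct (laplace theta_tail 2) as [a b], (laplace theta_tail (-1)) as [a' b'],
    (laplace theta_tail 0) as [a0 b0], (laplace theta_tail (1 - 0)) as [a1 b1]. simpl in *. lra.
Qed.

Lemma derivable_pt_lim_interior_max (f : R -> R) (x l a b : R) :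
  derivable_pt_lim f x l -> a < x < b ->
  (forall y, a < y < b -> f y <= f x) -> l = 0.
Proof.
  intros H Hx Hmax.
  (* Built explicitly so that [derive_pt f x pr] computes to [l]. *)
  pose (pr := exist (fun l => derivable_pt_abs f x l) l H : derivable_pt f x).
  exact (deriv_maximum f a b x pr (proj1 Hx) (proj2 Hx) (fun y H1 H2 => Hmax y (conj H1 H2))).
Qed.

Lemma local_extremum_derivative (f : R -> R) (x l : R) :
  derivable_pt_lim f x l -> is_local_extremum f x -> l = 0.
Proof.
  intros H [[d Hd]|[d Hd]]; pose proof (cond_pos d).
  - apply (derivable_pt_lim_interior_max f x l (x - d) (x + d) H); [lra|].
    intros y Hy. apply Hd. apply Rabs_lt_between. unfold minus, plus, opp; simpl. lra.
  - enough (- l = 0) by lra.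
    apply (derivable_pt_lim_interior_max (fun y => - f y) x (- l) (x - d) (x + d)); [now apply derivable_pt_lim_opp|lra|].
    intros y Hy. apply Ropp_le_contravar. apply Hd. apply Rabs_lt_between. unfold minus, plus, opp; simpl. lra.
Qed.

Lemma differentiable_pt_lim_snd (f : R -> R -> R) (x y a b : R) :
  differentiable_pt_lim f x y a b -> derivable_pt_lim (fun v => f x v) y b.
Proof.
  intros H. replace b with (a * 0 + b * 1) by ring.
  apply (derivable_pt_lim_comp_2d f (fun _ => x) (fun v => v)); [exact H| |].
  - apply derivable_pt_lim_const.
  - apply derivable_pt_lim_id.
Qed.

Lemma RtoC_Ci_pair (x y : R) : (RtoC x + Ci * RtoC y)%C = (x, y).
Proof. apply injective_projections; simpl; ring. Qed.

Lemma entire_Re_not_local_max (f : C -> C) (x y : R) : entire f -> (exists z w, f z <> f w) ->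
  ~ is_local_max_2d (fun u v => Re (f (u, v))) x y.
Proof.
  intros H (z & w & Hzw) [d Hd]. apply Hzw.
  assert (K : forall z, f z = f (x, y)).
  { apply (entire_local_max_constant f (x, y) d H (cond_pos d)). intros h Hh.
    replace ((x, y) + h)%C with ((x + Re h, y + Im h) : C) by (destruct h; reflexivity).
    apply Hd.
    - replace (x + Re h - x) with (Re h) by ring. eapply Rle_lt_trans; [apply re_le_Cmod|exact Hh].
    - replace (y + Im h - y) with (Im h) by ring. eapply Rle_lt_trans; [apply Im_le_Cmod|exact Hh]. }
  now rewrite (K z), (K w).
Qed.

Theorem lemma2p1 (xi : C -> C) (xi_riemann : is_riemann_xi xi) (tstar : R) :
  is_local_extremum (Xi xi) tstar ->
  is_saddle_point (fun sigma t : R => Re (xi (RtoC sigma + Ci * RtoC t)%C))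
    (1 / 2) tstar.
Proof.
  intros Hext.
  pose proof (xi_eq_xi_theta xi xi_riemann) as Hxi.
  destruct xi_riemann as [Hent _].
  assert (Hnc : xi 0%C <> xi 2%C) by (rewrite !Hxi; exact xi_theta_not_constant).
  destruct (proj1 (holomorphic_Cderiv _ _) (Hent (1 / 2, tstar))) as [d Hd].
  destruct (Cderiv_partials _ _ _ _ Hd) as [HRe HIm].
  split.
  - apply differentiable_pt_lim_ext with (f1 := fun u v => Re (xi (u, v))).
    { apply locally_2d_forall. intros u v. now rewrite RtoC_Ci_pair. }
    (* [- Im d] is the derivative of [Xi] at [tstar], which vanishes at an extremum. *)
    assert (E1 : Im d = 0).
    { enough (- Im d = 0) by lra.
      apply (local_extremum_derivative (Xi xi) tstar); [|exact Hext].
      apply (derivable_pt_lim_ext (fun v => Re (xi (1 / 2, v)))).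
      - intros v. unfold Xi. now rewrite RtoC_Ci_pair.
      - exact (differentiable_pt_lim_snd _ _ _ _ _ HRe). }
    (* By the Cauchy-Riemann equations, as [xi] is real on the critical line. *)
    assert (E2 : Re d = 0).
    { apply (uniqueness_limite (fun v => Im (xi (1 / 2, v))) tstar).
      - exact (differentiable_pt_lim_snd _ _ _ _ _ HIm).
      - apply (derivable_pt_lim_ext (fun _ => 0)).
        + intros v. rewrite Hxi. symmetry. apply xi_theta_critical_line.
        + apply derivable_pt_lim_const. }
    unfold is_critical_point. rewrite E1, E2, Ropp_0 in HRe. exact HRe.
  - intros [Hmax|Hmin].
    + apply (entire_Re_not_local_max xi (1 / 2) tstar Hent); [now exists 0%C, 2%C|].
      unfold is_local_max_2d in *. apply locally_2d_impl with (2 := Hmax). apply locally_2d_forall.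
      intros u v. now rewrite !RtoC_Ci_pair.
    + apply (entire_Re_not_local_max (fun s => (- (1)) * xi s)%C (1 / 2) tstar).
      * apply entire_mult; [apply entire_const|exact Hent].
      * exists 0%C, 2%C. intros E. apply Hnc.
        replace (xi 0%C) with (- (1) * (- (1) * xi 0%C))%C by ring. rewrite E. ring.
      * unfold is_local_max_2d, is_local_min_2d in *. apply locally_2d_impl with (2 := Hmin). apply locally_2d_forall.
        intros u v. rewrite !RtoC_Ci_pair. destruct (xi (u, v)), (xi (1 / 2, tstar)). simpl. lra.
Qed.
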